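(* Let $f\colon X\to Y$ be a morphism between finite spaces, $\Gamma\colon X\to X\times Y$ its graph and $\pi\colon X\times Y\to X$ the natural projection. For any quasi-coherent module $\mathcal M$ on $X$, the natural morphism $$\mathbb L\pi^*\mathcal M\overset{\mathbb L}\otimes\mathbb R\Gamma_*\mathcal O_X\to\mathbb R\Gamma_*\mathcal M$$ is an isomorphism in the derived category of $\mathcal O_{X\times Y}$-modules.
   Context: All rings are commutative with unit. A ringed finite space is a ringed space $(X,\mathcal O)$ with $X$ a finite topological space; morphisms are morphisms of ringed spaces. For $p\in X$, $U_p$ is the smallest open subset containing $p$; $p\le q$ means $q\in U_p$. The stalk is $\mathcal O_p=\mathcal O(U_p)$, with restriction morphisms $\mathcal O_p\to\mathcal O_q$ for $p\le q$. A finite space is a ringed finite space all of whose restriction morphisms are flat. An $\mathcal O$-module is quasi-coherent if it is locally a cokernel of a morphism between free modules of arbitrary rank. All spaces and morphisms are over a fixed commutative base ring $k$ (i.e. over the one-point ringed space $( *,k)$; $k=\mathbb Z$ imposes no restriction). $X\times Y=X\times_kY$ is the product topological space with $\mathcal O_{(x,y)}=\mathcal O_x\otimes_k\mathcal O_y$. The graph $\Gamma$ is the morphism with components $\mathrm{Id}_X$ and $f$. The natural morphism in the claim is the projection-formula morphism $\mathbb L\pi^*\mathcal M\overset{\mathbb L}\otimes\mathbb R\Gamma_*\mathcal O_X\to\mathbb R\Gamma_*(\mathbb L\Gamma^*\mathbb L\pi^*\mathcal M)$ followed by the identification $\mathbb L\Gamma^*\mathbb L\pi^*\mathcal M=\mathcal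 M$ coming from $\pi\circ\Gamma=\mathrm{Id}_X$. *)

(* Defs.v *)
From HB Require Import structures.
From mathcomp Require Import all_boot all_order all_algebra.
From mathcomp Require Import boolp classical_sets functions cardinality topology.

Set Implicit Arguments.
Unset Strict Implicit.
Unset Printing Implicit Defensive.

Import GRing.Theory.
Local Open Scope classical_set_scope.
Local Open Scope ring_scope.
Local Open Scope quotient_scope.

Definition mkrmorph (R S : pzRingType) (f : R -> S) (fD : zmod_morphism f)
    (fM : monoid_morphism f) : {rmorphism R -> S} :=
  HB.pack f (GRing.isZmodMorphism.Build R S f fD)
    (GRing.isMonoidMorphism.Build R S f fM).

Definition semilin (R S : pzRingType) (g : R -> S) (M : lmodType R)
    (N : lmodType S) (f : M -> N) : Prop :=
  forall a x y, f (a *: x + y) = g a *: f x + f y.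

Section Semilin.
Variables (R S : pzRingType) (g : {rmorphism R -> S}).
Variables (M : lmodType R) (N : lmodType S) (f : M -> N).
Hypothesis hf : semilin g f.
Lemma semilinD : {morph f : x y / x + y}.
Proof. by move=> x y; rewrite -[x]scale1r hf rmorph1 !scale1r. Qed.
Lemma semilin0 : f 0 = 0.
Proof.
by have /eqP := semilinD 0 0; rewrite addr0 -subr_eq0 opprD addNKr oppr_eq0 => /eqP.
Qed.
Lemma semilinZ a x : f (a *: x) = g a *: f x.
Proof. by rewrite -[a *: x]addr0 hf semilin0 addr0. Qed.
End Semilin.

(* [restr g N] is the [S]-module [N] viewed as an [R]-module through [g]. *)
Definition restr (R S : pzRingType) (g : {rmorphism R -> S})
  (N : lmodType S) : Type := N.

Section Restr.
Variables (R S : pzRingType) (g : {rmorphism R -> S}) (N : lmodType S).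
HB.instance Definition _ := GRing.Zmodule.on (restr g N).
Let sc (a : R) (n : restr g N) : restr g N := g a *: (n : N).
Fact restr_scA a b v : sc a (sc b v) = sc (a * b) v.
Proof. by rewrite /sc scalerA rmorphM. Qed.
Fact restr_sc1 : left_id 1 sc.
Proof. by move=> v; rewrite /sc rmorph1 scale1r. Qed.
Fact restr_scDr : right_distributive sc +%R.
Proof. by move=> a u v; rewrite /sc scalerDr. Qed.
Fact restr_scDl v : {morph sc^~ v : a b / a + b}.
Proof. by move=> a b; rewrite /sc rmorphD scalerDl. Qed.
HB.instance Definition _ := GRing.Zmodule_isLmodule.Build R (restr g N)
  restr_scA restr_sc1 restr_scDr restr_scDl.
Definition restrM : lmodType R := restr g N.
End Restr.

(* [tens_eq s t]: the formal sums of pure tensors [s] and [t] agree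
   in the tensor product. *)
Inductive tens_eq (R : comPzRingType) (M N : lmodType R) :
    seq (M * N) -> seq (M * N) -> Prop :=
| tens_refl s : tens_eq s s
| tens_sym s t : tens_eq s t -> tens_eq t s
| tens_trans s t u : tens_eq s t -> tens_eq t u -> tens_eq s u
| tens_cat s s' t t' : tens_eq s s' -> tens_eq t t' ->
    tens_eq (s ++ t) (s' ++ t')
| tens_catC s t : tens_eq (s ++ t) (t ++ s)
| tens_Dl m m' n : tens_eq [:: (m + m', n)] [:: (m, n); (m', n)]
| tens_Dr m n n' : tens_eq [:: (m, n + n')] [:: (m, n); (m, n')]
| tens_Z a m n : tens_eq [:: (a *: m, n)] [:: (m, a *: n)]
| tens_N m n : tens_eq [:: (- m, n); (m, n)] [::].

Section Tensor.
Variables (R : comPzRingType) (M N : lmodType R).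

Definition tens_eqb (s t : seq (M * N)) : bool := `[< tens_eq s t >].

Fact tens_eqb_refl : reflexive tens_eqb.
Proof. by move=> s; apply/asboolP; apply: tens_refl. Qed.
Fact tens_eqb_sym : symmetric tens_eqb.
Proof. by move=> s t; apply/asboolP/asboolP; apply: tens_sym. Qed.
Fact tens_eqb_trans : transitive tens_eqb.
Proof.
by move=> t s u /asboolP h /asboolP h'; apply/asboolP; apply: tens_trans h h'.
Qed.

Canonical tens_equiv :=
  EquivRel tens_eqb tens_eqb_refl tens_eqb_sym tens_eqb_trans.

Definition tensor : Type := {eq_quot tens_equiv}.
HB.instance Definition _ := Choice.on tensor.
HB.instance Definition _ := EqQuotient.on tensor.

Definition tsum (s : seq (M * N)) : tensor := \pi_tensor s.
Definition tpure (m : M) (n : N) : tensor := tsum [:: (m, n)].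

Lemma tsumP s t : tsum s = tsum t <-> tens_eq s t.
Proof.
split; first by move/eqmodP/asboolP.
by move=> h; apply/eqmodP/asboolP.
Qed.

Lemma tsum_repr (x : tensor) : tsum (repr x) = x.
Proof. exact: reprK. Qed.

Lemma repr_tsum s : tens_eq (repr (tsum s)) s.
Proof. by apply/tsumP; rewrite tsum_repr. Qed.

Definition tadd (x y : tensor) : tensor := tsum (repr x ++ repr y).
Definition topp (x : tensor) : tensor :=
  tsum [seq (- u.1, u.2) | u <- repr x].

Lemma tadd_sum s t : tadd (tsum s) (tsum t) = tsum (s ++ t).
Proof. by apply/tsumP; apply: tens_cat; apply: repr_tsum. Qed.

Lemma tens_ind0 (P : tensor -> Prop) :
  (forall s, P (tsum s)) -> forall x, P x.
Proof. by move=> H x; rewrite -(tsum_repr x). Qed.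

Fact taddA : associative tadd.
Proof.
by elim/tens_ind0=> x; elim/tens_ind0=> y; elim/tens_ind0=> z;
  rewrite !tadd_sum catA.
Qed.
Fact taddC : commutative tadd.
Proof.
elim/tens_ind0=> x; elim/tens_ind0=> y.
by rewrite !tadd_sum; apply/tsumP; apply: tens_catC.
Qed.
Fact tadd0 : left_id (tsum [::]) tadd.
Proof. by elim/tens_ind0=> x; rewrite tadd_sum. Qed.
Fact taddN : left_inverse (tsum [::]) topp tadd.
Proof.
move=> x; rewrite /topp -{2}(tsum_repr x) tadd_sum; apply/tsumP.
elim: (repr x) => [|[m n] s IHs] /=; first exact: tens_refl.
rewrite -[_ :: _ ++ _]/([:: (- m, n)] ++ ([seq (- u.1, u.2) | u <- s] ++ _)).
rewrite -(cat1s (m, n) s) catA catA -(catA [:: (- m, n)]).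
apply: tens_trans (_ : tens_eq (([:: (- m, n)] ++ [:: (m, n)]) ++ ([seq (- u.1, u.2) | u <- s] ++ s)) _).
  rewrite -!catA; apply: tens_cat; first exact: tens_refl.
  rewrite !catA; apply: tens_cat; last exact: tens_refl.
  exact: tens_catC.
rewrite -[[::]]cats0; apply: tens_cat IHs; exact: tens_N.
Qed.

HB.instance Definition _ := GRing.isZmodule.Build tensor
  taddA taddC tadd0 taddN.

Lemma tsumE s : tsum s = \sum_(u <- s) tpure u.1 u.2.
Proof.
elim: s => [|[m n] s IHs]; first by rewrite big_nil.
by rewrite big_cons -IHs -[LHS]/(tsum ([:: (m, n)] ++ s)) -tadd_sum.
Qed.

Lemma tensor_ind (P : tensor -> Prop) :
  P 0 -> (forall x y, P x -> P y -> P (x + y)) ->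
  (forall m n, P (tpure m n)) -> forall x, P x.
Proof.
move=> P0 PD Pp; elim/tens_ind0=> s; rewrite tsumE.
by elim/big_ind: _ => // -[].
Qed.

Lemma tpureDl n : {morph tpure^~ n : m m' / m + m'}.
Proof.
by move=> m m'; rewrite /tpure -[RHS]/(tadd _ _) tadd_sum; apply/tsumP/tens_Dl.
Qed.
Lemma tpureDr m : {morph tpure m : n n' / n + n'}.
Proof.
by move=> n n'; rewrite /tpure -[RHS]/(tadd _ _) tadd_sum; apply/tsumP/tens_Dr.
Qed.
Lemma tpureZ a m n : tpure (a *: m) n = tpure m (a *: n).
Proof. by apply/tsumP/tens_Z. Qed.

(* [tlift b] is the additive map induced by [b] on the tensor product, when
   [b] is balanced. *)
Definition tlift (V : zmodType) (b : M -> N -> V) (x : tensor) : V :=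
  \sum_(u <- repr x) b u.1 u.2.

Definition balanced (V : zmodType) (b : M -> N -> V) : Prop :=
  [/\ forall m m' n, b (m + m') n = b m n + b m' n,
      forall m n n', b m (n + n') = b m n + b m n' &
      forall a m n, b (a *: m) n = b m (a *: n)].

Section Lift.
Variables (V : zmodType) (b : M -> N -> V).
Hypothesis hb : balanced b.

Lemma tlift_sum s : tlift b (tsum s) = \sum_(u <- s) b u.1 u.2.
Proof.
have [bDl bDr bZ] := hb.
rewrite /tlift; move: (repr_tsum s); move: (repr _) => r; elim=> // {r s}.
- by move=> s1 t u _ -> _ ->.
- by move=> s1 s' t t' _ h _ h'; rewrite !big_cat /= h h'.
- by move=> s1 t; rewrite !big_cat /= addrC.
- by move=> m m' n; rewrite !big_cons !big_nil /= !addr0 bDl.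
- by move=> m m' n; rewrite !big_cons !big_nil /= !addr0 bDr.
- by move=> a m n; rewrite !big_cons !big_nil /= !addr0 bZ.
move=> m n; rewrite !big_cons !big_nil /= !addr0 -bDl addNr.
by have /eqP := bDl 0 0 n; rewrite addr0 -subr_eq0 opprD addNKr oppr_eq0 => /eqP.
Qed.

Lemma tlift_pure m n : tlift b (tpure m n) = b m n.
Proof. by rewrite tlift_sum big_cons big_nil addr0. Qed.

Lemma tliftD : {morph tlift b : x y / x + y}.
Proof.
elim/tens_ind0=> s; elim/tens_ind0=> t.
by rewrite -[tsum s + _]/(tadd _ _) tadd_sum !tlift_sum big_cat.
Qed.

Lemma tlift0 : tlift b 0 = 0.
Proof. by rewrite -[0]/(tsum [::]) tlift_sum big_nil. Qed.

Lemma tliftN : {morph tlift b : x / - x}.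
Proof.
by move=> x; apply/eqP; rewrite -subr_eq0 opprK -tliftD addNr tlift0.
Qed.
Lemma tliftB : {morph tlift b : x y / x - y}.
Proof. by move=> x y; rewrite tliftD tliftN. Qed.
End Lift.

Lemma tens_ext (V : zmodType) (f g : tensor -> V) :
  {morph f : x y / x + y} -> {morph g : x y / x + y} ->
  (forall m n, f (tpure m n) = g (tpure m n)) -> f =1 g.
Proof.
move=> fD gD fg; have z (h : tensor -> V) : {morph h : x y / x + y} -> h 0 = 0 :> V.
  by move=> hD; have /eqP := hD 0 0; rewrite /= addr0 -subr_eq0 opprD addNKr oppr_eq0 => /eqP.
elim/tensor_ind => [|x y hx hy|//]; first by rewrite !z.
by rewrite fD gD hx hy.
Qed.

Let sc (a : R) := tlift (fun m n => tpure (a *: m) n).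
Let sc_bal a : balanced (fun m n => tpure (a *: m) n).
Proof.
split=> [m m' n|m n n'|c m n]; first by rewrite scalerDr tpureDl.
  exact: tpureDr.
by rewrite scalerA mulrC -scalerA tpureZ.
Qed.
Let scD a : {morph sc a : x y / x + y} := tliftD (sc_bal a).
Let sc_pure a m n : sc a (tpure m n) = tpure (a *: m) n := tlift_pure (sc_bal a) m n.

Fact tscA a b v : sc a (sc b v) = sc (a * b) v.
Proof.
elim/tensor_ind: v => [|x y|m n]; rewrite ?scD; first by rewrite /sc !tlift0.
  by move=> -> ->.
by rewrite !sc_pure scalerA.
Qed.
Fact tsc1 : left_id 1 sc.
Proof.
elim/tensor_ind => [|x y|m n]; rewrite ?scD; first by rewrite /sc !tlift0.
  by move=> -> ->.
by rewrite !sc_pure scale1r.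
Qed.
Fact tscDr : right_distributive sc +%R.
Proof. by move=> a x y; rewrite scD. Qed.
Fact tscDl v : {morph sc^~ v : a b / a + b}.
Proof.
move=> a b; elim/tensor_ind: v => [|x y|m n]; rewrite ?scD.
- by rewrite /sc !tlift0 // addr0.
- by move=> -> ->; rewrite addrACA.
by rewrite !sc_pure scalerDl tpureDl.
Qed.

HB.instance Definition _ := GRing.Zmodule_isLmodule.Build R tensor
  tscA tsc1 tscDr tscDl.

Definition tens : lmodType R := tensor.

Lemma tpureZl a m n : a *: tpure m n = tpure (a *: m) n.
Proof. exact: sc_pure. Qed.
Lemma tpureZr a m n : a *: tpure m n = tpure m (a *: n).
Proof. by rewrite tpureZl tpureZ. Qed.

End Tensor.
Arguments tpure {R M N}.
Arguments tensor {R} M N.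
Arguments tens {R} M N.

(* [tmap f h] is [f (x) h], when [f] and [h] are semilinear over the same ring
   morphism. *)
Section TMap.
Variables (R S : comPzRingType).
Variables (M N : lmodType R) (M' N' : lmodType S).

Definition tmap (f : M -> M') (h : N -> N') : tens M N -> tens M' N' :=
  tlift (fun m n => tpure (f m) (h n)).

Variables (g : {rmorphism R -> S}) (f : M -> M') (h : N -> N').
Hypotheses (hf : semilin g f) (hh : semilin g h).

Lemma tmap_bal : balanced (fun m n => tpure (f m) (h n)).
Proof.
split=> [m m' n|m n n'|c m n]; first by rewrite (semilinD hf) tpureDl.
  by rewrite (semilinD hh) tpureDr.
by rewrite (semilinZ hf) (semilinZ hh) tpureZ.
Qed.

Lemma tmap_pure m n : tmap f h (tpure m n) = tpure (f m) (h n).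
Proof. exact: (tlift_pure tmap_bal). Qed.
Lemma tmapD : {morph tmap f h : x y / x + y}.
Proof. exact: (tliftD tmap_bal). Qed.
Lemma tmap0 : tmap f h 0 = 0.
Proof. exact: (tlift0 tmap_bal). Qed.
Lemma tmap_semilin : semilin g (tmap f h).
Proof.
move=> a x y; rewrite tmapD; congr +%R.
elim/tensor_ind: x => [|x x' hx hx'|m n]; first by rewrite scaler0 tmap0 scaler0.
  by rewrite scalerDr !tmapD scalerDr hx hx'.
by rewrite tpureZl !tmap_pure (semilinZ hf) /= tpureZl.
Qed.
End TMap.

Section AlgTensor.
Variables (k A B : comPzRingType).
Variables (al : {rmorphism k -> A}) (be : {rmorphism k -> B}).

Definition atensor : Type := tensor (restr al A^o) (restr be B^o).
HB.instance Definition _ := GRing.Zmodule.on atensor.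

Definition apure (a : A) (b : B) : atensor :=
  @tpure _ (restr al A^o) (restr be B^o) a b.

Lemma apureDl b : {morph apure^~ b : a a' / a + a'}.
Proof. exact: (@tpureDl _ (restr al A^o) (restr be B^o)). Qed.
Lemma apureDr a : {morph apure a : b b' / b + b'}.
Proof. exact: (@tpureDr _ (restr al A^o) (restr be B^o)). Qed.
Lemma apureZ c a b : apure (al c * a) b = apure a (be c * b).
Proof. exact: (@tpureZ _ (restr al A^o) (restr be B^o)). Qed.

Definition amul (x y : atensor) : atensor :=
  @tlift _ (restr al A^o) (restr be B^o) atensor
    (fun a b => @tlift _ (restr al A^o) (restr be B^o) atensor
      (fun a' b' => apure ((a : A) * (a' : A)) ((b : B) * (b' : B))) y) x.

Let amul_bal1 (a : A) (b : B) :
  @balanced _ (restr al A^o) (restr be B^o) atensor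
    (fun a' b' => apure (a * (a' : A)) (b * (b' : B))).
Proof.
split=> [m m' n|m n n'|c m n]; first by rewrite mulrDr apureDl.
  by rewrite mulrDr apureDr.
by rewrite [X in apure X _]mulrCA apureZ; congr apure; exact: mulrCA.
Qed.

Let amul_bal2 (y : atensor) :
  @balanced _ (restr al A^o) (restr be B^o) atensor
    (fun a b => @tlift _ (restr al A^o) (restr be B^o) atensor
      (fun a' b' => apure ((a : A) * (a' : A)) ((b : B) * (b' : B))) y).
Proof.
split=> [m m' n|m n n'|c m n]; elim/tensor_ind: y => [|x y hx hy|a b].
all: try by rewrite !(tlift0 (amul_bal1 _ _)) ?addr0.
all: try by rewrite !(tliftD (amul_bal1 _ _)) hx hy // addrACA.
all: rewrite !(tlift_pure (amul_bal1 _ _)).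
- by rewrite mulrDl apureDl.
- by rewrite mulrDl apureDr.
- rewrite -[(c *: m : A)]/(al c * (m : A)) -[(c *: n : B)]/(be c * (n : B)).
  by rewrite -!mulrA apureZ.
Qed.

Lemma amulDl (x x' y : atensor) : amul (x + x') y = amul x y + amul x' y.
Proof. exact: (tliftD (amul_bal2 y)). Qed.
Lemma amul_pure a b a' b' :
  amul (apure a b) (apure a' b') = apure (a * a') (b * b').
Proof.
by rewrite /amul (tlift_pure (amul_bal2 _)) (tlift_pure (amul_bal1 _ _)).
Qed.
Let amul0l y : amul 0 y = 0.
Proof. exact: (tlift0 (amul_bal2 y)). Qed.

Lemma atensor_ind (P : atensor -> Prop) :
  P 0 -> (forall x y, P x -> P y -> P (x + y)) ->
  (forall a b, P (apure a b)) -> forall x, P x.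
Proof. exact: tensor_ind. Qed.

Fact amulC : commutative amul.
Proof.
have D a b y y' : amul (apure a b) (y + y') = amul (apure a b) y + amul (apure a b) y'.
  by rewrite /amul !(tlift_pure (amul_bal2 _)) (tliftD (amul_bal1 _ _)).
have z a b : amul (apure a b) 0 = 0.
  by rewrite /amul !(tlift_pure (amul_bal2 _)) (tlift0 (amul_bal1 _ _)).
have D' (x y y' : atensor) : amul x (y + y') = amul x y + amul x y'.
  elim/atensor_ind: x => [|x x' hx hx'|a b]; rewrite ?amul0l ?addr0 ?D //.
  by rewrite !amulDl hx hx' addrACA.
have z' x : amul x 0 = 0.
  elim/atensor_ind: x => [|x x' hx hx'|a b]; rewrite ?amul0l ?z //.
  by rewrite amulDl hx hx' addr0.
move=> x y; elim/atensor_ind: x => [|x x' hx hx'|a b].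
- by rewrite amul0l z'.
- by rewrite amulDl D' hx hx'.
elim/atensor_ind: y => [|y y' hy hy'|a' b'].
- by rewrite amul0l z.
- by rewrite amulDl D hy hy'.
by rewrite !amul_pure mulrC [b * _]mulrC.
Qed.
Fact amulA : associative amul.
Proof.
have Dr (x y y' : atensor) : amul x (y + y') = amul x y + amul x y'.
  by rewrite !(amulC x) amulDl.
have zr x : amul x 0 = 0 by rewrite amulC amul0l.
move=> x y z; elim/atensor_ind: x => [|x x' hx hx'|a b].
- by rewrite !amul0l.
- by rewrite !amulDl hx hx'.
elim/atensor_ind: y => [|y y' hy hy'|a' b'].
- by rewrite amul0l !zr amul0l.
- by rewrite amulDl !Dr amulDl hy hy'.
elim/atensor_ind: z => [|z z' hz hz'|a'' b''].
- by rewrite !zr.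
- by rewrite !Dr hz hz'.
by rewrite !amul_pure !mulrA.
Qed.
Fact amul1 : left_id (apure 1 1) amul.
Proof.
have Dr (x y y' : atensor) : amul x (y + y') = amul x y + amul x y'.
  by rewrite !(amulC x) amulDl.
elim/atensor_ind => [|x x' hx hx'|a b].
- by rewrite amulC amul0l.
- by rewrite Dr hx hx'.
by rewrite amul_pure !mul1r.
Qed.
Fact amulDl' : left_distributive amul +%R.
Proof. by move=> x y z; exact: amulDl. Qed.

HB.instance Definition _ := GRing.Zmodule_isComPzRing.Build atensor
  amulA amulC amul1 amulDl'.

Definition atens : comPzRingType := atensor.

Lemma apureM a b a' b' : (apure a b : atens) * apure a' b' = apure (a * a') (b * b').
Proof. exact: amul_pure. Qed.

Definition ainl_fun (a : A) : atens := apure a 1.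
Fact ainl_zmod : zmod_morphism ainl_fun.
Proof.
move=> a b; apply/eqP; rewrite eq_sym subr_eq; apply/eqP.
by rewrite /ainl_fun -apureDl subrK.
Qed.
Fact ainl_monoid : monoid_morphism ainl_fun.
Proof. by split=> // a b; rewrite /ainl_fun apureM mulr1. Qed.
Definition ainl : {rmorphism A -> atens} := mkrmorph ainl_zmod ainl_monoid.

Definition ainr_fun (b : B) : atens := apure 1 b.
Fact ainr_zmod : zmod_morphism ainr_fun.
Proof.
move=> a b; apply/eqP; rewrite eq_sym subr_eq; apply/eqP.
by rewrite /ainr_fun -apureDr subrK.
Qed.
Fact ainr_monoid : monoid_morphism ainr_fun.
Proof. by split=> // a b; rewrite /ainr_fun apureM mulr1. Qed.
Definition ainr : {rmorphism B -> atens} := mkrmorph ainr_zmod ainr_monoid.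

Lemma apureE a b : apure a b = ainl a * ainr b.
Proof. by rewrite /ainl /ainr /= /ainl_fun /ainr_fun apureM mulr1 mul1r. Qed.

Lemma ainlr c : ainl (al c) = ainr (be c).
Proof. by have := apureZ c 1 1; rewrite !mulr1. Qed.

Section Lift.
Variables (C : comPzRingType).
Variables (f : {rmorphism A -> C}) (h : {rmorphism B -> C}).
Hypothesis fh : forall c, f (al c) = h (be c).

Definition alift_fun : atens -> C :=
  @tlift _ (restr al A^o) (restr be B^o) C (fun a b => f a * h b).
Let alift_bal : @balanced _ (restr al A^o) (restr be B^o) C
  (fun a b => f a * h b).
Proof.
split=> [m m' n|m n n'|c m n]; first by rewrite rmorphD mulrDl.
  by rewrite rmorphD mulrDr.
by rewrite !rmorphM fh mulrCA mulrA.
Qed.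
Let alift_pure a b : alift_fun (apure a b) = f a * h b.
Proof. exact: (tlift_pure alift_bal). Qed.
Let alift0 : alift_fun 0 = 0.
Proof. exact: (tlift0 alift_bal). Qed.
Let aliftD : {morph alift_fun : x y / x + y}.
Proof. exact: (tliftD alift_bal). Qed.
Fact alift_zmod : zmod_morphism alift_fun.
Proof. exact: (tliftB alift_bal). Qed.
Fact alift_monoid : monoid_morphism alift_fun.
Proof.
split=> [|x y]; first by rewrite -[1]/(apure 1 1) alift_pure !rmorph1 mulr1.
elim/atensor_ind: x => [|x x' hx hx'|a b].
- by rewrite mul0r !alift0 mul0r.
- by rewrite mulrDl !aliftD hx hx' mulrDl.
elim/atensor_ind: y => [|y y' hy hy'|a' b'].
- by rewrite mulr0 !alift0 mulr0.
- by rewrite mulrDr !aliftD hy hy' mulrDr.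
by rewrite apureM !alift_pure !rmorphM mulrACA.
Qed.
Definition alift : {rmorphism atens -> C} := mkrmorph alift_zmod alift_monoid.

Lemma aliftE a b : alift (apure a b) = f a * h b.
Proof. exact: alift_pure. Qed.
Lemma alift_inl a : alift (ainl a) = f a.
Proof. by rewrite -[ainl a]/(apure a 1) aliftE rmorph1 mulr1. Qed.
Lemma alift_inr b : alift (ainr b) = h b.
Proof. by rewrite -[ainr b]/(apure 1 b) aliftE rmorph1 mul1r. Qed.
End Lift.

Lemma alift_ext (C : comPzRingType) (f h : {rmorphism atens -> C}) :
  (forall a, f (ainl a) = h (ainl a)) -> (forall b, f (ainr b) = h (ainr b)) ->
  f =1 h.
Proof.
move=> fhl fhr; elim/atensor_ind => [|x y hx hy|a b]; first by rewrite !rmorph0.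
  by rewrite !rmorphD hx hy.
by rewrite apureE !rmorphM fhl fhr.
Qed.
End AlgTensor.
Arguments ainl : simpl never.
Arguments ainr : simpl never.
Arguments alift : simpl never.

(* [bch g N] is [N (x)_R S] with its [S]-module structure. *)
Definition bch (R S : comPzRingType) (g : {rmorphism R -> S})
  (N : lmodType R) : Type := tensor N (restr g S^o).

Section BaseChange.
Variables (R S : comPzRingType) (g : {rmorphism R -> S}) (N : lmodType R).
HB.instance Definition _ := GRing.Zmodule.on (bch g N).

Definition bpure (n : N) (s : S) : bch g N := @tpure _ N (restr g S^o) n s.

Lemma bch_ind (P : bch g N -> Prop) :
  P 0 -> (forall x y, P x -> P y -> P (x + y)) ->
  (forall n s, P (bpure n s)) -> forall x, P x.
Proof. exact: tensor_ind. Qed.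

Lemma bpureDl s : {morph bpure^~ s : n n' / n + n'}.
Proof. exact: (@tpureDl _ N (restr g S^o)). Qed.
Lemma bpureDr n : {morph bpure n : s s' / s + s'}.
Proof. exact: (@tpureDr _ N (restr g S^o)). Qed.
Lemma bpureZ a n s : bpure (a *: n) s = bpure n (g a * s).
Proof. exact: (@tpureZ _ N (restr g S^o)). Qed.

Let sc (a : S) : bch g N -> bch g N :=
  @tlift _ N (restr g S^o) (bch g N) (fun n s => bpure n (a * (s : S))).
Let sc_bal (a : S) : @balanced _ N (restr g S^o) (bch g N)
  (fun n s => bpure n (a * (s : S))).
Proof.
split=> [m m' n|m n n'|c m n]; first exact: bpureDl.
  by rewrite mulrDr bpureDr.
by rewrite bpureZ mulrCA.
Qed.
Let scD a : {morph sc a : x y / x + y} := tliftD (sc_bal a).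
Let sc0 a : sc a 0 = 0 := tlift0 (sc_bal a).
Let sc_pure a n s : sc a (bpure n s) = bpure n (a * s) :=
  tlift_pure (sc_bal a) n s.

Fact bchA a b v : sc a (sc b v) = sc (a * b) v.
Proof.
elim/bch_ind: v => [|x y hx hy|m n]; first by rewrite !sc0.
  by rewrite !scD hx hy.
by rewrite !sc_pure mulrA.
Qed.
Fact bch1 : left_id 1 sc.
Proof.
elim/bch_ind => [|x y hx hy|m n]; first by rewrite !sc0.
  by rewrite !scD hx hy.
by rewrite !sc_pure mul1r.
Qed.
Fact bchDr : right_distributive sc +%R.
Proof. by move=> a x y; rewrite scD. Qed.
Fact bchDl v : {morph sc^~ v : a b / a + b}.
Proof.
move=> a b; elim/bch_ind: v => [|x y hx hy|m n]; first by rewrite !sc0 addr0.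
  by rewrite !scD hx hy addrACA.
by rewrite !sc_pure mulrDl bpureDr.
Qed.
HB.instance Definition _ := GRing.Zmodule_isLmodule.Build S (bch g N)
  bchA bch1 bchDr bchDl.

Definition bchM : lmodType S := bch g N.

Lemma bpureZr a n s : a *: bpure n s = bpure n (a * s).
Proof. exact: sc_pure. Qed.

(* [blift t h] sends [n (x) s] to [t(s) h(n)]. *)
Section BLift.
Variables (T : comPzRingType) (t : {rmorphism S -> T}) (V : lmodType T).
Definition blift (h : N -> V) : bchM -> V :=
  @tlift _ N (restr g S^o) V (fun n s => t s *: h n).
Variable h : N -> V.
Hypothesis hh : semilin (t \o g) h.
Let b_bal : @balanced _ N (restr g S^o) V (fun n s => t s *: h n).
Proof.
split=> [m m' n|m n n'|c m n]; first by rewrite (semilinD hh) scalerDr.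
  by rewrite rmorphD scalerDl.
by rewrite (semilinZ hh) /= scalerA -rmorphM mulrC.
Qed.
Lemma blift_pure n s : blift h (bpure n s) = t s *: h n.
Proof. exact: (tlift_pure b_bal). Qed.
Lemma blift0 : blift h 0 = 0. Proof. exact: (tlift0 b_bal). Qed.
Lemma bliftD : {morph blift h : x y / x + y}.
Proof. exact: (tliftD b_bal). Qed.
Lemma blift_lin : semilin t (blift h).
Proof.
move=> a x y; rewrite bliftD; congr +%R => /=.
elim/bch_ind: x => [|x x' hx hx'|m n]; first by rewrite scaler0 !blift0 scaler0.
  by rewrite scalerDr !bliftD scalerDr hx hx'.
by rewrite bpureZr !blift_pure scalerA rmorphM.
Qed.
End BLift.
End BaseChange.
Arguments bpure {R S} g {N} n s.

(* The smallest open set containing [p], when the space is finite. *)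
Definition minopen (T : topologicalType) (p : T) : set T :=
  \bigcap_(U in [set U : set T | open U /\ U p]) U.

Lemma minopen_open (T : topologicalType) (p : T) :
  finite_set [set: T] -> open (minopen p).
Proof.
move=> fT; pose W q : set (set T) := [set U | [/\ open U, U p & ~ U q]].
have H q : ~ minopen p q -> W q (get (W q)).
  move=> nq; apply: getPex; apply: contrapT => nU; apply: nq => U [oU Up].
  by apply: contrapT => nUq; apply: nU; exists U.
rewrite -[minopen p]setCK openC.
have -> : ~` minopen p = \bigcup_(q in ~` minopen p) ~` get (W q).
  apply/seteqP; split=> [q nq|q [r nr nWq] pq].
    by exists q => //; have [] := H q nq.
  by have [oU Up _] := H r nr; apply: nWq; apply: pq.
apply: closed_bigcup => [|q nq]; first exact: sub_finite_set fT.
by rewrite closedC; have [] := H q nq.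
Qed.

(* the relation [p <= q] *)
Definition spec (T : topologicalType) (p q : T) : Prop := minopen p q.

Lemma spec_refl (T : topologicalType) (p : T) : spec p p.
Proof. by move=> U []. Qed.
Arguments spec_refl {T} p.

Lemma spec_trans (T : topologicalType) (p q r : T) :
  spec p q -> spec q r -> spec p r.
Proof. by move=> pq qr U [oU Up]; apply: qr; split=> //; apply: pq. Qed.

Lemma spec_cont (S T : topologicalType) (f : S -> T) (p q : S) :
  continuous f -> spec p q -> spec (f p) (f q).
Proof.
move=> /continuousP cf pq U [oU Up].
by apply: (pq (f @^-1` U)); split=> //; apply: cf.
Qed.

(* A sheaf of [k]-algebras on a finite topological space is given by its
   stalks [O p], which are its sections on [minopen p], and by the restriction
   morphisms between them. *)
Record rfspace (k : comPzRingType) := RFSpace {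
  pt :> topologicalType;
  pt_fin : finite_set [set: pt];
  O : pt -> comPzRingType;
  ores : forall p q : pt, spec p q -> {rmorphism O p -> O q};
  ores_id : forall p (h : spec p p) a, ores h a = a;
  ores_comp : forall p q r (h : spec p q) (h' : spec q r) (h'' : spec p r) a,
    ores h' (ores h a) = ores h'' a;
  okalg : forall p, {rmorphism k -> O p};
  ores_k : forall p q (h : spec p q) c, ores h (okalg p c) = okalg q c
}.
Arguments O {k} _ _.
Arguments ores {k _ _ _} _.
Arguments okalg {k _} _.

Definition flat_morphism (A B : comPzRingType) (g : {rmorphism A -> B}) : Prop :=
  forall (N N' : lmodType A) (u : {linear N -> N'}), injective u ->
  injective (tmap u id : tens N (restrM g B^o) -> tens N' (restrM g B^o)).

Definition finite_space (k : comPzRingType) (X : rfspace k) : Prop :=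
  forall (p q : X) (h : spec p q), flat_morphism (ores h).

(* The morphism [O_Y -> f_* O_X] is given by the morphisms
   [O_(Y, f x) -> O_(X, x)] it induces on the stalks. *)
Record rfmor (k : comPzRingType) (X Y : rfspace k) := RFMor {
  fpt :> X -> Y;
  fcont : continuous fpt;
  fsh : forall x, {rmorphism O Y (fpt x) -> O X x};
  fsh_nat : forall x x' (h : spec x x') (h' : spec (fpt x) (fpt x')) a,
    fsh x' (ores h' a) = ores h (fsh x a);
  fsh_k : forall x c, fsh x (okalg (fpt x) c) = okalg x c
}.
Arguments fsh {k X Y} _ _.

Section Product.
Variables (k : comPzRingType) (X Y : rfspace k).

Definition prod_pt : topologicalType := (X * Y)%type.

Fact prod_fin : finite_set [set: prod_pt].
Proof. by rewrite -setXTT; apply: finite_setX; apply: pt_fin. Qed.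

Lemma fst_cont : continuous (fst : prod_pt -> X).
Proof. by move=> [x y]; apply: cvg_fst. Qed.
Lemma snd_cont : continuous (snd : prod_pt -> Y).
Proof. by move=> [x y]; apply: cvg_snd. Qed.

Definition prod_O (z : prod_pt) : comPzRingType :=
  atens (@okalg k X z.1) (@okalg k Y z.2).

Section Res.
Variables (z z' : prod_pt) (h : spec z z').
Definition prod_resl : {rmorphism O X z.1 -> prod_O z'} :=
  ainl (okalg z'.1) (okalg z'.2) \o ores (spec_cont fst_cont h).
Definition prod_resr : {rmorphism O Y z.2 -> prod_O z'} :=
  ainr (okalg z'.1) (okalg z'.2) \o ores (spec_cont snd_cont h).
Fact prod_resP c : prod_resl (okalg z.1 c) = prod_resr (okalg z.2 c).
Proof. by rewrite /prod_resl /prod_resr /= !ores_k; apply: ainlr. Qed.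
Definition prod_res : {rmorphism prod_O z -> prod_O z'} := alift prod_resP.
End Res.

Definition prod_inl (z : prod_pt) : {rmorphism O X z.1 -> prod_O z} :=
  ainl (okalg z.1) (okalg z.2).
Definition prod_inr (z : prod_pt) : {rmorphism O Y z.2 -> prod_O z} :=
  ainr (okalg z.1) (okalg z.2).

Arguments prod_inl : simpl never.
Arguments prod_inr : simpl never.
Arguments prod_res : simpl never.

Lemma prod_ext z (C : comPzRingType) (f g : {rmorphism prod_O z -> C}) :
  (forall a, f (prod_inl z a) = g (prod_inl z a)) ->
  (forall b, f (prod_inr z b) = g (prod_inr z b)) -> f =1 g.
Proof. exact: alift_ext. Qed.

Lemma prod_res_l z z' (h : spec z z') (h' : spec z.1 z'.1) a :
  prod_res h (prod_inl z a) = prod_inl z' (ores h' a).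
Proof.
rewrite (Prop_irrelevance h' (spec_cont fst_cont h)).
exact: (alift_inl (prod_resP h)).
Qed.
Lemma prod_res_r z z' (h : spec z z') (h' : spec z.2 z'.2) a :
  prod_res h (prod_inr z a) = prod_inr z' (ores h' a).
Proof.
rewrite (Prop_irrelevance h' (spec_cont snd_cont h)).
exact: (alift_inr (prod_resP h)).
Qed.

Fact prod_res_id z (h : spec z z) a : prod_res h a = a.
Proof.
move: a; apply: (prod_ext (g := idfun)) => a.
  by rewrite (prod_res_l _ (spec_refl _)) ores_id.
by rewrite (prod_res_r _ (spec_refl _)) ores_id.
Qed.

Fact prod_res_comp p q r (h : spec p q) (h' : spec q r) (h'' : spec p r) a :
  prod_res h' (prod_res h a) = prod_res h'' a.
Proof.
have l (z z' : prod_pt) (hz : spec z z') := spec_cont fst_cont hz.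
have r' (z z' : prod_pt) (hz : spec z z') := spec_cont snd_cont hz.
move: a; apply: (prod_ext (f := prod_res h' \o prod_res h)) => a.
  rewrite -[LHS]/(prod_res h' (prod_res h (prod_inl p a))).
  rewrite (prod_res_l h (l _ _ h)) (prod_res_l h' (l _ _ h')).
  by rewrite (prod_res_l h'' (l _ _ h'')) (ores_comp _ _ (l _ _ h'')).
rewrite -[LHS]/(prod_res h' (prod_res h (prod_inr p a))).
rewrite (prod_res_r h (r' _ _ h)) (prod_res_r h' (r' _ _ h')).
by rewrite (prod_res_r h'' (r' _ _ h'')) (ores_comp _ _ (r' _ _ h'')).
Qed.

Definition prod_k (z : prod_pt) : {rmorphism k -> prod_O z} :=
  prod_inl z \o okalg z.1.

Fact prod_res_k p q (h : spec p q) c : prod_res h (prod_k p c) = prod_k q c.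
Proof.
rewrite -[LHS]/(prod_res h (prod_inl p (okalg p.1 c))).
by rewrite (prod_res_l h (spec_cont fst_cont h)) ores_k.
Qed.

Definition prodS : rfspace k :=
  RFSpace prod_fin prod_res_id prod_res_comp prod_res_k.

Fact proj1_nat (z z' : prodS) (h : spec z z') (h' : spec z.1 z'.1) a :
  prod_inl z' (ores h' a) = ores h (prod_inl z a).
Proof. exact/esym/(prod_res_l h). Qed.

Definition proj1S : rfmor prodS X := 
  @RFMor k prodS X fst fst_cont prod_inl proj1_nat (fun _ _ => erefl).
End Product.

Section Graph.
Variables (k : comPzRingType) (X Y : rfspace k) (f : rfmor X Y).

Definition graph_pt (x : X) : prodS X Y := (x, f x).

Fact graph_cont : continuous graph_pt.
Proof. by move=> x; apply: cvg_pair; [apply: cvg_id|apply: fcont]. Qed.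

Fact graph_shP (x : X) c :
  (idfun : {rmorphism O X x -> O X x}) (okalg x c) = fsh f x (okalg (f x) c).
Proof. by rewrite fsh_k. Qed.

(* [a (x) b |-> a f^#(b)] *)
Definition graph_sh (x : X) : {rmorphism O (prodS X Y) (graph_pt x) -> O X x} :=
  alift (@graph_shP x).

Arguments graph_sh : simpl never.
Lemma graph_shl x a : graph_sh x (prod_inl (graph_pt x) a) = a.
Proof. exact: (alift_inl (@graph_shP x)). Qed.
Lemma graph_shr x a : graph_sh x (prod_inr (graph_pt x) a) = fsh f x a.
Proof. exact: (alift_inr (@graph_shP x)). Qed.

Fact graph_nat x x' (h : spec x x') (h' : spec (graph_pt x) (graph_pt x')) a :
  graph_sh x' (ores h' a) = ores h (graph_sh x a).
Proof.
move: a; apply: (prod_ext (f := graph_sh x' \o ores h')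
  (g := ores h \o graph_sh x)) => a.
  rewrite -[LHS]/(graph_sh x' (prod_res h' (prod_inl (graph_pt x) a))).
  rewrite -[RHS]/(ores h (graph_sh x (prod_inl (graph_pt x) a))).
  by rewrite (prod_res_l h' h) !graph_shl.
rewrite -[LHS]/(graph_sh x' (prod_res h' (prod_inr (graph_pt x) a))).
rewrite -[RHS]/(ores h (graph_sh x (prod_inr (graph_pt x) a))).
rewrite (prod_res_r h' (spec_cont (@fcont _ _ _ f) h)) !graph_shr.
exact: fsh_nat.
Qed.

Fact graph_k x c : graph_sh x (okalg (graph_pt x) c) = okalg x c.
Proof. exact: graph_shl. Qed.

Definition graphS : rfmor X (prodS X Y) := 
  @RFMor k X (prodS X Y) graph_pt graph_cont graph_sh graph_nat graph_k.
End Graph.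

(* As for the structure sheaf, a sheaf of modules is given by its stalks
   and the restriction morphisms between them. *)
Record omod (k : comPzRingType) (X : rfspace k) := OMod {
  ost :> forall p : X, lmodType (O X p);
  mres : forall p q : X, spec p q -> ost p -> ost q;
  mres_lin : forall p q (h : spec p q), semilin (ores h) (mres h);
  mres_id : forall p (h : spec p p) m, mres h m = m;
  mres_comp : forall p q r (h : spec p q) (h' : spec q r) (h'' : spec p r) m,
    mres h' (mres h m) = mres h'' m
}.
Arguments mres {k X} _ {p q} h m.

Record ohom (k : comPzRingType) (X : rfspace k) (M N : omod X) := OHom {
  oh :> forall p : X, M p -> N p;
  oh_lin : forall p, linear (@oh p);
  oh_nat : forall p q (h : spec p q) m,
    @oh q (mres M h m) = mres N h (@oh p m)
}.
Arguments oh {k X M N} _ p m.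

Section OmodTheory.
Variables (k : comPzRingType) (X : rfspace k).

Lemma mresD (M : omod X) p q (h : spec p q) : {morph mres M h : x y / x + y}.
Proof. exact: semilinD (mres_lin _). Qed.
Lemma mres0 (M : omod X) p q (h : spec p q) : mres M h 0 = 0.
Proof. exact: semilin0 (mres_lin _). Qed.
Lemma mresZ (M : omod X) p q (h : spec p q) a x :
  mres M h (a *: x) = ores h a *: mres M h x.
Proof. exact: semilinZ (mres_lin _) _ _. Qed.

Lemma linear_semilin (R : pzRingType) (M N : lmodType R) (f : M -> N) :
  linear f -> semilin (idfun : {rmorphism R -> R}) f.
Proof. by []. Qed.

Variables (M N : omod X) (f : ohom M N).
Lemma oh_semilin p : semilin (idfun : {rmorphism O X p -> O X p}) (f p).
Proof. exact: linear_semilin (@oh_lin _ _ _ _ f p). Qed.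
Lemma ohD p : {morph f p : x y / x + y}.
Proof. exact: semilinD (@oh_semilin p). Qed.
Lemma oh0 p : f p 0 = 0.
Proof. exact: semilin0 (@oh_semilin p). Qed.
Lemma ohZ p a x : f p (a *: x) = a *: f p x.
Proof. exact: (semilinZ (@oh_semilin p)). Qed.
End OmodTheory.

Section BasicMods.
Variables (k : comPzRingType) (X : rfspace k).

Definition ounit : omod X.
Proof.
refine (@OMod k X (fun p => (O X p)^o) (fun p q h => ores h) _ _ _).
- by move=> p q h a x y; rewrite rmorphD rmorphM.
- exact: ores_id.
- exact: ores_comp.
Defined.

Definition ozero : omod X.
Proof.
refine (@OMod k X (fun p => 'rV[O X p]_0) (fun p q h _ => 0) _ _ _) => //.
- by move=> p q h a x y; rewrite scaler0 addr0.
- by move=> p h m; rewrite [m]thinmx0.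
Defined.

Definition ohom_id (M : omod X) : ohom M M := @OHom k X M M (fun p x => x)
  (fun p a x y => erefl) (fun p q h m => erefl).

Definition ohom_comp (M N L : omod X) (g : ohom N L) (f : ohom M N) : ohom M L.
Proof.
refine (@OHom k X M L (fun p x => g p (f p x)) _ _).
- by move=> p a x y; rewrite !oh_lin.
- by move=> p q h m; rewrite !oh_nat.
Defined.

Definition ohom0 (M N : omod X) : ohom M N.
Proof.
refine (@OHom k X M N (fun p x => 0) _ _).
- by move=> p a x y; rewrite scaler0 addr0.
- by move=> p q h m; rewrite mres0.
Defined.
End BasicMods.
Arguments ounit {k X}.
Arguments ozero {k X}.

Section TmapComp.
Variables (R S T : comPzRingType) (g : {rmorphism R -> S}) (g' : {rmorphism S -> T}).
Variables (M N : lmodType R) (M' N' : lmodType S) (M'' N'' : lmodType T).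
Variables (f : M -> M') (h : N -> N') (f' : M' -> M'') (h' : N' -> N'').
Hypotheses (hf : semilin g f) (hh : semilin g h).
Hypotheses (hf' : semilin g' f') (hh' : semilin g' h').
Lemma tmap_comp x :
  tmap f' h' (tmap f h x) = tmap (f' \o f) (h' \o h) x.
Proof.
have hfc : semilin (g' \o g : {rmorphism R -> T}) (f' \o f).
  by move=> a u v /=; rewrite hf hf'.
have hhc : semilin (g' \o g : {rmorphism R -> T}) (h' \o h).
  by move=> a u v /=; rewrite hh hh'.
elim/tensor_ind: x => [|x y hx hy|m n].
- by rewrite (tmap0 hf hh) (tmap0 hf' hh') (tmap0 hfc hhc).
- by rewrite (tmapD hf hh) (tmapD hf' hh') (tmapD hfc hhc) hx hy.
by rewrite (tmap_pure hf hh) (tmap_pure hf' hh') (tmap_pure hfc hhc).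
Qed.
End TmapComp.

Lemma tmap_id (R : comPzRingType) (M N : lmodType R) (x : tens M N) :
  tmap (fun m => m) (fun n => n) x = x.
Proof.
have hM : semilin (idfun : {rmorphism R -> R}) (fun m : M => m) by [].
have hN : semilin (idfun : {rmorphism R -> R}) (fun n : N => n) by [].
elim/tensor_ind: x => [|x y hx hy|m n]; first exact: (tmap0 hM hN).
  by rewrite (tmapD hM hN) hx hy.
exact: (tmap_pure hM hN).
Qed.

Lemma eq_tmap (R S : comPzRingType) (M N : lmodType R) (M' N' : lmodType S)
  (f f' : M -> M') (h h' : N -> N') : f =1 f' -> h =1 h' ->
  tmap f h =1 tmap f' h'.
Proof. by move=> /funext -> /funext ->. Qed.

Section OTens.
Variables (k : comPzRingType) (X : rfspace k).

Definition otens (M N : omod X) : omod X.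
Proof.
refine (@OMod k X (fun p => tens (M p) (N p))
  (fun p q h => tmap (mres M h) (mres N h)) _ _ _).
- by move=> p q h; apply: tmap_semilin; apply: mres_lin.
- move=> p h m; rewrite -[RHS]tmap_id; apply: eq_tmap => x; exact: mres_id.
- move=> p q r h h' h'' m.
  rewrite (tmap_comp (g := ores h) (g' := ores h')); try exact: mres_lin.
  by apply: eq_tmap => x; apply: mres_comp.
Defined.

Definition otens_map (M M' N N' : omod X) (f : ohom M M') (g : ohom N N') :
  ohom (otens M N) (otens M' N').
Proof.
refine (@OHom k X (otens M N) (otens M' N') (fun p => tmap (f p) (g p)) _ _).
- move=> p; apply: (@tmap_semilin _ _ _ _ _ _ idfun); exact: oh_semilin.
- move=> p q h m /=.
  rewrite (tmap_comp (g := ores h) (g' := idfun)); try exact: mres_lin;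
    try exact: oh_semilin.
  rewrite (tmap_comp (g := idfun) (g' := ores h)); try exact: mres_lin;
    try exact: oh_semilin.
  by apply: eq_tmap => x; apply: oh_nat.
Defined.
End OTens.

(* Finitely supported families vanishing outside of [Q] *)
Record dsum (I : choiceType) (Q : pred I) (R : pzRingType)
    (V : I -> lmodType R) := DSum {
  dfam :> forall i, V i;
  dfam_out : forall i, ~~ Q i -> dfam i = 0;
  dfam_fin : exists s : seq I, forall i, i \notin s -> dfam i = 0
}.

HB.instance Definition _ I Q R V := gen_eqMixin (@dsum I Q R V).
HB.instance Definition _ I Q R V := gen_choiceMixin (@dsum I Q R V).

Section DSum.
Variables (I : choiceType) (Q : pred I) (R : pzRingType) (V : I -> lmodType R).
Implicit Types x y : dsum Q V.

Lemma dsum_ext x y : (forall i, x i = y i) -> x = y.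
Proof.
case: x y => [x xo xf] [y yo yf] /= xy.
have {}xy : x = y by apply: functional_extensionality_dep.
by case: y / xy yo yf => yo yf; congr DSum; apply: Prop_irrelevance.
Qed.

Definition ds0 : dsum Q V.
Proof. by exists (fun i => 0) => //; exists [::]. Defined.
Definition dsopp x : dsum Q V.
Proof.
exists (fun i => - x i); first by move=> i Qi; rewrite dfam_out ?oppr0.
by have [s hs] := dfam_fin x; exists s => i /hs ->; rewrite oppr0.
Defined.
Definition dsadd x y : dsum Q V.
Proof.
exists (fun i => x i + y i); first by move=> i Qi; rewrite !dfam_out ?addr0.
have [s hs] := dfam_fin x; have [t ht] := dfam_fin y.
exists (s ++ t) => i; rewrite mem_cat negb_or => /andP[/hs -> /ht ->].
by rewrite addr0.
Defined.
Definition dsscale (a : R) x : dsum Q V.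
Proof.
exists (fun i => a *: x i); first by move=> i Qi; rewrite dfam_out ?scaler0.
by have [s hs] := dfam_fin x; exists s => i /hs ->; rewrite scaler0.
Defined.

Fact dsaddA : associative dsadd.
Proof. by move=> x y z; apply: dsum_ext => i /=; rewrite addrA. Qed.
Fact dsaddC : commutative dsadd.
Proof. by move=> x y; apply: dsum_ext => i /=; rewrite addrC. Qed.
Fact dsadd0 : left_id ds0 dsadd.
Proof. by move=> x; apply: dsum_ext => i /=; rewrite add0r. Qed.
Fact dsaddN : left_inverse ds0 dsopp dsadd.
Proof. by move=> x; apply: dsum_ext => i /=; rewrite addNr. Qed.
HB.instance Definition _ := GRing.isZmodule.Build (dsum Q V)
  dsaddA dsaddC dsadd0 dsaddN.
Fact dsscaleA a b x : dsscale a (dsscale b x) = dsscale (a * b) x.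
Proof. by apply: dsum_ext => i /=; rewrite scalerA. Qed.
Fact dsscale1 : left_id 1 dsscale.
Proof. by move=> x; apply: dsum_ext => i /=; rewrite scale1r. Qed.
Fact dsscaleDr : right_distributive dsscale +%R.
Proof. by move=> a x y; apply: dsum_ext => i /=; rewrite scalerDr. Qed.
Fact dsscaleDl x : {morph dsscale^~ x : a b / a + b}.
Proof. by move=> a b; apply: dsum_ext => i /=; rewrite scalerDl. Qed.
HB.instance Definition _ := GRing.Zmodule_isLmodule.Build R (dsum Q V)
  dsscaleA dsscale1 dsscaleDr dsscaleDl.
Definition dsumM : lmodType R := dsum Q V.
End DSum.
Arguments dsumM {I} Q {R} V.

Section ODsum.
Variables (k : comPzRingType) (X : rfspace k).

Section Res.
Variables (R S : pzRingType) (g : {rmorphism R -> S}).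
Variables (I : choiceType) (Q : pred I).
Variables (V : I -> lmodType R) (W : I -> lmodType S) (f : forall i, V i -> W i).
Hypothesis hf : forall i, semilin g (@f i).
Definition dsmap (x : dsum Q V) : dsum Q W.
Proof.
exists (fun i => f (x i)); first by move=> i Qi; rewrite dfam_out ?(semilin0 (@hf i)).
by have [s hs] := dfam_fin x; exists s => i /hs ->; rewrite (semilin0 (@hf i)).
Defined.
Lemma dsmap_semilin : @semilin R S g (dsumM Q V) (dsumM Q W) dsmap.
Proof. by move=> a x y; apply: dsum_ext => i /=; rewrite hf. Qed.
End Res.

Definition odsum (I : choiceType) (Q : pred I) (M : I -> omod X) : omod X.
Proof.
refine (@OMod k X (fun p => dsumM Q (fun i => M i p))
  (fun p q h => dsmap (fun i => @mres_lin _ _ (M i) _ _ h)) _ _ _).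
- by move=> p q h; apply: dsmap_semilin.
- by move=> p h m; apply: dsum_ext => i; apply: mres_id.
- by move=> p q r h h' h'' m; apply: dsum_ext => i; apply: mres_comp.
Defined.

Definition odsum_map (I : choiceType) (Q : pred I) (M N : I -> omod X)
  (f : forall i, ohom (M i) (N i)) : ohom (odsum Q M) (odsum Q N).
Proof.
refine (@OHom k X (odsum Q M) (odsum Q N)
  (fun p => dsmap (fun i => oh_semilin (f i) (p := p))) _ _).
- by move=> p; apply: dsmap_semilin.
- by move=> p q h m; apply: dsum_ext => i; apply: oh_nat.
Defined.

Definition ofree (I : choiceType) : omod X :=
  odsum (predT : pred I) (fun _ => ounit).
End ODsum.

(* [gsec f M y]: the sections of [M] on the preimage of [minopen y] *)
Record gsec (k : comPzRingType) (X Y : rfspace k) (f : rfmor X Y) (M : omod X)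
    (y : Y) := GSec {
  sfam :> forall x : X, minopen y (f x) -> M x;
  sfam_res : forall x x' (h : spec x x') (u : minopen y (f x))
    (u' : minopen y (f x')), mres M h (sfam u) = sfam u'
}.

HB.instance Definition _ k X Y f M y := gen_eqMixin (@gsec k X Y f M y).
HB.instance Definition _ k X Y f M y := gen_choiceMixin (@gsec k X Y f M y).

Section GSec.
Variables (k : comPzRingType) (X Y : rfspace k) (f : rfmor X Y) (M : omod X).
Variable (y : Y).
Implicit Types s t : gsec f M y.

Lemma gsec_ext s t : (forall x u, s x u = t x u) -> s = t.
Proof.
case: s t => [s hs] [t ht] /= st.
have {}st : s = t.
  by apply: functional_extensionality_dep => x; apply: functional_extensionality_dep.
by case: t / st ht => ht; congr GSec; apply: Prop_irrelevance.
Qed.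

Definition gs0 : gsec f M y.
Proof. by exists (fun x u => 0) => *; rewrite mres0. Defined.
Definition gsopp s : gsec f M y.
Proof.
exists (fun x u => - s x u) => x x' h u u'; apply: (addrI (s x' u')).
by rewrite -{1}(sfam_res s h u u') -mresD !subrr mres0.
Defined.
Definition gsadd s t : gsec f M y.
Proof.
by exists (fun x u => s x u + t x u) => x x' h u u'; rewrite mresD !(sfam_res _ _ _ u').
Defined.
Definition gsscale (a : O Y y) s : gsec f M y.
Proof.
exists (fun x u => fsh f x (ores (u : spec y (f x)) a) *: s x u).
move=> x x' h u u'; rewrite mresZ (sfam_res _ _ _ u'); congr (_ *: _).
have h' := spec_cont (@fcont _ _ _ f) h.
by rewrite -(fsh_nat h h') (ores_comp _ _ u').
Defined.

Fact gsaddA : associative gsadd.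
Proof. by move=> r s t; apply: gsec_ext => x u /=; rewrite addrA. Qed.
Fact gsaddC : commutative gsadd.
Proof. by move=> r s; apply: gsec_ext => x u /=; rewrite addrC. Qed.
Fact gsadd0 : left_id gs0 gsadd.
Proof. by move=> r; apply: gsec_ext => x u /=; rewrite add0r. Qed.
Fact gsaddN : left_inverse gs0 gsopp gsadd.
Proof. by move=> r; apply: gsec_ext => x u /=; rewrite addNr. Qed.
HB.instance Definition _ := GRing.isZmodule.Build (gsec f M y)
  gsaddA gsaddC gsadd0 gsaddN.
Fact gsscaleA a b s : gsscale a (gsscale b s) = gsscale (a * b) s.
Proof. by apply: gsec_ext => x u /=; rewrite scalerA !rmorphM. Qed.
Fact gsscale1 : left_id 1 gsscale.
Proof. by move=> s; apply: gsec_ext => x u /=; rewrite !rmorph1 scale1r. Qed.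
Fact gsscaleDr : right_distributive gsscale +%R.
Proof. by move=> a s t; apply: gsec_ext => x u /=; rewrite scalerDr. Qed.
Fact gsscaleDl s : {morph gsscale^~ s : a b / a + b}.
Proof. by move=> a b; apply: gsec_ext => x u /=; rewrite !rmorphD scalerDl. Qed.
HB.instance Definition _ := GRing.Zmodule_isLmodule.Build (O Y y) (gsec f M y)
  gsscaleA gsscale1 gsscaleDr gsscaleDl.
Definition gsecM : lmodType (O Y y) := gsec f M y.
End GSec.

Section Push.
Variables (k : comPzRingType) (X Y : rfspace k) (f : rfmor X Y).

Definition push_res (M : omod X) (y y' : Y) (h : spec y y') (s : gsec f M y) :
  gsec f M y'.
Proof.
by exists (fun x u => s x (spec_trans h u)) => x x' hx u u'; apply: sfam_res.
Defined.

Definition push (M : omod X) : omod Y.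
Proof.
refine (@OMod k Y (fun y => gsecM f M y) (fun y y' h => push_res h) _ _ _).
- move=> y y' h a s t; apply: gsec_ext => x u /=.
  by rewrite (ores_comp _ _ (spec_trans h u)).
- move=> y h s; apply: gsec_ext => x u /=.
  by rewrite (Prop_irrelevance (spec_trans h u) u).
- move=> p q r h h' h'' s; apply: gsec_ext => x u /=.
  by rewrite (Prop_irrelevance (spec_trans h'' u) (spec_trans h (spec_trans h' u))).
Defined.

Definition push_fun (M N : omod X) (a : ohom M N) (y : Y) (s : gsec f M y) :
  gsec f N y.
Proof.
by exists (fun x u => a x (s x u)) => x x' h u u'; rewrite -oh_nat (sfam_res _ _ _ u').
Defined.

Definition push_map (M N : omod X) (a : ohom M N) : ohom (push M) (push N).
Proof.
refine (@OHom k Y (push M) (push N) (push_fun a) _ _).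
- by move=> y c s t; apply: gsec_ext => x u /=; rewrite oh_lin.
- by move=> y y' h s; apply: gsec_ext.
Defined.
End Push.

Section Pull.
Variables (k : comPzRingType) (X Y : rfspace k) (f : rfmor X Y).

Lemma fsh_semilin (x x' : X) (h : spec x x') (h' : spec (f x) (f x')) :
  semilin (ores h')
    (ores h : restrM (fsh f x) (O X x)^o -> restrM (fsh f x') (O X x')^o).
Proof.
move=> a u v; rewrite rmorphD; congr (_ + _).
by rewrite -[LHS]/(ores h (fsh f x a * u)) rmorphM -(fsh_nat h h').
Qed.

Definition pull_res (N : omod Y) (x x' : X) (h : spec x x') :
    bchM (fsh f x) (N (f x)) -> bchM (fsh f x') (N (f x')) :=
  @tmap _ _ (N (f x)) (restrM (fsh f x) (O X x)^o)
    (N (f x')) (restrM (fsh f x') (O X x')^o)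
    (mres N (spec_cont (@fcont _ _ _ f) h)) (ores h).

Lemma pull_res_pure (N : omod Y) (x x' : X) (h : spec x x') n s :
  pull_res h (bpure (fsh f x) n s) =
  bpure (fsh f x') (mres N (spec_cont (@fcont _ _ _ f) h) n) (ores h s).
Proof. apply: tmap_pure; [exact: mres_lin|exact: fsh_semilin]. Qed.
Lemma pull_resD (N : omod Y) (x x' : X) (h : spec x x') :
  {morph @pull_res N x x' h : u v / u + v}.
Proof. apply: tmapD; [exact: mres_lin|exact: fsh_semilin]. Qed.
Lemma pull_res0 (N : omod Y) (x x' : X) (h : spec x x') :
  @pull_res N x x' h 0 = 0.
Proof. apply: tmap0; [exact: mres_lin|exact: fsh_semilin]. Qed.
Lemma pull_res_lin (N : omod Y) (x x' : X) (h : spec x x') :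
  semilin (ores h) (@pull_res N x x' h).
Proof.
move=> a u v; rewrite pull_resD; congr (_ + _).
elim/bch_ind: u => [|u u' hu hu'|n s]; first by rewrite scaler0 pull_res0 scaler0.
  by rewrite scalerDr !pull_resD scalerDr hu hu'.
by rewrite bpureZr !pull_res_pure bpureZr rmorphM.
Qed.

Definition pull (N : omod Y) : omod X.
Proof.
refine (@OMod k X (fun x => bchM (fsh f x) (N (f x))) (@pull_res N) _ _ _).
- exact: pull_res_lin.
- move=> x h u; elim/bch_ind: u => [|u u' hu hu'|n s]; first exact: pull_res0.
    by rewrite pull_resD hu hu'.
  by rewrite pull_res_pure mres_id ores_id.
- move=> p q r h h' h'' u; elim/bch_ind: u => [|u u' hu hu'|n s].
  + by rewrite !pull_res0.
  + by rewrite !pull_resD hu hu'.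
  rewrite !pull_res_pure (ores_comp _ _ h'').
  by rewrite (mres_comp _ _ (spec_cont (@fcont _ _ _ f) h'')).
Defined.

Definition pull_fun (M N : omod Y) (a : ohom M N) (x : X) :
    bchM (fsh f x) (M (f x)) -> bchM (fsh f x) (N (f x)) :=
  @tmap _ _ (M (f x)) (restrM (fsh f x) (O X x)^o)
    (N (f x)) (restrM (fsh f x) (O X x)^o) (a (f x)) id.

Section PullMap.
Variables (M N : omod Y) (a : ohom M N).
Let idP x : semilin (idfun : {rmorphism O Y (f x) -> O Y (f x)})
  (id : restrM (fsh f x) (O X x)^o -> restrM (fsh f x) (O X x)^o).
Proof. by []. Qed.
Lemma pull_fun_pure x n s :
  pull_fun a (bpure (fsh f x) n s) = bpure (fsh f x) (a (f x) n) s.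
Proof. apply: (@tmap_pure _ _ _ _ _ _ idfun); [exact: oh_semilin|exact: idP]. Qed.
Lemma pull_funD x : {morph @pull_fun M N a x : u v / u + v}.
Proof. apply: (@tmapD _ _ _ _ _ _ idfun); [exact: oh_semilin|exact: idP]. Qed.
Lemma pull_fun0 x : @pull_fun M N a x 0 = 0.
Proof. apply: (@tmap0 _ _ _ _ _ _ idfun); [exact: oh_semilin|exact: idP]. Qed.
Lemma pull_fun_lin x : linear (@pull_fun M N a x).
Proof.
move=> c u v; rewrite pull_funD; congr (_ + _).
elim/bch_ind: u => [|u u' hu hu'|n s]; first by rewrite scaler0 pull_fun0 scaler0.
  by rewrite scalerDr !pull_funD scalerDr hu hu'.
by rewrite bpureZr !pull_fun_pure bpureZr.
Qed.

Definition pull_map : ohom (pull M) (pull N).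
Proof.
refine (@OHom k X (pull M) (pull N) (@pull_fun M N a) _ _).
- exact: pull_fun_lin.
- move=> x x' h u; rewrite -[mres _ _ _]/(pull_res h u).
  rewrite -[mres (pull N) _ _]/(pull_res h (pull_fun a u)).
  elim/bch_ind: u => [|u u' hu hu'|n s].
  + by rewrite pull_res0 !pull_fun0 pull_res0.
  + by rewrite pull_resD !pull_funD pull_resD hu hu'.
  by rewrite pull_res_pure !pull_fun_pure pull_res_pure oh_nat.
Defined.
End PullMap.
End Pull.

Section Restriction.
Variables (k : comPzRingType) (X : rfspace k) (T : topologicalType).
Variables (j : T -> X) (jc : continuous j) (fT : finite_set [set: T]).

Definition sub_res (p q : T) (h : spec p q) : {rmorphism O X (j p) -> O X (j q)} :=
  ores (spec_cont jc h).

(* [T] with the sheaf of rings [j^-1 O_X] *)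
Definition subS : rfspace k.
Proof.
refine (@RFSpace k T fT (fun t => O X (j t)) sub_res _ _ (fun t => okalg (j t)) _).
- by move=> p h a; apply: ores_id.
- by move=> p q r h h' h'' a; apply: ores_comp.
- by move=> p q h c; apply: ores_k.
Defined.

Definition osub (M : omod X) : omod subS.
Proof.
refine (@OMod k subS (fun t : T => M (j t))
  (fun p q h => mres M (spec_cont jc h)) _ _ _).
- by move=> p q h; exact: (mres_lin (spec_cont jc h)).
- by move=> p h m; exact: mres_id.
- by move=> p q r h h' h'' m; exact: mres_comp.
Defined.
End Restriction.

Section OpenSub.
Variables (k : comPzRingType) (X : rfspace k) (U : set X).

Definition open_pt : topologicalType := initial_topology (set_val : U -> X).
Definition open_val : open_pt -> X := set_val.
Lemma open_cont : continuous open_val.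
Proof. exact: initial_continuous. Qed.
Lemma open_fin : finite_set [set: open_pt].
Proof.
rewrite -(preimage_setT open_val); apply: finite_preimage (@pt_fin _ X).
by move=> x y _ _; apply: val_inj.
Qed.

(* the ringed space [(U, O_X|_U)] *)
Definition openS : rfspace k := subS open_cont open_fin.
Definition open_restr (M : omod X) : omod openS := osub open_cont open_fin M.
End OpenSub.

Definition presented (k : comPzRingType) (X : rfspace k) (M : omod X) : Prop :=
  exists (I J : choiceType) (a : ohom (ofree X J) (ofree X I))
    (b : ohom (ofree X I) M),
    (forall p m, exists x, b p x = m) /\
    (forall p x, b p x = 0 <-> exists y, a p y = x).

Definition quasi_coherent (k : comPzRingType) (X : rfspace k) (M : omod X) : Prop :=
  forall p : X, exists U : set X,
    [/\ open U, U p & presented (open_restr U M)].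

(* The differential of degree [i -> j] is given for all [i] and [j], and is zero
   unless [j = i + 1]; this avoids casts between degrees. *)
Record cx (k : comPzRingType) (X : rfspace k) := Cx {
  cob :> int -> omod X;
  cd : forall i j, ohom (cob i) (cob j);
  cd_shape : forall i j p x, j != i + 1 -> cd i j p x = 0;
  cd_sq : forall i j l p x, cd j l p (cd i j p x) = 0
}.
Arguments cd {k X} _ i j.

Record cmap (k : comPzRingType) (X : rfspace k) (A B : cx X) := CMap {
  cf :> forall i, ohom (A i) (B i);
  cf_d : forall i j p x, cf j p (cd A i j p x) = cd B i j p (cf i p x)
}.

Section Cx.
Variables (k : comPzRingType) (X : rfspace k).
Implicit Types A B C : cx X.

Definition cmap_id A : cmap A A :=
  @CMap k X A A (fun i => ohom_id (A i)) (fun _ _ _ _ => erefl).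

Definition cmap_comp A B C (g : cmap B C) (f : cmap A B) : cmap A C.
Proof.
refine (@CMap k X A C (fun i => ohom_comp (g i) (f i)) _).
by move=> i j p x /=; rewrite !cf_d.
Defined.

Definition cmap0 A B : cmap A B.
Proof.
refine (@CMap k X A B (fun i => ohom0 (A i) (B i)) _).
by move=> i j p x /=; rewrite oh0.
Defined.

Definition acyclic A : Prop := forall n p (x : A n p),
  cd A n (n + 1) p x = 0 -> exists y : A (n - 1) p, x = cd A (n - 1) n p y.

(* [H^n(f)] is injective and surjective on stalks, for all [n] *)
Definition quasi_iso A B (f : cmap A B) : Prop := forall n p,
  (forall x : A n p, cd A n (n + 1) p x = 0 ->
    (exists y : B (n - 1) p, f n p x = cd B (n - 1) n p y) ->
    exists z : A (n - 1) p, x = cd A (n - 1) n p z) /\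
  (forall y : B n p, cd B n (n + 1) p y = 0 ->
    exists (x : A n p) (z : B (n - 1) p),
      cd A n (n + 1) p x = 0 /\ y = f n p x + cd B (n - 1) n p z).

Definition homotopic A B (f g : cmap A B) : Prop :=
  exists h : forall i j, ohom (A i) (B j), forall n p x,
    f n p x = g n p x + (cd B (n - 1) n p (h n (n - 1) p x) +
                         h (n + 1) n p (cd A n (n + 1) p x)).

Definition K_injective (J : cx X) : Prop :=
  forall A (f : cmap A J), acyclic A -> homotopic f (cmap0 A J).

Definition single_ob (M : omod X) (i : int) : omod X :=
  if i is Posz 0 then M else ozero.
Definition single (M : omod X) : cx X.
Proof.
refine (@Cx k X (single_ob M) (fun i j => ohom0 _ _) _ _); by [].
Defined.
End Cx.

Definition push_cx (k : comPzRingType) (X Y : rfspace k) (f : rfmor X Y) (A : cx X) :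
  cx Y.
Proof.
refine (@Cx k Y (fun i => push f (A i)) (fun i j => push_map f (cd A i j)) _ _).
- by move=> i j p x ij; apply: gsec_ext => q u; apply: cd_shape.
- by move=> i j l p x; apply: gsec_ext => q u; apply: cd_sq.
Defined.

Definition push_cmap (k : comPzRingType) (X Y : rfspace k) (f : rfmor X Y)
  (A B : cx X) (a : cmap A B) : cmap (push_cx f A) (push_cx f B).
Proof.
refine (@CMap k Y (push_cx f A) (push_cx f B) (fun i => push_map f (a i)) _).
by move=> i j p x; apply: gsec_ext => q u; apply: cf_d.
Defined.

Definition pull_cx (k : comPzRingType) (X Y : rfspace k) (f : rfmor X Y) (A : cx Y) :
  cx X.
Proof.
refine (@Cx k X (fun i => pull f (A i)) (fun i j => pull_map f (cd A i j)) _ _).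
- move=> i j p x ij /=; elim/bch_ind: x => [|x y hx hy|n s].
  + exact: pull_fun0.
  + by rewrite pull_funD hx hy addr0.
  by rewrite pull_fun_pure cd_shape // -(scale0r 0) bpureZ rmorph0 mul0r -(mul0r 0) -bpureZr scale0r.
- move=> i j l p x /=; elim/bch_ind: x => [|x y hx hy|n s].
  + by rewrite !pull_fun0.
  + by rewrite !pull_funD hx hy addr0.
  by rewrite !pull_fun_pure cd_sq -(scale0r 0) bpureZ rmorph0 mul0r -(mul0r 0) -bpureZr scale0r.
Defined.

Arguments otens_map : simpl never.
Section OtensMap.
Variables (k : comPzRingType) (X : rfspace k).
Lemma otens_map_comp (M M' M'' N N' N'' : omod X) (f : ohom M M')
  (f' : ohom M' M'') (g : ohom N N') (g' : ohom N' N'') p x :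
  otens_map f' g' p (otens_map f g p x) =
  otens_map (ohom_comp f' f) (ohom_comp g' g) p x.
Proof.
rewrite /otens_map /= (tmap_comp (g := idfun) (g' := idfun)) //; exact: oh_semilin.
Qed.
Lemma otens_map_pure (M M' N N' : omod X) (f : ohom M M') (g : ohom N N') p m n :
  otens_map f g p (tpure m n) = tpure (f p m) (g p n).
Proof. by apply: (@tmap_pure _ _ _ _ _ _ idfun); apply: oh_semilin. Qed.
Lemma otens_res_pure (M N : omod X) p q (h : spec p q) m n :
  mres (otens M N) h (tpure m n) = tpure (mres M h m) (mres N h n).
Proof. exact: (tmap_pure (@mres_lin _ _ M _ _ h) (@mres_lin _ _ N _ _ h)). Qed.
Lemma eq_otens_map (M M' N N' : omod X) (f f' : ohom M M') (g g' : ohom N N') p x :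
  f p =1 f' p -> g p =1 g' p -> otens_map f g p x = otens_map f' g' p x.
Proof. by move=> ff gg; apply: eq_tmap. Qed.
Lemma otens_map0l (M M' N N' : omod X) (f : ohom M M') (g : ohom N N') p x :
  (forall m, f p m = 0) -> otens_map f g p x = 0.
Proof.
move=> f0; elim/tensor_ind: x => [|x y hx hy|m n]; first by rewrite oh0.
  by rewrite ohD hx hy addr0.
by rewrite otens_map_pure f0 -(scale0r 0) -tpureZl scale0r.
Qed.
Lemma otens_map0r (M M' N N' : omod X) (f : ohom M M') (g : ohom N N') p x :
  (forall m, g p m = 0) -> otens_map f g p x = 0.
Proof.
move=> f0; elim/tensor_ind: x => [|x y hx hy|m n]; first by rewrite oh0.
  by rewrite ohD hx hy addr0.
by rewrite otens_map_pure f0 -(scale0r 0) -tpureZr scale0r.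
Qed.
End OtensMap.

Section Tot.
Variables (k : comPzRingType) (X : rfspace k) (P A : cx X).

Definition tot_ob (n : int) : omod X :=
  odsum (fun ij : int * int => ij.1 + ij.2 == n)
        (fun ij => otens (P ij.1) (A ij.2)).

(* the components [d (x) 1] and [1 (x) d] arriving in [P i (x) A j] *)
Definition tot_dl (i j : int) : ohom (otens (P (i - 1)) (A j)) (otens (P i) (A j)) :=
  otens_map (cd P (i - 1) i) (ohom_id (A j)).
Definition tot_dr (i j : int) : ohom (otens (P i) (A (j - 1))) (otens (P i) (A j)) :=
  otens_map (ohom_id (P i)) (cd A (j - 1) j).
Arguments tot_dl : simpl never.
Arguments tot_dr : simpl never.

(* [d (x (x) y) = dx (x) y + (-1)^i x (x) dy] for [x] of degree [i] *)
Definition tot_dfun (n m : int) (p : X) (x : tot_ob n p)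
    (ij : int * int) : otens (P ij.1) (A ij.2) p :=
  if n + 1 == m then
    tot_dl ij.1 ij.2 p (x (ij.1 - 1, ij.2)) +
    (-1) ^+ `|ij.1|%N *: tot_dr ij.1 ij.2 p (x (ij.1, ij.2 - 1))
  else 0.

Lemma tot_dfunE n m p (x : tot_ob n p) i j : tot_dfun m x (i, j) =
  if n + 1 == m then tot_dl i j p (x (i - 1, j)) +
    (-1) ^+ `|i|%N *: tot_dr i j p (x (i, j - 1)) else 0.
Proof. by []. Qed.

Definition tot_dterm (n m : int) (p : X) (x : tot_ob n p) : tot_ob m p.
Proof.
exists (tot_dfun m x).
- move=> [i j] ijm; rewrite tot_dfunE; case: eqP => // nm.
  rewrite !dfam_out ?oh0 ?scaler0 ?addr0 //.
    by apply: contra ijm => /eqP /= h; rewrite -nm -h -addrA subrK.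
  by apply: contra ijm => /eqP /= h; rewrite -nm -h (addrAC i) subrK.
- have [s hs] := dfam_fin x.
  exists ([seq (ij.1 + 1, ij.2) | ij <- s] ++ [seq (ij.1, ij.2 + 1) | ij <- s]).
  move=> [i j]; rewrite mem_cat negb_or => /andP[h1 h2].
  rewrite tot_dfunE; case: ifP => // _; rewrite !hs ?oh0 ?scaler0 ?addr0 //.
    by apply: contra h2 => h; apply/mapP; exists (i, j - 1); rewrite //= subrK.
  by apply: contra h1 => h; apply/mapP; exists (i - 1, j); rewrite //= subrK.
Defined.

Lemma tot_dterm_lin n m p : linear (@tot_dterm n m p).
Proof.
move=> a x y; apply: dsum_ext => -[i j].
rewrite -[LHS]/(tot_dfun m (a *: x + y) (i, j)).
rewrite -[RHS]/(a *: tot_dfun m x (i, j) + tot_dfun m y (i, j)).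
rewrite !tot_dfunE; case: ifP => // _; last by rewrite scaler0 addr0.
rewrite !(ohD, ohZ) !scalerDr !scalerA !(mulrC _ a).
by rewrite addrACA.
Qed.

Lemma tot_dterm_nat n m p q (h : spec p q) (x : tot_ob n p) :
  tot_dterm m (mres (tot_ob n) h x) = mres (tot_ob m) h (tot_dterm m x).
Proof.
apply: dsum_ext => -[i j].
rewrite -[LHS]/(tot_dfun m (mres (tot_ob n) h x) (i, j)).
rewrite -[RHS]/(mres (otens (P i) (A j)) h (tot_dfun m x (i, j))).
rewrite !tot_dfunE; case: ifP => _; last by rewrite mres0.
by rewrite mresD mresZ -!oh_nat rmorphXn rmorphN rmorph1.
Qed.

Definition tot_d (n m : int) : ohom (tot_ob n) (tot_ob m) :=
  OHom (@tot_dterm_lin n m) (@tot_dterm_nat n m).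

Lemma tot_dE n m p (x : tot_ob n p) i j : tot_d n m p x (i, j) =
  if n + 1 == m then tot_dl i j p (x (i - 1, j)) +
    (-1) ^+ `|i|%N *: tot_dr i j p (x (i, j - 1)) else 0.
Proof. by []. Qed.

Lemma sign_pred (R : pzRingType) (i : int) :
  (-1) ^+ `|i - 1|%N = - (-1) ^+ `|i|%N :> R.
Proof.
case: i => [[|n]|n].
- by rewrite sub0r /= expr1.
- by rewrite -addn1 PoszD addrK /= addn1 exprS mulN1r opprK.
- by rewrite NegzE -opprD abszN -PoszD addn1 abszN /= exprS mulN1r.
Qed.

Definition tot : cx X.
Proof.
refine (@Cx k X tot_ob tot_d _ _).
- move=> i j p x ij; apply: dsum_ext => -[a b].
  by rewrite tot_dE eq_sym (negPf ij).
- move=> n m l p x; apply: dsum_ext => -[a b]; rewrite !tot_dE.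
  case: ifP => // _; case: ifP => _; last by rewrite !oh0 scaler0 addr0.
  rewrite !(ohD, ohZ) /tot_dl /tot_dr !otens_map_comp.
  rewrite otens_map0l ?add0r; last by move=> y; apply: cd_sq.
  rewrite [X in _ + _ *: (_ + _ *: X)]otens_map0r; last by move=> y; apply: cd_sq.
  rewrite scaler0 addr0 sign_pred scaleNr addrC; apply/eqP; rewrite subr_eq0.
  by apply/eqP; congr (_ *: _); apply: eq_otens_map.
Defined.
End Tot.

Definition tot_map (k : comPzRingType) (X : rfspace k) (P P' A A' : cx X)
  (f : cmap P P') (g : cmap A A') : cmap (tot P A) (tot P' A').
Proof.
refine (@CMap k X (tot P A) (tot P' A')
  (fun n => odsum_map _ (fun ij => otens_map (f ij.1) (g ij.2))) _).
move=> n m p x; apply: dsum_ext => -[i j].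
rewrite [RHS]tot_dE.
rewrite -[LHS]/(otens_map (f i) (g j) p (tot_d P A n m p x (i, j))) tot_dE.
case: ifP => _; last by rewrite oh0.
rewrite ohD ohZ -[odsum_map _ _ _ _ (i - 1, j)]/(otens_map _ _ _ _).
rewrite -[odsum_map _ _ _ _ (i, j - 1)]/(otens_map _ _ _ _).
rewrite /tot_dl /tot_dr !otens_map_comp.
by congr (_ + _ *: _); apply: eq_otens_map => y //=; rewrite cf_d.
Defined.

Definition K_flat (k : comPzRingType) (X : rfspace k) (P : cx X) : Prop :=
  forall A : cx X, acyclic A -> acyclic (tot P A).

Section RightUnit.
Variables (k : comPzRingType) (X : rfspace k).

Lemma oright_bal (M : omod X) p :
  @balanced _ (M p) (O X p)^o (M p) (fun m a => (a : O X p) *: m).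
Proof.
split=> [m m' n|m n n'|c m n]; first exact: scalerDr.
  exact: scalerDl.
by rewrite !scalerA mulrC.
Qed.

Definition oright (M : omod X) : ohom (otens M ounit) M.
Proof.
refine (@OHom k X (otens M ounit) M
  (fun p => @tlift _ (M p) (O X p)^o (M p) (fun m a => (a : O X p) *: m)) _ _).
- move=> p c x y; rewrite (tliftD (oright_bal M p)); congr (_ + _).
  elim/tensor_ind: x => [|x x' hx hx'|m n].
  + by rewrite scaler0 (tlift0 (oright_bal M p)) scaler0.
  + by rewrite scalerDr !(tliftD (oright_bal M p)) scalerDr hx hx'.
  by rewrite tpureZr !(tlift_pure (oright_bal M p)) scalerA.
- move=> p q h x; elim/tensor_ind: x => [|x x' hx hx'|m n].
  + by rewrite mres0 !(tlift0 (oright_bal _ _)) mres0.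
  + by rewrite mresD !(tliftD (oright_bal _ _)) mresD hx hx'.
  by rewrite otens_res_pure !(tlift_pure (oright_bal _ _)) mresZ.
Defined.

Lemma oright_nat (M N : omod X) (f : ohom M N) p x :
  oright N p (otens_map f (ohom_id ounit) p x) = f p (oright M p x).
Proof.
elim/tensor_ind: x => [|x x' hx hx'|m n]; first by rewrite !oh0.
  by rewrite !ohD hx hx'.
by rewrite otens_map_pure /= !(tlift_pure (oright_bal _ _)) ohZ.
Qed.

Definition right_unit_hom (P : cx X) n : ohom (tot P (single ounit) n) (P n).
Proof.
refine (@OHom k X (tot P (single ounit) n) (P n)
    (fun p x => oright (P n) p (x (n, 0))) _ _).
- by move=> p a x y; rewrite -oh_lin.
- by move=> p q h x; rewrite -oh_nat.
Defined.

Definition right_unit (P : cx X) : cmap (tot P (single ounit)) P.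
Proof.
refine (@CMap k X (tot P (single ounit)) P (right_unit_hom P) _).
move=> n m p x.
rewrite -[LHS]/(oright (P m) p (tot_d P (single ounit) n m p x (m, 0))) tot_dE.
rewrite -[right_unit_hom P n p x]/(oright (P n) p (x (n, 0))).
have [<-|nm] := eqVneq (n + 1) m; last first.
  by rewrite oh0 cd_shape // eq_sym.
rewrite /tot_dr otens_map0r // scaler0 addr0 /tot_dl oright_nat.
have : n = n + 1 - 1 by rewrite addrK.
by move: (n + 1 - 1) => l e; case: l / e.
Defined.
End RightUnit.

Section TotAdditive.
Variables (k : comPzRingType) (X Y : rfspace k).
Variables (P A : cx X) (P' A' : cx Y) (p : X) (q : Y).
Variable F : forall i j, otens (P i) (A j) p -> otens (P' i) (A' j) q.
Hypothesis FD : forall i j, {morph @F i j : x y / x + y}.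
Hypothesis Fl : forall i j x, @F i j (tot_dl P A i j p x) = tot_dl P' A' i j q (F x).
Hypothesis Fr : forall i j x, @F i j (tot_dr P A i j p x) = tot_dr P' A' i j q (F x).

Let F0 i j : @F i j 0 = 0.
Proof.
by have /eqP := @FD i j 0 0; rewrite addr0 -subr_eq0 opprD addNKr oppr_eq0 => /eqP.
Qed.
Let FN i j : {morph @F i j : x / - x}.
Proof. by move=> x; apply/eqP; rewrite -subr_eq0 opprK -FD addNr F0. Qed.
Let Fsign i j n x : @F i j ((-1) ^+ n *: x) = (-1) ^+ n *: @F i j x.
Proof.
rewrite -[in LHS]signr_odd -[in RHS]signr_odd.
by case: (odd n); rewrite ?expr1 ?expr0 ?scaleN1r ?scale1r // FN.
Qed.

Definition tot_add n (x : tot_ob P A n p) : tot_ob P' A' n q.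
Proof.
exists (fun ij => @F ij.1 ij.2 (x ij)).
- by move=> [i j] ij; rewrite dfam_out // F0.
- by have [s hs] := dfam_fin x; exists s => -[i j] /hs ->; rewrite F0.
Defined.

Lemma tot_addE n x i j : @tot_add n x (i, j) = @F i j (x (i, j)).
Proof. by []. Qed.

Lemma tot_add_d n m x : tot_add (tot_d P A n m p x) = tot_d P' A' n m q (tot_add x).
Proof.
apply: dsum_ext => -[i j]; rewrite tot_addE !tot_dE !tot_addE.
by case: ifP => // _; rewrite FD Fsign Fl Fr.
Qed.

Lemma tot_add0 n : @tot_add n 0 = 0.
Proof. by apply: dsum_ext => -[i j]; rewrite tot_addE F0. Qed.
End TotAdditive.

Section PullKFlat.
Variables (k : comPzRingType) (X Y : rfspace k) (g : rfmor X Y).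
Variables (P : cx Y) (A : cx X) (p : X).

Let pt1 : topologicalType := initial_topology (fun _ : unit => p).
Let j (t : pt1) : X := p.
Let jc : continuous j. Proof. exact: cst_continuous. Qed.
Let jf : finite_set [set: pt1].
Proof. by apply: sub_finite_set (finite_set1 (tt : pt1)) => t _; case: (t : unit). Qed.
Let S : rfspace k := subS jc jf.

Let i_sh_nat (t t' : S) (h : spec t t') (h' : spec (g p) (g p)) a :
  fsh g p (ores h' a) = @ores k S _ _ h (fsh g p a).
Proof. by rewrite ores_id /= /sub_res ores_id. Qed.
Let i_cont : continuous (fun _ : S => g p).
Proof. exact: cst_continuous. Qed.
Let i : rfmor S Y :=
  @RFMor k S Y (fun _ => g p) i_cont (fun _ => fsh g p) i_sh_nat
    (fun _ c => fsh_k g p c).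

Let sub_map (M N : omod X) (f : ohom M N) : ohom (osub jc jf M) (osub jc jf N).
Proof.
refine (@OHom k S (osub jc jf M) (osub jc jf N) (fun _ => f p) _ _).
- by move=> t; exact: (@oh_lin _ _ _ _ f p).
- by move=> t t' h m; exact: (oh_nat f).
Defined.
Let sA : cx S.
Proof.
refine (@Cx k S (fun n => osub jc jf (A n)) (fun n m => sub_map (cd A n m)) _ _).
- by move=> n m t x nm; exact: cd_shape.
- by move=> n m l t x; exact: cd_sq.
Defined.
Let B : cx Y := push_cx i sA.

Let csec (n : int) (y : Y) (a : A n p) : gsec i (sA n) y.
Proof. by exists (fun t u => a) => t t' h u u'; exact: (mres_id (spec_cont jc h)). Defined.

Let csecE n y (s : gsec i (sA n) y) (u : spec y (g p)) : s = csec y (s tt u).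
Proof. by apply: gsec_ext => -[] u'; rewrite (Prop_irrelevance u' u). Qed.

Let B_acyclic : acyclic A -> acyclic B.
Proof.
move=> aA n y s ds.
have [u|nu] := EM (spec y (g p)); last first.
  by exists 0; apply: gsec_ext => t u; case: (nu u).
have da : cd A n (n + 1) p (s tt u) = 0.
  exact: (congr1 (fun z : gsec i (sA (n + 1)) y => z tt u) ds).
have [b sb] := aA n p _ da.
by exists (csec y b); rewrite (csecE s u) sb; apply: gsec_ext.
Qed.

Let R := O Y (g p).
Let T := O X p.
Let phi := fsh g p.

Section Comp.
Variables a b : int.
Let L := pull_cx g P a p.
Let L' := P a (g p).
Let N := A b p.
Let N' := B b (g p).

Let csecD (n n' : N) : csec (g p) (n + n') = csec (g p) n + csec (g p) n' :> N'.
Proof. exact: gsec_ext. Qed.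
Let csecZ c (n : N) : csec (g p) (phi c *: n) = c *: (csec (g p) n : N').
Proof. by apply: gsec_ext => t u /=; rewrite ores_id. Qed.

Let F1 (n : N) : L -> tens L' N' :=
  @tlift _ L' (restrM phi T^o) (tens L' N')
    (fun m s => tpure m (csec (g p) ((s : T) *: n) : N')).
Let F1_bal n : @balanced _ L' (restrM phi T^o) (tens L' N')
    (fun m s => tpure m (csec (g p) ((s : T) *: n) : N')).
Proof.
split=> [m m' s|m s s'|c m s]; first exact: tpureDl.
  by rewrite scalerDl csecD tpureDr.
by rewrite tpureZ -csecZ scalerA.
Qed.
Let F1_pure n m s : F1 n (bpure phi m s) = tpure m (csec (g p) (s *: n) : N').
Proof. exact: (tlift_pure (F1_bal n)). Qed.
Let F1D n : {morph F1 n : x y / x + y}.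
Proof. exact: (tliftD (F1_bal n)). Qed.
Let F10 n : F1 n 0 = 0.
Proof. exact: (tlift0 (F1_bal n)). Qed.

Definition kf_F : tens L N -> tens L' N' := tlift (fun w n => F1 n w).
Let F_bal : balanced (fun w n => F1 n w).
Proof.
split=> [w w' n|w n n'|c w n]; first exact: F1D.
- elim/bch_ind: w => [|w w' hw hw'|m s]; first by rewrite !F10 addr0.
    by rewrite !F1D hw hw' addrACA.
  by rewrite !F1_pure scalerDr csecD tpureDr.
- elim/bch_ind: w => [|w w' hw hw'|m s]; first by rewrite scaler0 !F10.
    by rewrite scalerDr !F1D hw hw'.
  by rewrite bpureZr !F1_pure scalerA mulrC.
Qed.
Lemma kf_FD : {morph kf_F : x y / x + y}.
Proof. exact: (tliftD F_bal). Qed.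
Lemma kf_F_pure m s n : kf_F (tpure (bpure phi m s : L) n) =
  tpure m (csec (g p) (s *: n) : N').
Proof. by rewrite /kf_F (tlift_pure F_bal) F1_pure. Qed.

Definition kf_G : tens L' N' -> tens L N :=
  tlift (fun m (s : N') => tpure (bpure phi m 1 : L) ((s : gsec i (sA b) (g p)) tt (spec_refl (g p)))).
Let G_bal : balanced (fun m (s : N') => tpure (bpure phi m 1 : L) ((s : gsec i (sA b) (g p)) tt (spec_refl (g p)))).
Proof.
split=> [m m' s|m s s'|c m s]; first by rewrite bpureDl tpureDl.
  exact: tpureDr.
by rewrite bpureZ -bpureZr tpureZ /= ores_id.
Qed.
Lemma kf_GD : {morph kf_G : x y / x + y}.
Proof. exact: (tliftD G_bal). Qed.
Lemma kf_G_pure m (s : N') : kf_G (tpure m s) =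
  tpure (bpure phi m 1 : L) ((s : gsec i (sA b) (g p)) tt (spec_refl (g p))).
Proof. exact: (tlift_pure G_bal). Qed.

Lemma kf_ext (V : zmodType) (f h : tens L N -> V) :
  {morph f : x y / x + y} -> {morph h : x y / x + y} ->
  (forall m s n, f (tpure (bpure phi m s : L) n) = h (tpure (bpure phi m s : L) n)) ->
  f =1 h.
Proof.
move=> fD hD fh; apply: tens_ext => // w n.
have z (u : tens L N -> V) : {morph u : x y / x + y} -> u 0 = 0.
  by move=> uD; have /eqP := uD 0 0; rewrite /= addr0 -subr_eq0 opprD addNKr oppr_eq0 => /eqP.
elim/bch_ind: w => [|w w' hw hw'|m s]; last exact: fh.
- by rewrite -(scale0r 0) -tpureZl scale0r !z.
- by rewrite tpureDl fD hD hw hw'.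
Qed.

Lemma kf_FK x : kf_G (kf_F x) = x.
Proof.
move: x; apply: (@kf_ext _ (kf_G \o kf_F) id) => //.
  by move=> x y /=; rewrite kf_FD kf_GD.
by move=> m s n /=; rewrite kf_F_pure kf_G_pure /= -tpureZ bpureZr mulr1.
Qed.
End Comp.

Lemma pull_K_flat_stalk : K_flat P -> acyclic A ->
  forall n (x : tot (pull_cx g P) A n p),
  cd (tot (pull_cx g P) A) n (n + 1) p x = 0 ->
  exists y : tot (pull_cx g P) A (n - 1) p,
    x = cd (tot (pull_cx g P) A) (n - 1) n p y.
Proof.
move=> fP aA n x dx.
have Fl a b w : kf_F (tot_dl (pull_cx g P) A a b p w) = tot_dl P B a b (g p) (kf_F w).
  move: w; apply: kf_ext => [u v|u v|m s l]; rewrite ?ohD ?kf_FD ?ohD //.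
  rewrite /tot_dl kf_F_pure !otens_map_pure.
  rewrite -[pull_map _ _ _ _]/(pull_fun (cd P (a - 1) a) _) pull_fun_pure.
  by rewrite kf_F_pure.
have Fr a b w : kf_F (tot_dr (pull_cx g P) A a b p w) = tot_dr P B a b (g p) (kf_F w).
  move: w; apply: kf_ext => [u v|u v|m s l]; rewrite ?ohD ?kf_FD ?ohD //.
  rewrite /tot_dr kf_F_pure !otens_map_pure kf_F_pure.
  by congr tpure; apply: gsec_ext => t u /=; rewrite ohZ.
have Gl a b w : kf_G (tot_dl P B a b (g p) w) = tot_dl (pull_cx g P) A a b p (kf_G w).
  move: w; apply: tens_ext => [u v|u v|m s]; rewrite ?ohD ?kf_GD ?ohD //.
  rewrite /tot_dl kf_G_pure !otens_map_pure kf_G_pure.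
  by rewrite -[pull_map _ _ _ _]/(pull_fun (cd P (a - 1) a) _) pull_fun_pure.
have Gr a b w : kf_G (tot_dr P B a b (g p) w) = tot_dr (pull_cx g P) A a b p (kf_G w).
  move: w; apply: tens_ext => [u v|u v|m s]; rewrite ?ohD ?kf_GD ?ohD //.
  by rewrite /tot_dr kf_G_pure !otens_map_pure kf_G_pure.
pose tF := tot_add (@kf_FD); pose tG := tot_add (@kf_GD).
have dF : cd (tot P B) n (n + 1) (g p) (tF n x) = 0.
  by rewrite -[LHS](tot_add_d (@kf_FD) Fl Fr) dx tot_add0.
have [y Fy] := fP B (B_acyclic aA) n (g p) (tF n x) dF.
exists (tG _ y); rewrite -[RHS](tot_add_d (@kf_GD) Gl Gr) -[tot_d _ _ _ _ _ _]Fy.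
by apply: dsum_ext => -[a b]; rewrite !tot_addE kf_FK.
Qed.
End PullKFlat.

Lemma pull_K_flat (k : comPzRingType) (X Y : rfspace k) (g : rfmor X Y) (P : cx Y) :
  K_flat P -> K_flat (pull_cx g P).
Proof. by move=> fP A aA n p; apply: pull_K_flat_stalk. Qed.

Record kflat (k : comPzRingType) (X : rfspace k) := KFlat {
  kflat_cx :> cx X;
  kflatP : K_flat kflat_cx
}.

Record kinj (k : comPzRingType) (X : rfspace k) := KInj {
  kinj_cx :> cx X;
  kinjP : K_injective kinj_cx
}.

Record kflat_res (k : comPzRingType) (X : rfspace k) (A : cx X) := KFlatRes {
  kfr :> kflat X;
  kfr_map : cmap kfr A;
  kfr_qis : quasi_iso kfr_map
}.

Record kinj_res (k : comPzRingType) (X : rfspace k) (A : cx X) := KInjRes {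
  kir :> kinj X;
  kir_map : cmap A kir;
  kir_qis : quasi_iso kir_map
}.

(* [L f^* A] is [Lpull f P] for any K-flat resolution [P -> A], the left
   derived tensor product of [A] and [B] is [Ltensor P B], and [R f_* A] is
   [Rpush f J] for any K-injective resolution [A -> J]. These objects of the
   derived category do not depend on the resolution, up to a unique
   isomorphism. As [Lpull f P] is again K-flat, it can be used as it stands in
   [Ltensor] and in a further [Lpull]. *)
Definition Lpull (k : comPzRingType) (X Y : rfspace k) (f : rfmor X Y)
  (P : kflat Y) : kflat X := KFlat (@pull_K_flat k X Y f P (@kflatP k Y P)).

Definition Ltensor (k : comPzRingType) (X : rfspace k) (P : kflat X) (A : cx X) :
  cx X := tot P A.

Definition Rpush (k : comPzRingType) (X Y : rfspace k) (f : rfmor X Y)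
  (J : kinj X) : cx Y := push_cx f J.

Section Projection.
Variables (k : comPzRingType) (X Y : rfspace k) (f : rfmor X Y).

Section Modules.
Variables (M : omod Y) (N : omod X).

(* [m (x) s] is sent to the section [x |-> (m|_(f x) (x) 1) (x) s x]. *)
Let term (y : Y) (x : X) (u : minopen y (f x)) (m : M y) (s : gsec f N y) :
    otens (pull f M) N x :=
  tpure (bpure (fsh f x) (mres M (u : spec y (f x)) m) 1 : pull f M x) (s x u).

Let term_bal y x u : balanced (fun m (s : gsecM f N y) => @term y x u m s).
Proof.
rewrite /term; split=> [m m' n|m n n'|c m n].
- by rewrite mresD bpureDl tpureDl.
- exact: tpureDr.
by rewrite mresZ bpureZ -bpureZr tpureZ.
Qed.

Definition oproj_at (y : Y) (x : X) (u : minopen y (f x))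
    (t : otens M (push f N) y) : otens (pull f M) N x :=
  tlift (fun m (s : gsecM f N y) => term u m s) t.

Lemma oproj_at_pure y x u m s : @oproj_at y x u (tpure m s) = term u m s.
Proof. exact: (tlift_pure (term_bal u)). Qed.
Lemma oproj_atD y x u : {morph @oproj_at y x u : s t / s + t}.
Proof. exact: (tliftD (term_bal u)). Qed.
Lemma oproj_at0 y x u : @oproj_at y x u 0 = 0.
Proof. exact: (tlift0 (term_bal u)). Qed.
Lemma oproj_atZ y x u a t :
  @oproj_at y x u (a *: t) = fsh f x (ores (u : spec y (f x)) a) *: oproj_at u t.
Proof.
elim/tensor_ind: t => [|t t' ht ht'|m s]; first by rewrite scaler0 oproj_at0 scaler0.
  by rewrite scalerDr !oproj_atD scalerDr ht ht'.
by rewrite tpureZl !oproj_at_pure /term mresZ bpureZ -bpureZr tpureZl.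
Qed.
Lemma oproj_at_res y x x' (h : spec x x') (u : minopen y (f x))
    (u' : minopen y (f x')) t :
  mres (otens (pull f M) N) h (oproj_at u t) = oproj_at u' t.
Proof.
elim/tensor_ind: t => [|t t' ht ht'|m s]; first by rewrite !oproj_at0 mres0.
  by rewrite !oproj_atD mresD ht ht'.
rewrite !oproj_at_pure otens_res_pure (sfam_res _ _ _ u').
rewrite -[mres (pull f M) _ _]/(pull_res h _) pull_res_pure rmorph1.
by rewrite (mres_comp _ _ u').
Qed.
Lemma oproj_at_trans y y' (h : spec y y') x (u : minopen y' (f x))
    (u' : minopen y (f x)) t :
  oproj_at u (mres (otens M (push f N)) h t) = oproj_at u' t.
Proof.
elim/tensor_ind: t => [|t t' ht ht'|m s]; first by rewrite mres0 !oproj_at0.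
  by rewrite mresD !oproj_atD ht ht'.
rewrite otens_res_pure !oproj_at_pure /term (mres_comp _ _ u') /=.
by rewrite (Prop_irrelevance (spec_trans h u) u').
Qed.
End Modules.

Lemma oproj_at_nat (M M' : omod Y) (N N' : omod X) (a : ohom M M')
    (b : ohom N N') y x (u : minopen y (f x)) t :
  oproj_at u (otens_map a (push_map f b) y t) =
  otens_map (pull_map f a) b x (oproj_at u t).
Proof.
elim/tensor_ind: t => [|t t' ht ht'|m s]; first by rewrite oh0 !oproj_at0 oh0.
  by rewrite ohD !oproj_atD ohD ht ht'.
rewrite otens_map_pure !oproj_at_pure otens_map_pure.
rewrite -[pull_map f a _ _]/(pull_fun a _) pull_fun_pure.
by rewrite -oh_nat.
Qed.

Section Complexes.
Variables (E : cx Y) (F : cx X).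

Definition proj_val (n : int) (y : Y) (t : tot E (push_cx f F) n y) (x : X)
  (u : minopen y (f x)) : tot (pull_cx f E) F n x.
Proof.
exists (fun ij : int * int => oproj_at u (t ij)).
- by move=> ij nij; rewrite dfam_out // oproj_at0.
- by have [s hs] := dfam_fin t; exists s => ij /hs ->; rewrite oproj_at0.
Defined.

Definition proj_sec (n : int) (y : Y) (t : tot E (push_cx f F) n y) :
  gsec f (tot (pull_cx f E) F n) y.
Proof.
exists (proj_val t) => x x' h u u'; apply: dsum_ext => ij.
exact: oproj_at_res.
Defined.

Definition proj_hom (n : int) :
  ohom (tot E (push_cx f F) n) (push f (tot (pull_cx f E) F n)).
Proof.
refine (@OHom k Y (tot E (push_cx f F) n) (push f (tot (pull_cx f E) F n))
  (@proj_sec n) _ _).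
- move=> y a s t; apply: gsec_ext => x u; apply: dsum_ext => ij.
  rewrite -[LHS]/(oproj_at u (a *: s ij + t ij)) oproj_atD oproj_atZ; reflexivity.
- move=> y y' h t; apply: gsec_ext => x u; apply: dsum_ext => ij.
  exact: oproj_at_trans.
Defined.

Definition projection :
  cmap (tot E (push_cx f F)) (push_cx f (tot (pull_cx f E) F)).
Proof.
refine (@CMap k Y (tot E (push_cx f F)) (push_cx f (tot (pull_cx f E) F)) proj_hom _).
move=> n m y t; apply: gsec_ext => x u; apply: dsum_ext => -[i j].
rewrite -[LHS]/(oproj_at u (tot_d E (push_cx f F) n m y t (i, j))).
rewrite -[RHS]/(tot_d (pull_cx f E) F n m x (proj_val t u) (i, j)) !tot_dE.
case: ifP => _; last exact: oproj_at0.
rewrite oproj_atD oproj_atZ !rmorphXn !rmorphN !rmorph1.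
congr (_ + _ *: _).
  rewrite -[RHS]/(tot_dl (pull_cx f E) F i j x (oproj_at u (t (i - 1, j)))).
  rewrite /tot_dl -[RHS]oproj_at_nat; congr (oproj_at _ _).
  by apply: eq_otens_map => // s; apply: gsec_ext.
rewrite -[RHS]/(tot_dr (pull_cx f E) F i j x (oproj_at u (t (i, j - 1)))).
rewrite /tot_dr -[LHS]/(oproj_at u (otens_map _ (push_map f _) y _)) oproj_at_nat.
by apply: eq_otens_map => // w; apply: tmap_id.
Defined.
End Complexes.
End Projection.

Section GraphPull.
Variables (k : comPzRingType) (X Y : rfspace k) (f : rfmor X Y).
Let G : rfmor X (prodS X Y) := graphS f.
Let pi : rfmor (prodS X Y) X := proj1S X Y.

Section Modules.
Variables (M : omod X) (x : X).

(* [(m (x) c) (x) a |-> a Gamma^#(c) m] *)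
Definition graph_pull_in : pull pi M (G x) -> M x :=
  @blift _ _ (fsh pi (G x)) (M x) _ (fsh G x) (M x) id.
Definition graph_pull_fun : pull G (pull pi M) x -> M x :=
  @blift _ _ (fsh G x) (pull pi M (G x)) _ idfun (M x) graph_pull_in.

Let id_sl : semilin (fsh G x \o fsh pi (G x)) (id : M (pi (G x)) -> M x).
Proof.
move=> a u v; congr (_ *: _ + _).
by rewrite -[RHS]/(graph_sh f x (prod_inl (graph_pt f x) a)) graph_shl.
Qed.

Lemma graph_pull_in_pure m c :
  graph_pull_in (bpure (fsh pi (G x)) m c) = fsh G x c *: m.
Proof. exact: (blift_pure id_sl). Qed.
Lemma graph_pull_in_lin : semilin (fsh G x) graph_pull_in.
Proof. exact: (blift_lin id_sl). Qed.

Let in_sl : semilin (idfun \o fsh G x) graph_pull_in.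
Proof. exact: graph_pull_in_lin. Qed.

Lemma graph_pull_fun_pure w a :
  graph_pull_fun (bpure (fsh G x) w a) = a *: graph_pull_in w.
Proof. exact: (blift_pure in_sl). Qed.
Lemma graph_pull_funD : {morph graph_pull_fun : u v / u + v}.
Proof. exact: (bliftD in_sl). Qed.
Lemma graph_pull_fun0 : graph_pull_fun 0 = 0.
Proof. exact: (blift0 in_sl). Qed.
Lemma graph_pull_fun_lin : linear graph_pull_fun.
Proof. exact: (blift_lin in_sl). Qed.
End Modules.

Lemma graph_pull_in_res (M : omod X) x x' (h : spec x x')
    (h' : spec (G x) (G x')) w :
  graph_pull_in (mres (pull pi M) h' w) = mres M h (graph_pull_in w).
Proof.
have iD z := semilinD (@graph_pull_in_lin M z).
have i0 z := semilin0 (@graph_pull_in_lin M z).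
elim/bch_ind: w => [|w w' hw hw'|m c]; first by rewrite mres0 !i0 mres0.
  by rewrite mresD !iD mresD hw hw'.
rewrite -[mres (pull pi M) _ _]/(pull_res h' _) pull_res_pure.
rewrite !graph_pull_in_pure mresZ (fsh_nat h h'); congr (_ *: _).
by rewrite (Prop_irrelevance (spec_cont (@fcont _ _ _ pi) h') h).
Qed.

Definition graph_pull_hom (M : omod X) : ohom (pull G (pull pi M)) M.
Proof.
refine (@OHom k X (pull G (pull pi M)) M (@graph_pull_fun M)
  (@graph_pull_fun_lin M) _).
move=> x x' h u; rewrite -[mres (pull _ _) _ _]/(pull_res h u).
elim/bch_ind: u => [|u u' hu hu'|w a].
- by rewrite pull_res0 !graph_pull_fun0 mres0.
- by rewrite pull_resD !graph_pull_funD mresD hu hu'.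
rewrite pull_res_pure !graph_pull_fun_pure mresZ; congr (_ *: _).
exact: graph_pull_in_res.
Defined.

Lemma graph_pull_nat (M N : omod X) (b : ohom M N) x u :
  graph_pull_hom N x (pull_map G (pull_map pi b) x u) =
  b x (graph_pull_hom M x u).
Proof.
rewrite -[pull_map _ _ _ _]/(pull_fun (pull_map pi b) u).
rewrite -![graph_pull_hom _ _ _]/(graph_pull_fun _).
elim/bch_ind: u => [|u u' hu hu'|w a].
- by rewrite pull_fun0 !graph_pull_fun0 oh0.
- by rewrite pull_funD !graph_pull_funD ohD hu hu'.
rewrite pull_fun_pure !graph_pull_fun_pure ohZ; congr (_ *: _).
have iD Q := semilinD (@graph_pull_in_lin Q x).
have i0 Q := semilin0 (@graph_pull_in_lin Q x).
elim/bch_ind: w => [|w w' hw hw'|m c]; first by rewrite oh0 !i0 oh0.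
  by rewrite ohD !iD ohD hw hw'.
rewrite -[pull_map _ _ _ _]/(pull_fun b _) pull_fun_pure.
by rewrite !graph_pull_in_pure ohZ.
Qed.

Definition graph_pull (A : cx X) : cmap (pull_cx G (pull_cx pi A)) A.
Proof.
refine (@CMap k X (pull_cx G (pull_cx pi A)) A (fun n => graph_pull_hom (A n)) _).
by move=> n m x u; apply: graph_pull_nat.
Defined.
End GraphPull.

(* The derived category is the localization of the category of complexes at the
   quasi-isomorphisms: its morphisms are the zigzags [dhom] up to the congruence
   [deq]. *)
Inductive dhom (k : comPzRingType) (X : rfspace k) : cx X -> cx X -> Type :=
| did A : dhom A A
| dfwd A B C (f : cmap A B) (z : dhom B C) : dhom A C
| dbwd A B C (s : cmap B A) (hs : quasi_iso s) (z : dhom B C) : dhom A C.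
Arguments did {k X A}.
Arguments dbwd {k X A B C} s hs z.

Fixpoint dcomp (k : comPzRingType) (X : rfspace k) (A B C : cx X)
    (z : dhom A B) : dhom B C -> dhom A C :=
  match z in dhom A B return dhom B C -> dhom A C with
  | did _ => fun w => w
  | dfwd _ _ _ f z' => fun w => dfwd f (dcomp z' w)
  | dbwd _ _ _ s hs z' => fun w => dbwd s hs (dcomp z' w)
  end.

Inductive deq (k : comPzRingType) (X : rfspace k) :
    forall A B : cx X, dhom A B -> dhom A B -> Prop :=
| deq_refl A B (z : dhom A B) : deq z z
| deq_sym A B (z w : dhom A B) : deq z w -> deq w z
| deq_trans A B (z w v : dhom A B) : deq z w -> deq w v -> deq z v
| deq_fwd A B C (f : cmap A B) (z w : dhom B C) :
    deq z w -> deq (dfwd f z) (dfwd f w)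
| deq_bwd A B C (s : cmap B A) (hs : quasi_iso s) (z w : dhom B C) :
    deq z w -> deq (dbwd s hs z) (dbwd s hs w)
| deq_id A B (z : dhom A B) : deq (dfwd (cmap_id A) z) z
| deq_comp A B C D (f : cmap A B) (g : cmap B C) (z : dhom C D) :
    deq (dfwd f (dfwd g z)) (dfwd (cmap_comp g f) z)
| deq_fb A B C (s : cmap B A) (hs : quasi_iso s) (z : dhom B C) :
    deq (dfwd s (dbwd s hs z)) z
| deq_bf A B C (s : cmap B A) (hs : quasi_iso s) (z : dhom A C) :
    deq (dbwd s hs (dfwd s z)) z.

Definition dloc (k : comPzRingType) (X : rfspace k) (A B : cx X) (f : cmap A B) :
  dhom A B := dfwd f did.

Definition disom (k : comPzRingType) (X : rfspace k) (A B : cx X)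
    (z : dhom A B) : Prop :=
  exists w : dhom B A, deq (dcomp z w) did /\ deq (dcomp w z) did.

Section Natural.
Variables (k : comPzRingType) (X Y : rfspace k) (f : rfmor X Y) (M : omod X).
Let G : rfmor X (prodS X Y) := graphS f.
Let pi : rfmor (prodS X Y) X := proj1S X Y.
Variables (P : kflat_res (single M)).
Variables (I : kinj_res (single (@ounit k X))) (J : kinj_res (single M)).

(* The identification [L Gamma^* L pi^* M = M], as a map to [J]. *)
Definition graph_ident : cmap (Lpull G (Lpull pi P)) J :=
  cmap_comp (kir_map J) (cmap_comp (kfr_map P) (graph_pull f P)).

(* [psi] is the identification
     [L Gamma^* L pi^* M (x)^L O_X = L Gamma^* L pi^* M = M]
   in the derived category, when [O_X] is replaced with [I] and [M] with [J].
   As [J] is K-injective, such a [psi] exists and is unique up to homotopy, so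
   that [push_cmap G psi] is the image of this identification by [R Gamma_*]. *)
Definition represents_ident
    (psi : cmap (Ltensor (Lpull G (Lpull pi P)) I) J) : Prop :=
  deq (dloc (cmap_comp psi (tot_map (cmap_id (Lpull G (Lpull pi P))) (kir_map I))))
      (dloc (cmap_comp graph_ident (right_unit (Lpull G (Lpull pi P))))).

(* The projection formula morphism
     [L pi^* M (x)^L R Gamma_* O_X -> R Gamma_* (L Gamma^* L pi^* M (x)^L O_X)]
   followed by the image by [R Gamma_*] of the above identification. *)
Definition natural_morphism
    (psi : cmap (Ltensor (Lpull G (Lpull pi P)) I) J) :
    dhom (Ltensor (Lpull pi P) (Rpush G I)) (Rpush G J) :=
  dcomp (dloc (projection G (Lpull pi P) I)) (dloc (push_cmap G psi)).
End Natural.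

(* Main.v *)
Require Import Defs.
From HB Require Import structures.
From mathcomp Require Import all_boot all_order all_algebra.
From mathcomp Require Import boolp classical_sets functions cardinality topology.

Set Implicit Arguments.
Unset Strict Implicit.
Unset Printing Implicit Defensive.

Import GRing.Theory.
Local Open Scope classical_set_scope.
Local Open Scope ring_scope.

(* Let z = (x0, y0) and U = {x | z <= Gamma x}, an open subset of U_(x0). On the
   stalks at z, the composite of the projection morphism and of R Gamma_*(psi)
   becomes a morphism T_U : P_(x0) (x) I(U) -> J(U) over O_(x0), where P -> M is
   the K-flat resolution and O -> I, M -> J are the K-injective ones. The claim
   that T_U is a quasi-isomorphism makes sense for every open subset U of
   U_(x0), and is proved by induction on the number of points of U.

   If U is not empty, let x be a minimal point of U, and write U as the union of
   U_x and V, where V consists of the points of U not below x. Since I and J are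
   K-injective, the complexes I(U) -> I(U_x) + I(V) -> I(U_x /\ V), and the same
   with J, have an acyclic totalization: they are Hom complexes out of an acyclic
   complex of extensions by zero of O. As P is K-flat, tensoring with P_(x0)
   preserves this, and the five lemma reduces U to U_x, V and U_x /\ V.

   If U = U_x, the morphism is P_(x0) (x) I_x -> J_x. Here I_x can be replaced
   with O_x because P is K-flat, and H(P_(x0) (x) O_x) = M_(x0) (x) O_x because
   O_(x0) -> O_x is flat; finally M_(x0) (x) O_x = M_x because M is
   quasi-coherent. *)

(** * Complexes of abelian groups, and zigzags *)

(** K-flatness of P is a property of complexes of sheaves on X, whereas the argument lives on the
    stalk at z. Hence every complex to which this property is applied is realized as a complex of
    sheaves on X with the right stalk at p = x0: the sheaf [secs U F] has stalk F(U /\ U_p) at p,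
    and U = {x} turns the stalk at x into a skyscraper sheaf. The stalk at z is reached from there
    by cancelling a base change from O_p to O_z.

    A K-injective complex need not have injective terms, so the restriction from I(U_x) + I(V) to
    I(U_x /\ V) may fail to be surjective and there is no short exact sequence of complexes. This is
    why squares are handled through the acyclicity of their totalization, and the five lemma is a
    chase of cochains in it.

    The map psi is constrained only by an equality of zigzags in the derived category. It is
    exploited through the effect of zigzags on cocycles, and this is enough: all comparisons are
    made in the cohomology of stalks. *)

Record zcx := Zcx {
  zob :> int -> zmodType;
  zd : forall i j, zob i -> zob j;
  zdD : forall i j, {morph @zd i j : x y / x + y};
  zd_sq : forall i j l x, @zd j l (@zd i j x) = 0
}.
Arguments zd _ i j _ : clear implicits.

(** Only additivity is required, because the maps compared below go between stalks at different
    points, which are modules over different rings. *)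
Record zmap (A B : zcx) := ZMap {
  zf :> forall i, A i -> B i;
  zfD : forall i, {morph @zf i : x y / x + y};
  zf_d : forall i j x, @zf j (zd A i j x) = zd B i j (@zf i x)
}.

Arguments zf {A B} _ i _.

Definition zqis (A B : zcx) (f : zmap A B) : Prop := forall n,
  (forall x : A n, zd A n (n + 1) x = 0 ->
    (exists y : B (n - 1), f n x = zd B (n - 1) n y) ->
    exists z : A (n - 1), x = zd A (n - 1) n z) /\
  (forall y : B n, zd B n (n + 1) y = 0 ->
    exists (x : A n) (z : B (n - 1)),
      zd A n (n + 1) x = 0 /\ y = f n x + zd B (n - 1) n z).

Definition zcohom (A : zcx) n (x y : A n) : Prop :=
  exists z : A (n - 1), x = y + zd A (n - 1) n z.

Section Additive.
Variables (U V : zmodType) (f : U -> V).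
Hypothesis fD : {morph f : x y / x + y}.
Lemma madd0 : f 0 = 0.
Proof.
by have /eqP := fD 0 0; rewrite addr0 -subr_eq0 opprD addNKr oppr_eq0 => /eqP.
Qed.
Lemma maddN : {morph f : x / - x}.
Proof. by move=> x; apply/eqP; rewrite -subr_eq0 opprK -fD addNr madd0. Qed.
Lemma maddB : {morph f : x y / x - y}.
Proof. by move=> x y; rewrite fD maddN. Qed.
Lemma madd_sum (I : Type) (r : seq I) (F : I -> U) :
  f (\sum_(i <- r) F i) = \sum_(i <- r) f (F i).
Proof. exact: (big_morph f fD madd0). Qed.
Lemma madd_int (x : U) (n : int) : f (x *~ n) = f x *~ n.
Proof.
have fn m : f (x *+ m) = f x *+ m.
  by elim: m => [|m IH]; rewrite ?madd0 // !mulrS fD IH.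
by case: n => m; rewrite ?NegzE ?mulrNz ?maddN -!pmulrn fn.
Qed.
End Additive.

Section Zqis.
Implicit Types A B C : zcx.

Lemma zd0 A i j : zd A i j 0 = 0. Proof. exact: madd0 (@zdD A i j). Qed.
Lemma zdN A i j : {morph zd A i j : x / - x}. Proof. exact: maddN (@zdD A i j). Qed.
Lemma zdB A i j : {morph zd A i j : x y / x - y}.
Proof. exact: maddB (@zdD A i j). Qed.
Lemma zf0 A B (f : zmap A B) i : f i 0 = 0. Proof. exact: madd0 (@zfD _ _ f i). Qed.
Lemma zfB A B (f : zmap A B) i : {morph f i : x y / x - y}.
Proof. exact: maddB (@zfD _ _ f i). Qed.

Lemma zcohom_refl A n (x : A n) : zcohom x x.
Proof. by exists 0; rewrite zd0 addr0. Qed.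
Lemma zcohom_sym A n (x y : A n) : zcohom x y -> zcohom y x.
Proof. by move=> [z ->]; exists (- z); rewrite zdN addrK. Qed.
Lemma zcohom_trans A n (x y z : A n) : zcohom x y -> zcohom y z -> zcohom x z.
Proof. by move=> [u ->] [v ->]; exists (v + u); rewrite zdD addrA. Qed.
Lemma zcohom_map A B (f : zmap A B) n (x y : A n) : zcohom x y -> zcohom (f n x) (f n y).
Proof. by move=> [z ->]; exists (f _ z); rewrite zfD zf_d. Qed.
Lemma zqis_inj A B (f : zmap A B) n (x y : A n) : zqis f ->
  zd A n (n + 1) x = 0 -> zd A n (n + 1) y = 0 -> zcohom (f n x) (f n y) -> zcohom x y.
Proof.
move=> /(_ n)[fi _] dx dy [z fxy].
have [|//|w xy] := fi (x - y); first by rewrite zdB dx dy subrr.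
  by exists z; rewrite zfB fxy addrC addKr.
by exists w; rewrite -xy addrC subrK.
Qed.

Definition zcomp A B C (g : zmap B C) (f : zmap A B) : zmap A C.
Proof.
refine (@ZMap A C (fun i x => g i (f i x)) _ _).
- by move=> i x y; rewrite !zfD.
- by move=> i j x; rewrite !zf_d.
Defined.

Lemma zqis_comp A B C (g : zmap B C) (f : zmap A B) :
  zqis g -> zqis f -> zqis (zcomp g f).
Proof.
move=> qg qf n; split=> [x dx [y fx]|y dy].
  have dfx : zd B n (n + 1) (f n x) = 0 by rewrite -zf_d dx zf0.
  by have [gi _] := qg n; have [fi _] := qf n; apply: fi (gi _ dfx _) => //; exists y.
have [_ /(_ y dy)[b [z [db ->]]]] := qg n.
have [_ /(_ b db)[a [w [da ->]]]] := qf n.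
by exists a, (g _ w + z); split=> //=; rewrite zfD zdD zf_d addrA.
Qed.

Lemma zqis_cancel_l A B C (g : zmap B C) (f : zmap A B) :
  zqis g -> zqis (zcomp g f) -> zqis f.
Proof.
move=> qg qgf n; split=> [x dx [y fx]|y dy].
  have [gfi _] := qgf n; apply: gfi => //.
  by exists (g _ y); rewrite /= fx zf_d.
have dgy : zd C n (n + 1) (g n y) = 0 by rewrite -zf_d dy zf0.
have [_ /(_ _ dgy)[a [z [da gy]]]] := qgf n.
have dfa : zd B n (n + 1) (f n a) = 0 by rewrite -zf_d da zf0.
have [w yw] : zcohom y (f n a) by apply: zqis_inj qg dy dfa _; exists z.
by exists a, w.
Qed.

Lemma zqis_cancel_r A B C (g : zmap B C) (f : zmap A B) :
  zqis f -> zqis (zcomp g f) -> zqis g.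
Proof.
move=> qf qgf n; split=> [x dx [y gx]|y dy].
  have [_ /(_ x dx)[a [z [da xE]]]] := qf n.
  have [gfi _] := qgf n; have [|b ab] := gfi a da.
    exists (y - g _ z); rewrite zdB -gx xE zfD zf_d /= addrK //.
  by exists (f _ b + z); rewrite zdD -zf_d -ab.
have [_ /(_ y dy)[a [z [da ->]]]] := qgf n.
by exists (f n a), z; rewrite -zf_d da zf0.
Qed.

Lemma zqis_bij A B (f : zmap A B) (g : forall i, B i -> A i) :
  (forall i, cancel (f i) (g i)) -> (forall i, cancel (g i) (f i)) -> zqis f.
Proof.
move=> fK gK n; split=> [x dx [y fx]|y dy].
  exists (g _ y); apply: (can_inj (fK n)).
  by rewrite zf_d gK.
exists (g n y), 0; rewrite zd0 addr0 gK; split=> //.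
by apply: (can_inj (fK _)); rewrite zf_d gK dy zf0.
Qed.

(** This allows a map to be replaced with one that agrees with it in cohomology only, which is all
    that an equality in the derived category provides. *)
Lemma zqis_cohom A B (f g : zmap A B) :
  (forall n x, zd A n (n + 1) x = 0 -> zcohom (f n x) (g n x)) ->
  zqis f -> zqis g.
Proof.
move=> fg qf n; split=> [x dx [y gx]|y dy].
  have [fi _] := qf n; apply: fi => //.
  by have [z ->] := fg n x dx; exists (y + z); rewrite gx zdD.
have [_ /(_ y dy)[a [z [da ->]]]] := qf n.
have [w ->] := fg n a da.
by exists a, (w + z); rewrite zdD addrA.
Qed.
End Zqis.

Section Stalks.
Variables (k : comPzRingType) (X : rfspace k) (p : X).

Definition stalk (A : cx X) : zcx.
Proof.
refine (@Zcx (fun i => A i p) (fun i j => cd A i j p) _ _).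
- by move=> i j; apply: ohD.
- by move=> i j l x; apply: cd_sq.
Defined.

Definition stalk_map (A B : cx X) (f : cmap A B) : zmap (stalk A) (stalk B).
Proof.
refine (@ZMap (stalk A) (stalk B) (fun i => f i p) _ _).
- by move=> i; apply: ohD.
- by move=> i j x; apply: cf_d.
Defined.
End Stalks.

Lemma quasi_isoP (k : comPzRingType) (X : rfspace k) (A B : cx X) (f : cmap A B) :
  quasi_iso f <-> forall p, zqis (stalk_map p f).
Proof. by split=> [q p n|q n p]; have := q _ _; apply. Qed.

Section Zigzag.
Variables (k : comPzRingType) (X : rfspace k).

(* The action of a zigzag on cohomology, as a relation between cocycles; it is
   invariant under [deq]. *)
Fixpoint zrel (A B : cx X) (z : dhom A B) n p : stalk p A n -> stalk p B n -> Prop :=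
  match z in dhom A B return stalk p A n -> stalk p B n -> Prop with
  | did _ => fun a b => zcohom a b
  | dfwd _ _ _ f z' => fun a c => zrel z' (stalk_map p f n a) c
  | dbwd A B _ s _ z' => fun a c => exists b : stalk p B n,
      [/\ cd B n (n + 1) p b = 0, zcohom a (stalk_map p s n b) & zrel z' b c]
  end.

Lemma zrel_cohom (A B : cx X) (z : dhom A B) n p (a a' : stalk p A n) c :
  zcohom a a' -> zrel z a' c -> zrel z a c.
Proof.
elim: z a a' c => [A' a a' c|A' B' C' f z IH a a' c|A' B' C' s hs z IH a a' c] /= aa'.
- exact: zcohom_trans.
- move=> za; apply: IH za; exact: (zcohom_map (stalk_map p f) aa').
by move=> [b [db bb zb]]; exists b; split=> //; apply: zcohom_trans bb.
Qed.

Lemma deq_zrel (A B : cx X) (z w : dhom A B) : deq z w ->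
  forall n p (a : stalk p A n) c, cd A n (n + 1) p a = 0 -> zrel z a c <-> zrel w a c.
Proof.
have fd (A' B' : cx X) (f : cmap A' B') n p (a : A' n p) :
    cd A' n (n + 1) p a = 0 -> cd B' n (n + 1) p (f n p a) = 0.
  by move=> da; rewrite -cf_d da oh0.
elim=> {A B z w} //.
- by move=> A B z w _ IH n p a c da; rewrite IH.
- by move=> A B z w v _ IH _ IH' n p a c da; rewrite IH // IH'.
- by move=> A B C f z w _ IH n p a c da; apply: IH; apply: fd.
- move=> A B C s hs z w _ IH n p a c da /=.
  by split=> -[b [db ab zb]]; exists b; split=> //; apply/IH.
(* Cancelling [s] before its formal inverse uses that [s] is injective on cohomology; cancelling it
   after its formal inverse, in the next case, uses that it is surjective. *)
- move=> A B C s /[dup] /quasi_isoP qs hs z n p a c da /=; split=> [[b [db ab zb]]|za].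
    by apply: zrel_cohom zb; apply: zqis_inj (qs p) da db ab.
  by exists a; split=> //; apply: zcohom_refl.
- move=> A B C s /[dup] /quasi_isoP qs hs z n p a c da /=; split=> [[b [db ab zb]]|za].
    exact: zrel_cohom zb.
  have [_ /(_ a da)[b [y [db ay]]]] := qs p n.
  have ab : zcohom a (stalk_map p s n b) by exists y.
  by exists b; split=> //; apply: zrel_cohom za; apply: zcohom_sym.
Qed.

(** The only consequence of an equality in the derived category that is used later. *)
Lemma dloc_cohom (A B : cx X) (f g : cmap A B) : deq (dloc f) (dloc g) ->
  forall n p (a : stalk p A n), cd A n (n + 1) p a = 0 ->
  zcohom (stalk_map p f n a) (stalk_map p g n a).
Proof.
by move=> fg n p a da; apply/(deq_zrel fg (stalk_map p g n a) da); apply: zcohom_refl.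
Qed.

Lemma disom_quasi_iso (A B C : cx X) (f : cmap A B) (g : cmap B C) :
  quasi_iso (cmap_comp g f) -> disom (dcomp (dloc f) (dloc g)).
Proof.
move=> q; exists (dbwd _ q did); split => /=.
  apply: deq_trans (deq_comp _ _ _) _; exact: deq_fb.
apply: deq_trans (deq_bwd _ (deq_comp _ _ _)) _; exact: deq_bf.
Qed.
End Zigzag.

(** * Totalization of finite diagrams of complexes *)

Section Dput.
Variables (I : choiceType) (V : I -> zmodType).

Definition dput (i : I) (v : V i) (j : I) : V j :=
  match i =P j with
  | ReflectT e => eq_rect i (fun j => V j) v j e
  | ReflectF _ => 0
  end.

Lemma dput_id i (v : V i) : dput v i = v.
Proof. by rewrite /dput; case: eqP => // e; rewrite (Prop_irrelevance e erefl). Qed.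
Lemma dput_out i (v : V i) j : i != j -> dput v j = 0.
Proof. by rewrite /dput; case: eqP. Qed.
End Dput.

Lemma ohN (k : comPzRingType) (X : rfspace k) (M N : omod X) (f : ohom M N) p :
  {morph f p : x / - x}.
Proof. exact: (@maddN _ _ (f p) (@ohD _ _ _ _ f p)). Qed.
Lemma oh_sum (k : comPzRingType) (X : rfspace k) (M N : omod X) (f : ohom M N) p
    (I : Type) (r : seq I) (F : I -> M p) :
  f p (\sum_(i <- r) F i) = \sum_(i <- r) f p (F i).
Proof. exact: (@madd_sum _ _ (f p) (@ohD _ _ _ _ f p)). Qed.
Lemma oh_int (k : comPzRingType) (X : rfspace k) (M N : omod X) (f : ohom M N) p x n :
  f p (x *~ n) = f p x *~ n.
Proof. exact: (@madd_int _ _ (f p) (@ohD _ _ _ _ f p)). Qed.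
Lemma mres_sum (k : comPzRingType) (X : rfspace k) (M : omod X) p q (h : spec p q)
    (I : Type) (r : seq I) (F : I -> M p) :
  mres M h (\sum_(i <- r) F i) = \sum_(i <- r) mres M h (F i).
Proof. exact: (@madd_sum _ _ (mres M h) (mresD h)). Qed.
Lemma mres_int (k : comPzRingType) (X : rfspace k) (M : omod X) p q (h : spec p q) x n :
  mres M h (x *~ n) = mres M h x *~ n.
Proof. exact: (@madd_int _ _ (mres M h) (mresD h)). Qed.

Section Fintot.
Variables (k : comPzRingType) (X : rfspace k) (K : finType) (deg : K -> int).

(* The totalization of a finite diagram [c] of complexes [A a], with [A a] put in
   degree [deg a]. Its elements of degree [n] are the families [x (a, j)] with
   [j + deg a = n], so that no cast between degrees is needed. *)
Definition fin_ob (A : K -> cx X) (n : int) : omod X :=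
  odsum (fun aj : K * int => aj.2 + deg aj.1 == n) (fun aj => A aj.1 aj.2).

Section Def.
Variables (A : K -> cx X) (c : forall a b, cmap (A a) (A b)).

(** The maps [c a b] commute with the differentials; a sign that alternates with the internal degree
    makes them anticommute, as a differential of square zero requires. *)
Definition fin_dfun (n m : int) (p : X) (x : fin_ob A n p) (bj : K * int) :
    A bj.1 bj.2 p :=
  if n + 1 == m then cd (A bj.1) (bj.2 - 1) bj.2 p (x (bj.1, bj.2 - 1)) +
    (-1) ^+ `|bj.2|%N *: \sum_a c a bj.1 bj.2 p (x (a, bj.2))
  else 0.

Hypothesis c_deg : forall a b j p x, deg b != deg a + 1 -> c a b j p x = 0.
Hypothesis c_sq : forall a e j p x, \sum_b c b e j p (c a b j p x) = 0.

Definition fin_dterm (n m : int) (p : X) (x : fin_ob A n p) : fin_ob A m p.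
Proof.
exists (fin_dfun m x).
- move=> [b j] /= bjm; rewrite /fin_dfun /=; case: eqP => // nm.
  rewrite dfam_out ?oh0 ?add0r; last first.
    by apply: contra bjm => /eqP /= h; rewrite -nm -h addrAC subrK.
  rewrite big1 ?scaler0 // => a _.
  have [ba|/c_deg -> //] := eqVneq (deg b) (deg a + 1).
  rewrite dfam_out ?oh0 //.
  by apply: contra bjm => /eqP /= h; rewrite -nm -h ba addrA.
- have [s hs] := dfam_fin x.
  (* The internal differentials raise the degree by one. The maps of the diagram keep the internal
     degree but may reach any index [b]. *)
  exists ([seq (bj.1, bj.2 + 1) | bj <- s] ++
          [seq (b, j) | b <- enum K, j <- [seq aj.2 | aj <- s]]).
  move=> [b j]; rewrite mem_cat negb_or => /andP[h1 h2].
  rewrite /fin_dfun /=; case: ifP => // _; rewrite hs ?oh0 ?add0r; last first.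
    by apply: contra h1 => h; apply/mapP; exists (b, j - 1); rewrite //= subrK.
  rewrite big1 ?scaler0 // => a _; rewrite hs ?oh0 //.
  apply: contra h2 => h; apply/allpairsP; exists (b, j); split; rewrite ?mem_enum //.
  by apply/mapP; exists (a, j).
Defined.

Lemma fin_dterm_lin n m p : linear (@fin_dterm n m p).
Proof.
move=> u x y; apply: dsum_ext => -[b j].
rewrite -[LHS]/(fin_dfun m (u *: x + y) (b, j)).
rewrite -[RHS]/(u *: fin_dfun m x (b, j) + fin_dfun m y (b, j)) /fin_dfun /=.
case: ifP => // _; last by rewrite scaler0 addr0.
rewrite (eq_bigr (fun a => u *: c a b j p (x (a, j)) + c a b j p (y (a, j)))); last first.
  by move=> a _; rewrite -oh_lin.
rewrite big_split -scaler_sumr /= !(ohD, ohZ) !scalerDr !scalerA (mulrC _ u).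
by rewrite addrACA.
Qed.

Lemma fin_dterm_nat n m p q (h : spec p q) (x : fin_ob A n p) :
  fin_dterm m (mres (fin_ob A n) h x) = mres (fin_ob A m) h (fin_dterm m x).
Proof.
apply: dsum_ext => -[b j].
rewrite -[LHS]/(fin_dfun m (mres (fin_ob A n) h x) (b, j)).
rewrite -[RHS]/(mres (A b j) h (fin_dfun m x (b, j))) /fin_dfun /=.
case: ifP => _; last by rewrite mres0.
rewrite mresD mresZ mres_sum -!oh_nat rmorphXn rmorphN rmorph1.
by congr (_ + _ *: _); apply: eq_bigr => a _; rewrite -oh_nat.
Qed.

Definition fin_d (n m : int) : ohom (fin_ob A n) (fin_ob A m) :=
  OHom (@fin_dterm_lin n m) (@fin_dterm_nat n m).

Lemma fin_dE n m p (x : fin_ob A n p) b j : fin_d n m p x (b, j) =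
  if n + 1 == m then cd (A b) (j - 1) j p (x (b, j - 1)) +
    (-1) ^+ `|j|%N *: \sum_a c a b j p (x (a, j)) else 0.
Proof. by []. Qed.

Definition fintot : cx X.
Proof.
refine (@Cx k X (fin_ob A) fin_d _ _).
- move=> i j p x ij; apply: dsum_ext => -[a b].
  by rewrite fin_dE eq_sym (negPf ij).
- move=> n m l p x; apply: dsum_ext => -[b j]; rewrite fin_dE.
  case: ifP => // /eqP ml; rewrite fin_dE.
  have [nm|nm] := eqVneq (n + 1) m; last first.
    rewrite oh0 add0r big1 ?scaler0 // => a _.
    by rewrite fin_dE (negPf nm) oh0.
  rewrite ohD cd_sq add0r ohZ oh_sum.
  rewrite [X in _ + _ *: X](eq_bigr (fun a => cd (A b) (j - 1) j p (c a b (j - 1) p (x (a, j - 1))) +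
    (-1) ^+ `|j|%N *: \sum_e c a b j p (c e a j p (x (e, j))))); last first.
    move=> a _; rewrite fin_dE nm eqxx ohD ohZ -cf_d oh_sum.
    by congr (_ + _ *: _); apply: eq_bigr.
  rewrite big_split /= -scaler_sumr [X in _ *: (_ + _ *: X)]exchange_big /=.
  rewrite [X in _ *: (_ + _ *: X)]big1 ?scaler0 ?addr0; last by move=> a _; apply: c_sq.
  by rewrite sign_pred scaleNr addNr.
Defined.

Lemma fintot_dE n p (x : fintot n p) b j : cd fintot n (n + 1) p x (b, j) =
  cd (A b) (j - 1) j p (x (b, j - 1)) +
    (-1) ^+ `|j|%N *: \sum_a c a b j p (x (a, j)).
Proof. by rewrite [LHS]fin_dE eqxx. Qed.
Lemma fintot_dE' n p (x : fintot (n - 1) p) b j : cd fintot (n - 1) n p x (b, j) =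
  cd (A b) (j - 1) j p (x (b, j - 1)) +
    (-1) ^+ `|j|%N *: \sum_a c a b j p (x (a, j)).
Proof. by rewrite [LHS]fin_dE subrK eqxx. Qed.
End Def.
End Fintot.

Lemma sign_add (R : pzRingType) (i j : int) :
  (-1) ^+ absz (i + j) = (-1) ^+ `|i|%N * (-1) ^+ `|j|%N :> R.
Proof.
have S l : (-1) ^+ absz (l + 1) = - (-1) ^+ `|l|%N :> R.
  by apply: oppr_inj; rewrite -(sign_pred _ (l + 1)) addrK opprK.
elim/int_rect: i => [|n IH|n IH]; first by rewrite add0r mul1r.
  by rewrite -addn1 PoszD addrAC !S IH mulNr.
by rewrite -addn1 PoszD opprD addrAC !sign_pred IH mulNr.
Qed.

Lemma sign_sq (R : pzRingType) (i : int) : (-1) ^+ `|i|%N * (-1) ^+ `|i|%N = 1 :> R.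
Proof. by rewrite -expr2 sqrr_sign. Qed.

Section DsumCoord.
Variables (I : choiceType) (Q : pred I) (R : pzRingType) (V : I -> lmodType R).
Lemma dsum_coord_sum (J : Type) (r : seq J) (F : J -> dsumM Q V) i :
  (\sum_(a <- r) F a : dsumM Q V) i = \sum_(a <- r) F a i.
Proof. by elim/big_rec2: _ => // a y x _ <-. Qed.
End DsumCoord.

Section OtensLin.
Variables (k : comPzRingType) (X : rfspace k).
Lemma tpure_sumr (R : comPzRingType) (M N : lmodType R) m (I : Type) (r : seq I)
    (F : I -> N) :
  tpure m (\sum_(i <- r) F i) = \sum_(i <- r) tpure m (F i) :> tens M N.
Proof. exact: (@madd_sum _ _ (tpure m : N -> tens M N) (@tpureDr _ _ _ m)). Qed.
Lemma otens_map_id (M N : omod X) p (x : otens M N p) :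
  otens_map (ohom_id M) (ohom_id N) p x = x.
Proof. exact: tmap_id. Qed.
Lemma otens_map_sum0 (M N N' : omod X) (I : finType) (f : I -> ohom N N') p t :
  (forall n, \sum_b f b p n = 0) -> \sum_b otens_map (ohom_id M) (f b) p t = 0.
Proof.
move=> f0; elim/tensor_ind: t => [|u v hu hv|m n].
- by rewrite big1 // => b _; rewrite oh0.
- rewrite (eq_bigr (fun b => otens_map (ohom_id M) (f b) p u +
    otens_map (ohom_id M) (f b) p v)); last by move=> b _; rewrite ohD.
  by rewrite big_split /= hu hv addr0.
rewrite (eq_bigr (fun b => tpure m (f b p n))); last by move=> b _; rewrite otens_map_pure.
by rewrite -tpure_sumr f0 -(scale0r 0) -tpureZr scale0r.
Qed.
End OtensLin.

(** * Tensor product of a complex with a totalization *)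

Section TotFintot.
Variables (k : comPzRingType) (X : rfspace k) (K : finType) (deg : K -> int).
Variables (A : K -> cx X) (c : forall a b, cmap (A a) (A b)).
Hypothesis c_deg : forall a b j p x, deg b != deg a + 1 -> c a b j p x = 0.
Hypothesis c_sq : forall a e j p x, \sum_b c b e j p (c a b j p x) = 0.
Variable P : cx X.

Let A' a := tot P (A a).
Let c' a b : cmap (A' a) (A' b) := tot_map (cmap_id P) (c a b).

Lemma tot_fin_deg a b j p x : deg b != deg a + 1 -> c' a b j p x = 0.
Proof.
move=> ab; apply: dsum_ext => -[i l].
by rewrite -[LHS]/(otens_map _ _ p (x (i, l))) otens_map0r // => m; apply: c_deg.
Qed.

Lemma tot_fin_sq a e j p x : \sum_b c' b e j p (c' a b j p x) = 0.
Proof.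
apply: dsum_ext => -[i l]; rewrite dsum_coord_sum.
rewrite (eq_bigr (fun b => otens_map (ohom_id (P i))
  (ohom_comp (c b e l) (c a b l)) p (x (i, l)))); last first.
  move=> b _; rewrite -[LHS]/(otens_map (ohom_id _) (c b e l) p
    (otens_map (ohom_id _) (c a b l) p (x (i, l)))).
  by rewrite otens_map_comp; apply: eq_otens_map.
by apply: otens_map_sum0 => n; apply: c_sq.
Qed.

Let F := fintot c_deg c_sq.
Let F' := fintot tot_fin_deg tot_fin_sq.

Definition fin_pr (a : K) (j m : int) : ohom (F m) (A a j).
Proof. by refine (@OHom k X (F m) (A a j) (fun p x => x (a, j)) _ _). Defined.

Definition fin_in_fun (a : K) (j m : int) p (x : A a j p) : F m p.
Proof.
exists (fun bl => if j + deg a == m then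
  @dput _ (fun bl : K * int => A bl.1 bl.2 p) (a, j) x bl else 0).
- move=> [b l] blm; case: ifP => // /eqP ajm; rewrite dput_out //.
  by apply: contra blm => /eqP[<- <-] /=; rewrite ajm.
- exists [:: (a, j)] => bl; rewrite inE eq_sym => h.
  by case: ifP => // _; rewrite dput_out.
Defined.

Definition fin_in (a : K) (j m : int) : ohom (A a j) (F m).
Proof.
refine (@OHom k X (A a j) (F m) (@fin_in_fun a j m) _ _).
- move=> p u x y; apply: dsum_ext => bl /=.
  case: ifP => _; last by rewrite scaler0 addr0.
  rewrite /dput; case: eqP => [e|_]; last by rewrite scaler0 addr0.
  by case: bl / e.
- move=> p q h x; apply: dsum_ext => bl /=.
  case: ifP => _; last by rewrite mres0.
  rewrite /dput; case: eqP => [e|_]; last by rewrite mres0.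
  by case: bl / e.
Defined.

Let phi n p (x : tot P F n p) a i j : otens (P i) (A a j) p :=
  otens_map (ohom_id (P i)) (fin_pr a j (j + deg a)) p (x (i, j + deg a)).

Let phi_eq n p (x : tot P F n p) a i j m : m = j + deg a ->
  otens_map (ohom_id (P i)) (fin_pr a j m) p (x (i, m)) = phi x a i j.
Proof. by move=> ->. Qed.

Definition tot_fin_fun1 n p (x : tot P F n p) a l : tot P (A a) l p.
Proof.
exists (fun ij => if ij.1 + ij.2 == l then phi x a ij.1 ij.2 else 0).
- by move=> [i j] /= /negPf ->.
- have [s hs] := dfam_fin x; exists [seq (im.1, im.2 - deg a) | im <- s].
  move=> [i j] h; case: ifP => //= _; rewrite /phi hs ?oh0 //.
  by apply: contra h => h; apply/mapP; exists (i, j + deg a); rewrite //= addrK.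
Defined.

Definition tot_fin_fun n p (x : tot P F n p) : F' n p.
Proof.
exists (fun al => tot_fin_fun1 x al.1 al.2).
- move=> [a l] /= al; apply: dsum_ext => -[i j] /=; case: eqP => // ij.
  by rewrite /phi dfam_out ?oh0 // addrA ij.
- have [s hs] := dfam_fin x.
  exists [seq (a, im.1 + im.2 - deg a) | a <- enum K, im <- s] => -[a l] h.
  apply: dsum_ext => -[i j] /=; case: eqP => // ij; rewrite /phi hs ?oh0 //.
  apply: contra h => h; apply/allpairsP; exists (a, (i, j + deg a)); split => //=.
    by rewrite mem_enum.
  by rewrite addrA addrK ij.
Defined.

Lemma tot_fin_funE n p (x : tot P F n p) a l i j : i + j = l ->
  tot_fin_fun x (a, l) (i, j) = phi x a i j.
Proof. by move=> <- /=; rewrite eqxx. Qed.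

Let dr_pr i j m b p (t : otens (P i) (F (m - 1)) p) : m = j + deg b ->
  otens_map (ohom_id (P i)) (fin_pr b j m) p (tot_dr P F i m p t) =
  tot_dr P (A b) i j p (otens_map (ohom_id (P i)) (fin_pr b (j - 1) (m - 1)) p t) +
  (-1) ^+ `|j|%N *: \sum_a otens_map (ohom_id (P i)) (c a b j) p
    (otens_map (ohom_id (P i)) (fin_pr a j (m - 1)) p t).
Proof.
move=> mj; elim/tensor_ind: t => [|u v hu hv|y x].
- by rewrite !oh0 add0r big1 ?scaler0 // => a _; rewrite !oh0.
- rewrite !ohD hu hv.
  rewrite [X in _ = _ + _ *: X](eq_bigr (fun a => otens_map (ohom_id (P i)) (c a b j) p
    (otens_map (ohom_id (P i)) (fin_pr a j (m - 1)) p u) +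
    otens_map (ohom_id (P i)) (c a b j) p
    (otens_map (ohom_id (P i)) (fin_pr a j (m - 1)) p v))).
    by rewrite big_split /= scalerDr addrACA.
  by move=> a _; rewrite !ohD.
rewrite /tot_dr !otens_map_pure -[fin_pr b j m p _]/(cd F (m - 1) m p x (b, j)).
rewrite fintot_dE' tpureDr -tpureZr tpure_sumr; congr (_ + _ *: _).
by apply: eq_bigr => a _; rewrite !otens_map_pure.
Qed.

Lemma tot_fin_fun_d n p (x : tot P F n p) :
  tot_fin_fun (cd (tot P F) n (n + 1) p x) = cd F' n (n + 1) p (tot_fin_fun x).
Proof.
apply: dsum_ext => -[b l]; apply: dsum_ext => -[i j].
have [ij|ij] := eqVneq (i + j) l; last first.
  by rewrite !(dfam_out (_ : dsum _ _)).
rewrite tot_fin_funE // /phi tot_dE eqxx ohD ohZ dr_pr //.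
have -> : cd F' n (n + 1) p (tot_fin_fun x) (b, l) (i, j) =
  tot_dl P (A b) i j p (tot_fin_fun x (b, l - 1) (i - 1, j)) +
  (-1) ^+ `|i|%N *: tot_dr P (A b) i j p (tot_fin_fun x (b, l - 1) (i, j - 1)) +
  (-1) ^+ `|l|%N *: \sum_a otens_map (ohom_id (P i)) (c a b j) p (tot_fin_fun x (a, l) (i, j)).
  rewrite fintot_dE.
  rewrite -[LHS]/(tot_d P (A b) (l - 1) l p (tot_fin_fun x (b, l - 1)) (i, j) + _ *: _).
  rewrite tot_dE subrK eqxx; congr (_ + _ *: _).
  exact: dsum_coord_sum.
rewrite scalerDr scalerA -sign_add ij addrA; congr (_ + _ *: _ + _ *: _).
- rewrite tot_fin_funE; last by rewrite -ij addrAC.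
  by rewrite /phi /tot_dl !otens_map_comp; apply: eq_otens_map.
- rewrite tot_fin_funE; last by rewrite -ij addrA.
  by rewrite phi_eq // addrAC.
apply: eq_bigr => a _; rewrite tot_fin_funE //.
have [ab|ab] := eqVneq (deg b) (deg a + 1).
  by rewrite phi_eq // ab addrA addrK.
by rewrite !otens_map0r // => m; apply: c_deg.
Qed.

Let in_pr_sum m p (x : F m p) :
  x = \sum_a fin_in a (m - deg a) m p (fin_pr a (m - deg a) m p x).
Proof.
apply: dsum_ext => -[b l]; rewrite dsum_coord_sum (bigD1 b) //= subrK eqxx.
rewrite big1 ?addr0; last first.
  move=> a ab; rewrite /= subrK eqxx dput_out //.
  by apply: contra ab => /eqP[->].
have [<-|bl] := eqVneq (m - deg b) l; first by rewrite dput_id.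
rewrite dput_out ?dfam_out //=; last by apply: contra bl => /eqP[->].
by apply: contra bl => /eqP <-; rewrite addrK.
Qed.

(** [F m] is the finite direct sum of the [A a (m - deg a)], and the projections of this
    decomposition still determine an element after tensoring. *)
Lemma tot_fin_fun_inj n p (x : tot P F n p) : tot_fin_fun x = 0 -> x = 0.
Proof.
move=> x0; apply: dsum_ext => -[i m].
have E (t : otens (P i) (F m) p) : t = \sum_a otens_map (ohom_id (P i))
    (fin_in a (m - deg a) m) p (otens_map (ohom_id (P i)) (fin_pr a (m - deg a) m) p t).
  elim/tensor_ind: t => [|u v hu hv|y z].
  - by rewrite big1 // => a _; rewrite !oh0.
  - rewrite [LHS](congr2 +%R hu hv) -big_split.
    by apply: eq_bigr => a _; rewrite !ohD.
  rewrite [in LHS](in_pr_sum z) tpure_sumr.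
  by apply: eq_bigr => a _; rewrite !otens_map_pure.
rewrite [LHS]E big1 // => a _; rewrite phi_eq ?subrK //.
by rewrite -(@tot_fin_funE _ _ x a _ i _ erefl) x0 oh0.
Qed.

Lemma tot_fin_fun_surj n p (y : F' n p) : exists x, tot_fin_fun x = y.
Proof.
pose g i m : otens (P i) (F m) p := \sum_a otens_map (ohom_id (P i))
  (fin_in a (m - deg a) m) p (y (a, i + (m - deg a)) (i, m - deg a)).
have [s hs] := dfam_fin y.
(* One list must serve for all [a] and [l]: only finitely many components of [y] are nonzero, and
   each of them has a finite support. *)
have [t ht] : exists t : seq (int * int),
    forall a l im, im \notin t -> y (a, l) (im.1, im.2 - deg a) = 0.
  suff H (r : seq (K * int)) : exists t : seq (int * int), forall a l, (a, l) \in r ->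
      forall im, im \notin t -> y (a, l) (im.1, im.2 - deg a) = 0.
    have [t ht] := H s; exists t => a l im im_t.
    have [al|al] := boolP ((a, l) \in s); first exact: ht.
    by rewrite hs.
  elim: r => [|[a l] r [t ht]]; first by exists [::].
  have [u hu] := dfam_fin (y (a, l)).
  exists ([seq (ij.1, ij.2 + deg a) | ij <- u] ++ t) => a' l'.
  rewrite inE => /predU1P[[-> ->]|al] im; rewrite mem_cat negb_or => /andP[h1 h2].
    rewrite hu //; apply: contra h1 => h; apply/mapP; exists (im.1, im.2 - deg a) => //=.
    by rewrite subrK -surjective_pairing.
  exact: ht.
have g1 ij : ~~ (ij.1 + ij.2 == n) -> g ij.1 ij.2 = 0.
  move=> ij_n; rewrite /g big1 // => a _; rewrite (_ : y _ = 0) ?oh0 //.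
  by apply: dfam_out => /=; apply: contra ij_n => /eqP <-; rewrite addrA subrK.
have g2 : exists s : seq (int * int), forall ij, ij \notin s -> g ij.1 ij.2 = 0.
  exists t => ij ij_t; rewrite /g big1 // => a _.
  by rewrite (_ : y _ _ = 0) ?oh0 // ht.
exists (DSum g1 g2 : tot P F n p).
apply: dsum_ext => -[a l]; apply: dsum_ext => -[i j].
have [ij|ij] := eqVneq (i + j) l; last by rewrite !(dfam_out (_ : dsum _ _)).
rewrite tot_fin_funE // /phi -[X in otens_map _ _ _ X]/(g i (j + deg a)) /g oh_sum.
rewrite (bigD1 a) // big1.
  rewrite [LHS]addr0 otens_map_comp addrK ij.
  rewrite -[RHS](@otens_map_id _ _ (P i) (A a j)); apply: eq_otens_map => // z /=.
  by rewrite eqxx dput_id.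
move=> b ba; rewrite otens_map_comp otens_map0r // => z /=.
rewrite subrK eqxx dput_out //.
by apply: contra ba => /eqP[->].
Qed.

(** This is how K-flatness reaches diagrams: if the totalization of [A] is acyclic, so is that of
    the diagram tensored with a K-flat [P]. *)
Lemma tot_fintot_acyclic : acyclic (tot P F) -> acyclic F'.
Proof.
move=> aP n p y dy; have [x xy] := tot_fin_fun_surj y.
have dx : cd (tot P F) n (n + 1) p x = 0.
  by apply: tot_fin_fun_inj; rewrite tot_fin_fun_d xy.
have [z xz] := aP n p x dx; exists (tot_fin_fun z).
rewrite -xy xz; have := tot_fin_fun_d z.
by rewrite (subrK 1 n).
Qed.
End TotFintot.

(** * Mayer-Vietoris squares *)

(** A square starts at [(false, false)] and ends at [(true, true)], which has degree 2. *)
Definition sqdeg (a : bool * bool) : int := (a.1 + a.2)%N%:Z.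

Lemma sum_sq (V : zmodType) (F : bool * bool -> V) :
  \sum_a F a = F (true, true) + F (true, false) + (F (false, true) + F (false, false)).
Proof.
rewrite (eq_bigr (fun a : bool * bool => F (a.1, a.2))); last by move=> [].
by rewrite -(pair_bigA _ (fun a b => F (a, b))) /= !big_bool.
Qed.

Section Square.
Variables (k : comPzRingType) (X : rfspace k).
Variables (A : bool * bool -> cx X) (c : forall a b, cmap (A a) (A b)).
Hypothesis c_deg : forall a b j p x, sqdeg b != sqdeg a + 1 -> c a b j p x = 0.
Hypothesis c_sq : forall a e j p x, \sum_b c b e j p (c a b j p x) = 0.

Section Pack.
Variables (n : int) (p : X) (u : A (false, false) n p) (v : A (true, false) (n - 1) p).
Variables (w : A (false, true) (n - 1) p) (t : A (true, true) (n - 1 - 1) p).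

Let put (a : bool * bool) (i : int) (x : A a i p) (j : int) : A a j p :=
  @dput _ (fun j => A a j p) i x j.

Definition sq_fam (bj : (bool * bool) * int) : A bj.1 bj.2 p :=
  match bj.1 as b return A b bj.2 p with
  | (false, false) => put u bj.2
  | (true, false) => put v bj.2
  | (false, true) => put w bj.2
  | (true, true) => put t bj.2
  end.

Definition sq_pack : fintot c_deg c_sq n p.
Proof.
exists sq_fam.
- move=> [[[] []] j] /= jn; rewrite /sq_fam /put /= dput_out //; apply: contra jn => /eqP <-.
  + by rewrite -addrA subrK.
  + by rewrite subrK.
  + by rewrite subrK.
  by rewrite addr0.
- exists [seq (b, j) | b <- enum {: bool * bool}, j <- [:: n; n - 1; n - 1 - 1]].
  move=> [b j] h.
  have /norP[nj /norP[n1j /norP[n11j _]]] : j \notin [:: n; n - 1; n - 1 - 1].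
    by apply: contra h => h; apply/allpairsP; exists (b, j); rewrite /= mem_enum.
  by move: b {h} => [[] []]; rewrite /sq_fam /put /= dput_out // eq_sym.
Defined.

Lemma sq_pack_d : cd (A (false, false)) n (n + 1) p u = 0 ->
  c (false, false) (true, false) n p u = - (-1) ^+ `|n|%N *: cd (A (true, false)) (n - 1) n p v ->
  c (false, false) (false, true) n p u = - (-1) ^+ `|n|%N *: cd (A (false, true)) (n - 1) n p w ->
  c (true, false) (true, true) (n - 1) p v + c (false, true) (true, true) (n - 1) p w =
    (-1) ^+ `|n|%N *: cd (A (true, true)) (n - 1 - 1) (n - 1) p t ->
  cd (fintot c_deg c_sq) n (n + 1) p sq_pack = 0.
Proof.
move=> du dv dw dt; apply: dsum_ext => -[b j]; rewrite fintot_dE sum_sq.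
have E a i : sq_pack (a, i) = sq_fam (a, i) by [].
rewrite !E; case: b => [[] []]; rewrite /sq_fam /put /=.
- rewrite [c (true, true) _ _ _ _]c_deg // [c (false, false) _ _ _ _]c_deg // add0r addr0.
  have [->|jn] := eqVneq j (n - 1).
    by rewrite !dput_id dt sign_pred scaleNr scalerA sign_sq scale1r addrN.
  have jn1 i : (i - 1 == j - 1) = (i == j) by rewrite (inj_eq (addIr _)).
  rewrite eq_sym in jn; rewrite !dput_out ?jn1 // !oh0 ?addr0 scaler0 ?addr0 //. 
- rewrite [c (true, true) _ _ _ _]c_deg // [c (true, false) _ _ _ _]c_deg //.
  rewrite [c (false, true) _ _ _ _]c_deg // !add0r.
  have [->|jn] := eqVneq j n.
    by rewrite !dput_id dv scaleNr scalerN scalerA sign_sq scale1r addrN.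
  have jn1 i : (i - 1 == j - 1) = (i == j) by rewrite (inj_eq (addIr _)).
  rewrite eq_sym in jn; rewrite !dput_out ?jn1 // !oh0 ?addr0 scaler0 ?addr0 //. 
- rewrite [c (true, true) _ _ _ _]c_deg // [c (true, false) _ _ _ _]c_deg //.
  rewrite [c (false, true) _ _ _ _]c_deg // !add0r.
  have [->|jn] := eqVneq j n.
    by rewrite !dput_id dw scaleNr scalerN scalerA sign_sq scale1r addrN.
  have jn1 i : (i - 1 == j - 1) = (i == j) by rewrite (inj_eq (addIr _)).
  rewrite eq_sym in jn; rewrite !dput_out ?jn1 // !oh0 ?addr0 scaler0 ?addr0 //. 
rewrite !c_deg // !addr0 scaler0 addr0.
have [->|jn] := eqVneq j (n + 1); first by rewrite addrK dput_id.
rewrite !dput_out ?oh0 // eq_sym; apply: contra jn => /eqP <-.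
by rewrite subrK.
Qed.
End Pack.

(** Acyclicity read corner by corner, freed from signs: these are absorbed in the components of the
    cocycle and undone in its primitive. *)
Lemma sq_exact : acyclic (fintot c_deg c_sq) -> forall n p
  (u : A (false, false) n p) (v : A (true, false) (n - 1) p)
  (w : A (false, true) (n - 1) p) (t : A (true, true) (n - 1 - 1) p),
  cd (A (false, false)) n (n + 1) p u = 0 ->
  c (false, false) (true, false) n p u = cd (A (true, false)) (n - 1) n p v ->
  c (false, false) (false, true) n p u = cd (A (false, true)) (n - 1) n p w ->
  c (true, false) (true, true) (n - 1) p v + c (false, true) (true, true) (n - 1) p w =
    cd (A (true, true)) (n - 1 - 1) (n - 1) p t ->
  exists u' v' w' t',
  [/\ u = cd (A (false, false)) (n - 1) n p u',
    v = c (false, false) (true, false) (n - 1) p u' +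
        cd (A (true, false)) (n - 1 - 1) (n - 1) p v',
    w = c (false, false) (false, true) (n - 1) p u' +
        cd (A (false, true)) (n - 1 - 1) (n - 1) p w' &
    t = c (true, false) (true, true) (n - 1 - 1) p v' +
        c (false, true) (true, true) (n - 1 - 1) p w' +
        cd (A (true, true)) (n - 1 - 1 - 1) (n - 1 - 1) p t'].
Proof.
move=> ac n p u v w t du dv dw dt.
pose s : O X p := (-1) ^+ `|n|%N.
have ss : s * s = 1 := sign_sq _ _.
pose x := sq_pack u (- s *: v) (- s *: w) (- t).
have dx : cd (fintot c_deg c_sq) n (n + 1) p x = 0.
  apply: sq_pack_d => //.
  - by rewrite ohZ scalerA mulrNN ss scale1r.
  - by rewrite ohZ scalerA mulrNN ss scale1r.
  by rewrite !ohZ -scalerDr dt ohN scalerN scaleNr.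
have [y xy] := ac n p x dx.
have E b j : sq_fam u (- s *: v) (- s *: w) (- t) (b, j) = cd (A b) (j - 1) j p (y (b, j - 1)) +
    (-1) ^+ `|j|%N *: \sum_a c a b j p (y (a, j)).
  by rewrite -[LHS]/(x (b, j)) xy fintot_dE'.
exists (y (false, false, n - 1)), (- s *: y (true, false, n - 1 - 1)),
  (- s *: y (false, true, n - 1 - 1)), (- y (true, true, n - 1 - 1 - 1)).
split.
- have := E (false, false) n; rewrite sum_sq !c_deg // !addr0 scaler0 addr0.
  by rewrite /sq_fam /= dput_id.
- have := E (true, false) (n - 1); rewrite sum_sq.
  rewrite [c (true, true) _ _ _ _]c_deg // [c (true, false) _ _ _ _]c_deg //.
  rewrite [c (false, true) _ _ _ _]c_deg // !add0r.
  rewrite /sq_fam /= dput_id sign_pred => h.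
  have -> : v = - s *: (- s *: v) by rewrite scalerA mulrNN ss scale1r.
  by rewrite h scalerDr ohZ [- s *: (_ *: _)]scalerA mulrNN ss scale1r [LHS]addrC.
- have := E (false, true) (n - 1); rewrite sum_sq.
  rewrite [c (true, true) _ _ _ _]c_deg // [c (true, false) _ _ _ _]c_deg //.
  rewrite [c (false, true) _ _ _ _]c_deg // !add0r.
  rewrite /sq_fam /= dput_id sign_pred => h.
  have -> : w = - s *: (- s *: w) by rewrite scalerA mulrNN ss scale1r.
  by rewrite h scalerDr ohZ [- s *: (_ *: _)]scalerA mulrNN ss scale1r [LHS]addrC.
have := E (true, true) (n - 1 - 1); rewrite sum_sq.
rewrite [c (true, true) _ _ _ _]c_deg // [c (false, false) _ _ _ _]c_deg // add0r addr0.
rewrite /sq_fam /= dput_id !sign_pred opprK => h.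
have -> : t = - - t by rewrite opprK.
by rewrite h opprD ohN !ohZ -scalerDr scaleNr [LHS]addrC.
Qed.
End Square.

(** * The five lemma for squares with acyclic totalization *)

Section Five.
Variables (k : comPzRingType) (X : rfspace k).
Variables (A A' : bool * bool -> cx X).
Variables (c : forall a b, cmap (A a) (A b)) (c' : forall a b, cmap (A' a) (A' b)).
Hypothesis c_deg : forall a b j p x, sqdeg b != sqdeg a + 1 -> c a b j p x = 0.
Hypothesis c_sq : forall a e j p x, \sum_b c b e j p (c a b j p x) = 0.
Hypothesis c'_deg : forall a b j p x, sqdeg b != sqdeg a + 1 -> c' a b j p x = 0.
Hypothesis c'_sq : forall a e j p x, \sum_b c' b e j p (c' a b j p x) = 0.
Variable T : forall a, cmap (A a) (A' a).
Hypothesis T_c : forall a b j p x, T b j p (c a b j p x) = c' a b j p (T a j p x).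

Let o := (false, false).
Let l := (true, false).
Let r := (false, true).
Let lr := (true, true).

Let c_sum j p x : c l lr j p (c o l j p x) + c r lr j p (c o r j p x) = 0.
Proof.
have := c_sq lr x; rewrite sum_sq.
rewrite [c o o _ _ _]c_deg // oh0 [c o lr _ _ _]c_deg // oh0.
by rewrite add0r addr0.
Qed.
Let c'_sum j p x : c' l lr j p (c' o l j p x) + c' r lr j p (c' o r j p x) = 0.
Proof.
have := c'_sq lr x; rewrite sum_sq.
rewrite [c' o o _ _ _]c'_deg // oh0 [c' o lr _ _ _]c'_deg // oh0.
by rewrite add0r addr0.
Qed.

Lemma mv_five_lemma p : acyclic (fintot c_deg c_sq) -> acyclic (fintot c'_deg c'_sq) ->
  zqis (stalk_map p (T l)) -> zqis (stalk_map p (T r)) -> zqis (stalk_map p (T lr)) ->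
  zqis (stalk_map p (T o)).
Proof.
move=> ac ac' ql qr qlr n.
have ex := sq_exact ac; have ex' := sq_exact ac'.
have [_ ls] := ql n; have [_ rs] := qr n.
have [lri _] := qlr n; have [lri1 lrs1] := qlr (n - 1).
rewrite /= ?subrK in ls rs lri lri1 lrs1 *.
split=> [u du [u2 Tu]|u2 du2].
  (* At either middle corner the image of [u] bounds some [v], and a cocycle is subtracted from [v]
     so that [T v] agrees with the image of [u2] up to a boundary. *)
  have half a (qa : zqis (stalk_map p (T a))) : exists v v2,
      c o a n p u = cd (A a) (n - 1) n p v /\
      T a (n - 1) p v = c' o a (n - 1) p u2 + cd (A' a) (n - 1 - 1) (n - 1) p v2.
    have [ai _] := qa n; have [_ as1] := qa (n - 1); rewrite /= ?subrK in as1.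
    have [|/=|v /= uv] := ai (c o a n p u); first by rewrite /= -cf_d du oh0.
      by exists (c' o a _ p u2); rewrite /= T_c Tu cf_d.
    have [|v' [v2 /= [dv' h]]] := as1 (T a _ p v - c' o a _ p u2).
      by rewrite ohD ohN -!cf_d -uv -Tu T_c addrN.
    exists (v - v'), v2; rewrite !ohD !ohN dv' subr0; split=> //.
    have -> : T a _ p v = T a _ p v' + cd (A' a) _ _ p v2 + c' o a _ p u2.
      by rewrite -h subrK.
    by rewrite [LHS]addrC -(addrA (T a _ p v')) addKr addrC.
  have [v [v2 [uv Tv]]] := half l ql.
  have [w [w2 [uw Tw]]] := half r qr.
  (* The square anticommutes, so this sum is a cocycle. By the adjustment of [v] and [w], its image
     by [T] is a boundary. *)
  have [||t /= ht] := lri1 (c l lr _ p v + c r lr _ p w).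
  - by rewrite ohD -!cf_d -uv -uw c_sum.
  - exists (c' l lr _ p v2 + c' r lr _ p w2).
    by rewrite ohD !T_c Tv Tw !ohD addrACA c'_sum add0r !cf_d.
  have [u' [v' [w' [t' [-> _ _ _]]]]] := ex n p u v w t du uv uw ht.
  by exists u'.
(* For surjectivity, the images of [u2] at both middle corners are lifted along [T] up to
   boundaries. *)
have [v1 [v2 [dv1 hv]]] : exists v1 v2, cd (A l) n (n + 1) p v1 = 0 /\
    c' o l n p u2 = T l n p v1 + cd (A' l) (n - 1) n p v2.
  have [|v1 [v2 []]] := ls (c' o l n p u2); first by rewrite -cf_d du2 oh0.
  by exists v1, v2.
have [w1 [w2 [dw1 hw]]] : exists w1 w2, cd (A r) n (n + 1) p w1 = 0 /\
    c' o r n p u2 = T r n p w1 + cd (A' r) (n - 1) n p w2.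
  have [|w1 [w2 []]] := rs (c' o r n p u2); first by rewrite -cf_d du2 oh0.
  by exists w1, w2.
have hT : T lr n p (c l lr n p v1 + c r lr n p w1) =
    - cd (A' lr) (n - 1) n p (c' l lr _ p v2 + c' r lr _ p w2).
  apply/eqP; rewrite -addr_eq0 !ohD -!cf_d !T_c addrACA -!ohD -hv -hw.
  by rewrite c'_sum.
have [||t1 /= ht1] := lri (c l lr n p v1 + c r lr n p w1).
- by rewrite ohD -!cf_d dv1 dw1 !oh0 addr0.
- by exists (- (c' l lr _ p v2 + c' r lr _ p w2)); rewrite ohN hT.
(* The primitive [t1] is only determined up to a cocycle; the right choice makes [T t1] compatible
   with [v2] and [w2] up to a boundary. This uses surjectivity at the last corner, one degree
   lower. *)
have [|t1' [t2 /= [dt1' ht2]]] := lrs1 (T lr _ p t1 + (c' l lr _ p v2 + c' r lr _ p w2)).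
  by rewrite ohD -cf_d -ht1 hT addNr.
have ht3 : T lr (n - 1) p (t1 - t1') + (c' l lr _ p v2 + c' r lr _ p w2) =
    cd (A' lr) (n - 1 - 1) (n - 1) p t2.
  by rewrite ohD ohN addrAC ht2 addrAC addrN add0r.
have {}ht1 : c l lr n p v1 + c r lr n p w1 = cd (A lr) (n - 1) n p (t1 - t1').
  by rewrite ohD ohN dt1' subr0.
move: (t1 - t1') ht1 ht3 => {t1 t1' dt1' ht2} t1 ht1 ht3.
(* Exactness one degree higher, with zero at the first corner, glues [v1] and [w1] to a cocycle
   [u1]. *)
have S : exists u1 v1' w1' t1',
  [/\ cd (A o) n (n + 1) p u1 = 0,
    v1 = c o l n p u1 + cd (A l) (n - 1) n p v1',
    w1 = c o r n p u1 + cd (A r) (n - 1) n p w1' &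
    t1 = c l lr (n - 1) p v1' + c r lr (n - 1) p w1' +
      cd (A lr) (n - 1 - 1) (n - 1) p t1'].
  have := ex (n + 1) p 0; rewrite !addrK => /(_ v1 w1 t1).
  rewrite !oh0 dv1 dw1 ht1 => /(_ erefl erefl erefl erefl).
  by move=> [u1 [v1' [w1' [t1' [h *]]]]]; exists u1, v1', w1', t1'.
have [u1 [v1' [w1' [t1' [du1 ev ew et]]]]] := S.
(* The images of [u2 - T u1] at the middle corners bound, with primitives compatible at the last
   corner, so exactness makes it a boundary. *)
have [||||u' [_ [_ [_ [hu' _ _ _]]]]] := ex' n p (u2 - T o n p u1)
  (v2 + T l _ p v1') (w2 + T r _ p w1') (t2 - T lr _ p t1').
- by rewrite ohD ohN du2 -cf_d du1 oh0 subr0.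
- by rewrite ohD ohN hv ev -T_c !ohD -cf_d addrAC [T l n p _ + _]addrC addrK addrC.
- by rewrite ohD ohN hw ew -T_c !ohD -cf_d addrAC [T r n p _ + _]addrC addrK addrC.
- rewrite [RHS]ohD ohN -ht3 et !ohD -!cf_d !T_c.
  by rewrite [RHS]addrAC addrK addrACA [LHS]addrC.
exists u1, u'; split=> //.
by rewrite -hu' addrC subrK.
Qed.
End Five.

(** * Tensoring a quasi-isomorphism with a K-flat complex *)

Section TotQis.
Variables (k : comPzRingType) (X : rfspace k).

Lemma ozero_eq p (x y : @ozero k X p) : x = y.
Proof. by rewrite [x]thinmx0 [y]thinmx0. Qed.

Definition zero_cx : cx X.
Proof. by refine (@Cx k X (fun _ => ozero) (fun _ _ => ohom0 _ _) _ _). Defined.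

Variables (A B : cx X) (f : cmap A B).

(** With two zero corners, the totalization of the square is the mapping cone of [f] up to shift and
    signs, and the results on squares apply to it. *)
Let A4 (a : bool * bool) : cx X :=
  match a with (false, false) => A | (true, false) => B | _ => zero_cx end.
Let c4 (a b : bool * bool) : cmap (A4 a) (A4 b) :=
  match a return cmap (A4 a) (A4 b) with
  | (false, false) => match b return cmap A (A4 b) with
                      | (true, false) => f
                      | _ => cmap0 _ _
                      end
  | _ => cmap0 _ _
  end.
Let c4_deg a b j p x : sqdeg b != sqdeg a + 1 -> c4 a b j p x = 0.
Proof. by move: a b x => [[] []] [[] []]. Qed.
Let c4_sq a e j p x : \sum_b c4 b e j p (c4 a b j p x) = 0.
Proof.
apply: big1 => b _; move: a b e x => [[] []] [[] []] [[] []] x //=; exact: oh0.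
Qed.

Let cone_acyclic : quasi_iso f -> acyclic (fintot c4_deg c4_sq).
Proof.
move=> qf n p x dx.
pose s : O X p := (-1) ^+ `|n|%N.
have ss : s * s = 1 := sign_sq _ _.
have E b j : cd (A4 b) (j - 1) j p (x (b, j - 1)) +
    (-1) ^+ `|j|%N *: \sum_a c4 a b j p (x (a, j)) = 0 by rewrite -fintot_dE dx.
pose u : A n p := x (false, false, n); pose v : B (n - 1) p := x (true, false, n - 1).
have du : cd A n (n + 1) p u = 0.
  have := E (false, false) (n + 1); rewrite sum_sq !c4_deg // !addr0 scaler0 addr0.
  by rewrite addrK.
have dv : cd B (n - 1) n p v = - s *: f n p u.
  have := E (true, false) n; rewrite sum_sq /= !add0r => /eqP.
  by rewrite addr_eq0 => /eqP ->; rewrite scaleNr.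
have [fi _] := qf n p.
have [|u0 eu] := fi u du.
  by exists (- s *: v); rewrite ohZ dv scalerA mulrNN ss scale1r.
have [_ fs] := qf (n - 1) p; rewrite subrK in fs.
have [|u1 [v1 [du1 ev]]] := fs (v + s *: f _ p u0).
  by rewrite ohD ohZ -cf_d -eu dv scaleNr addNr.
(* [u0] bounds [u]. Subtracting the cocycle [s *: u1] keeps this and corrects the other component,
   because [v + s *: f u0] equals [f u1] plus the differential of [v1]. *)
exists (sq_pack c4_deg c4_sq (n := n - 1) (u0 - s *: u1) v1 0 0).
apply: dsum_ext => -[b j]; have [bj|bj] := eqVneq (j + sqdeg b) n; last first.
  by rewrite !(dfam_out (_ : dsum _ _)).
rewrite fintot_dE' sum_sq.
have K a i : sq_pack c4_deg c4_sq (n := n - 1) (u0 - s *: u1) v1 0 0 (a, i) =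
    sq_fam (A := A4) (n := n - 1) (u0 - s *: u1) v1 0 0 (a, i) by [].
move: bj; rewrite !K; case: b => [[] []] bj; try exact: ozero_eq.
  rewrite (_ : j = n - 1); last by rewrite -bj addrK.
  rewrite /sq_fam /= !dput_id !add0r sign_pred -/s ohD ohN ohZ scalerDr scalerN.
  rewrite !scaleNr scalerA ss scale1r opprK -/v.
  by apply: (addIr (s *: f _ p u0)); rewrite ev [LHS]addrC addrA [RHS]addrAC subrK.
rewrite (_ : j = n); last by rewrite -bj addr0.
rewrite /sq_fam /= !dput_id !add0r scaler0 addr0.
by rewrite ohD ohN ohZ du1 scaler0 subr0 -eu.
Qed.

(** The cone of [f] is acyclic, hence so is its tensor product with [P], which is the cone of the
    tensored map; [sq_exact] reads the conclusion off this cone. *)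
Lemma tot_qis (P : cx X) : K_flat P -> quasi_iso f ->
  quasi_iso (tot_map (cmap_id P) f).
Proof.
move=> fP qf n p.
have aF := tot_fintot_acyclic (fP _ (cone_acyclic qf)).
have ex := sq_exact aF.
split=> [x dx [y fx]|y dy].
  case: (ex n p x y 0 0 dx fx) => [||u' [_ [_ [_ [-> _ _ _]]]]]; last by exists u'.
    by rewrite oh0; apply: dsum_ext => ij; apply: otens_map0r.
  by rewrite !oh0 addr0; apply: dsum_ext => ij; apply: otens_map0r.
have := ex (n + 1) p 0; rewrite !addrK => /(_ y 0 0).
case; rewrite ?oh0 ?dy ?addr0 //; first by apply: dsum_ext => ij; apply: otens_map0r.
move=> u' [v' [_ [_ [du' ev _ _]]]].
by exists u', v'.
Qed.
End TotQis.

(** * Sections over subsets *)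

Section Sections.
Variables (k : comPzRingType) (X : rfspace k) (U : set X).

(* The sections of [F] over the intersection of [U] and [minopen p], extended by
   zero to [X]. The set [U] need not be open: [U = [set x]] gives the skyscraper
   sheaf at [x] with stalk [F x]. *)
Record osec (F : omod X) (p : X) := OSec {
  osv :> forall x : X, F x;
  osv_out : forall x, ~ (spec p x /\ U x) -> osv x = 0;
  osv_res : forall x x' (h : spec x x'), spec p x -> U x -> U x' ->
    mres F h (osv x) = osv x'
}.

HB.instance Definition _ F p := gen_eqMixin (@osec F p).
HB.instance Definition _ F p := gen_choiceMixin (@osec F p).

Section Module.
Variables (F : omod X) (p : X).
Implicit Types s t : osec F p.

Lemma osec_ext s t : (forall x, s x = t x) -> s = t.
Proof.
case: s t => [s so sr] [t to tr] /= st.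
have {}st : s = t by apply: functional_extensionality_dep.
by case: t / st to tr => to tr; congr OSec; apply: Prop_irrelevance.
Qed.

Definition os0 : osec F p.
Proof. by exists (fun x => 0) => // *; rewrite mres0. Defined.
Definition osopp s : osec F p.
Proof.
exists (fun x => - s x) => [x /osv_out ->|x x' h px Ux Ux']; first by rewrite oppr0.
apply: (addrI (s x')).
by rewrite -{1}(osv_res s h px Ux Ux') -mresD !subrr mres0.
Defined.
Definition osadd s t : osec F p.
Proof.
exists (fun x => s x + t x) => [x xo|x x' h px Ux Ux'].
  by rewrite !osv_out ?addr0.
by rewrite mresD !osv_res.
Defined.

(** The value 0 outside of [spec p] is harmless, since sections vanish there, and it lets scalars
    act on families indexed by all points. *)
Definition oscal x (a : O X p) (m : F x) : F x :=
  if pselect (spec p x) is left h then ores h a *: m else 0.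

Lemma oscalE x (h : spec p x) a (m : F x) : oscal a m = ores h a *: m.
Proof. by rewrite /oscal; case: pselect => // h'; rewrite (Prop_irrelevance h' h). Qed.

Definition osscale (a : O X p) s : osec F p.
Proof.
exists (fun x => oscal a (s x)) => [x /osv_out ->|x x' h px Ux Ux'].
  by rewrite /oscal; case: pselect => // h; rewrite scaler0.
rewrite (oscalE px) (oscalE (spec_trans px h)) mresZ (osv_res _ _ px) //.
by rewrite (ores_comp _ _ (spec_trans px h)).
Defined.

Fact osaddA : associative osadd.
Proof. by move=> r s t; apply: osec_ext => x /=; rewrite addrA. Qed.
Fact osaddC : commutative osadd.
Proof. by move=> r s; apply: osec_ext => x /=; rewrite addrC. Qed.
Fact osadd0 : left_id os0 osadd.
Proof. by move=> r; apply: osec_ext => x /=; rewrite add0r. Qed.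
Fact osaddN : left_inverse os0 osopp osadd.
Proof. by move=> r; apply: osec_ext => x /=; rewrite addNr. Qed.
HB.instance Definition _ := GRing.isZmodule.Build (osec F p)
  osaddA osaddC osadd0 osaddN.
Fact osscaleA a b s : osscale a (osscale b s) = osscale (a * b) s.
Proof.
apply: osec_ext => x /=; rewrite /oscal; case: pselect => // h.
by rewrite scalerA rmorphM.
Qed.
Fact osscale1 : left_id 1 osscale.
Proof.
move=> s; apply: osec_ext => x /=; rewrite /oscal; case: pselect => h.
  by rewrite rmorph1 scale1r.
by rewrite osv_out // => -[].
Qed.
Fact osscaleDr : right_distributive osscale +%R.
Proof.
move=> a s t; apply: osec_ext => x /=; rewrite /oscal; case: pselect => h.
  exact: scalerDr.
by rewrite addr0.
Qed.
Fact osscaleDl s : {morph osscale^~ s : a b / a + b}.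
Proof.
move=> a b; apply: osec_ext => x /=; rewrite /oscal; case: pselect => h.
  by rewrite rmorphD scalerDl.
by rewrite addr0.
Qed.
HB.instance Definition _ := GRing.Zmodule_isLmodule.Build (O X p) (osec F p)
  osscaleA osscale1 osscaleDr osscaleDl.
Definition osecM : lmodType (O X p) := osec F p.

Lemma osvZ (a : O X p) (s : osecM) x (h : spec p x) :
  (a *: s : osecM) x = ores h a *: (s x).
Proof. exact: oscalE. Qed.

Lemma osv_semilin x (h : spec p x) : semilin (ores h) (fun s : osecM => s x).
Proof. by move=> a s t; rewrite -(osvZ a s h). Qed.

Lemma osv_sum (I : Type) (r : seq I) (S : I -> osecM) x :
  (\sum_(i <- r) S i : osecM) x = \sum_(i <- r) S i x.
Proof. by elim/big_rec2: _ => // i y z _ <-. Qed.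

End Module.

Definition sec_res (F : omod X) (p q : X) (h : spec p q) (s : osec F p) : osec F q.
Proof.
exists (fun x => if `[< spec q x >] then s x else 0) => [x nx|x x' h' qx Ux Ux'].
  case: asboolP => // qx; apply: osv_out => -[px Ux]; exact: nx.
rewrite asboolT // asboolT; first exact: osv_res (spec_trans h qx) Ux Ux'.
exact: spec_trans h'.
Defined.

Lemma sec_resE (F : omod X) p q (h : spec p q) (s : osec F p) x :
  spec q x -> sec_res h s x = s x.
Proof. by move=> qx /=; rewrite asboolT. Qed.

Lemma osec_ext' (F : omod X) p (s t : osec F p) :
  (forall x, spec p x -> U x -> s x = t x) -> s = t.
Proof.
move=> st; apply: osec_ext => x.
have [[px Ux]|npU] := EM (spec p x /\ U x); first exact: st.
by rewrite !osv_out.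
Qed.

Definition secs (F : omod X) : omod X.
Proof.
refine (@OMod k X (fun p => osecM F p) (fun p q h => sec_res h) _ _ _).
- move=> p q h a s t; apply: osec_ext' => x qx Ux.
  have px := spec_trans h qx.
  rewrite sec_resE // -[LHS]/((a *: s : osecM F p) x + t x) (osvZ a s px).
  rewrite -[RHS]/((ores h a *: sec_res h s : osecM F q) x + sec_res h t x) (osvZ _ _ qx).
  by rewrite !sec_resE // (ores_comp _ _ px).
- by move=> p h s; apply: osec_ext' => x px Ux; rewrite sec_resE.
- move=> p q r h h' h'' s; apply: osec_ext' => x rx Ux.
  by rewrite !sec_resE //; apply: spec_trans rx.
Defined.

Definition sec_fun (F G : omod X) (f : ohom F G) p (s : osec F p) : osec G p.
Proof.
exists (fun x => f x (s x)) => [x /osv_out ->|x x' h px Ux Ux']; first exact: oh0.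
by rewrite -oh_nat osv_res.
Defined.

Definition secs_map (F G : omod X) (f : ohom F G) : ohom (secs F) (secs G).
Proof.
refine (@OHom k X (secs F) (secs G) (@sec_fun F G f) _ _).
- move=> p a s t; apply: osec_ext' => x px Ux.
  rewrite -[LHS]/(f x ((a *: s : osecM F p) x + t x)) (osvZ _ _ px) ohD ohZ.
  by rewrite -[RHS]/((a *: sec_fun f s : osecM G p) x + f x (t x)) (osvZ _ _ px).
- by move=> p q h s; apply: osec_ext' => x qx Ux; rewrite sec_resE //= asboolT.
Defined.

Definition secs_cx (A : cx X) : cx X.
Proof.
refine (@Cx k X (fun i => secs (A i)) (fun i j => secs_map (cd A i j)) _ _).
- by move=> i j p s ij; apply: osec_ext => x; apply: cd_shape.
- by move=> i j l p s; apply: osec_ext => x; apply: cd_sq.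
Defined.

Definition secs_cmap (A B : cx X) (f : cmap A B) : cmap (secs_cx A) (secs_cx B).
Proof.
refine (@CMap k X (secs_cx A) (secs_cx B) (fun i => secs_map (f i)) _).
by move=> i j p s; apply: osec_ext => x; apply: cf_d.
Defined.
End Sections.

Section Restrict.
Variables (k : comPzRingType) (X : rfspace k) (U V : set X) (n : int).

(* [n] times the restriction from [U] to [V]; the junk value [0] when [V] is not
   contained in [U] avoids carrying proofs of inclusions. *)
Definition sec_cut (F : omod X) p (s : osec U F p) : osec V F p.
Proof.
exists (fun x => if `[< V `<=` U /\ V x >] then s x *~ n else 0) => [x nx|x x' h px Vx Vx'].
  case: asboolP => // -[VU Vx]; rewrite osv_out ?mul0rz // => -[px Ux]; exact: nx.
have [VU|VU] := EM (V `<=` U); last first.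
  by rewrite !asboolF ?mres0 // => -[].
by rewrite !asboolT // mres_int (osv_res _ _ px) //; apply: VU.
Defined.

Lemma sec_cutE (F : omod X) p (s : osec U F p) x : V `<=` U -> V x ->
  sec_cut s x = s x *~ n.
Proof. by move=> VU Vx /=; rewrite asboolT. Qed.

Definition cut_hom (F : omod X) : ohom (secs U F) (secs V F).
Proof.
refine (@OHom k X (secs U F) (secs V F) (@sec_cut F) _ _).
- move=> p a s t; apply: osec_ext' => x px Vx.
  rewrite -[RHS]/((a *: sec_cut s : osecM V F p) x + sec_cut t x) (osvZ _ _ px) /=.
  case: ifP => _; last by rewrite scaler0 addr0.
  by rewrite (oscalE px) mulrzDl scalerMzr.
- move=> p q h s; apply: osec_ext' => x qx Ux; rewrite sec_resE //=.
  by rewrite (asboolT qx).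
Defined.

Definition cut (A : cx X) : cmap (secs_cx U A) (secs_cx V A).
Proof.
refine (@CMap k X (secs_cx U A) (secs_cx V A) (fun i => cut_hom (A i)) _).
move=> i j p s; apply: osec_ext => x /=.
by case: ifP => _; rewrite ?oh0 // oh_int.
Defined.
End Restrict.

(** In a finite space these are exactly the open subsets. *)
Definition upclosed (k : comPzRingType) (X : rfspace k) (U : set X) : Prop :=
  forall x y : X, spec x y -> U x -> U y.

Section MayerVietoris.
Variables (k : comPzRingType) (X : rfspace k) (V W : set X).

Definition mv_set (a : bool * bool) : set X :=
  match a with
  | (false, false) => V `|` W
  | (true, false) => V
  | (false, true) => W
  | (true, true) => V `&` W
  end.

(** The edge from [W] to the intersection carries the sign, so that the two paths through the square
    cancel. *)
Definition mv_sign (a b : bool * bool) : int :=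
  if sqdeg b == sqdeg a + 1 then (if a == (false, true) then -1 else 1) else 0.

Lemma mv_sign_sub a b : mv_sign a b != 0 -> mv_set b `<=` mv_set a.
Proof.
by move: a b => [[] []] [[] []] //= _ x; case.
Qed.
Lemma mv_sign_deg a b : sqdeg b != sqdeg a + 1 -> mv_sign a b = 0.
Proof. by rewrite /mv_sign => /negPf ->. Qed.
Lemma mv_sign_sq a e : \sum_b mv_sign a b * mv_sign b e = 0.
Proof. by rewrite sum_sq; move: a e => [[] []] [[] []]. Qed.

Variable J : cx X.
Definition mv_cut a b : cmap (secs_cx (mv_set a) J) (secs_cx (mv_set b) J) :=
  cut (mv_set a) (mv_set b) (mv_sign a b) J.

Lemma mv_cutE a b j p (s : secs_cx (mv_set a) J j p) x : mv_set b x ->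
  osv (mv_cut a b j p s) x = osv s x *~ mv_sign a b.
Proof.
move=> bx; have [ab|ab] := eqVneq (mv_sign a b) 0.
  by rewrite ab mulr0z /= ab mulr0z; case: ifP.
by rewrite -[LHS]/(sec_cut _ _ _ _) sec_cutE //; apply: mv_sign_sub.
Qed.

Lemma mv_cut_deg a b j p x : sqdeg b != sqdeg a + 1 -> mv_cut a b j p x = 0.
Proof.
move=> ab; apply: osec_ext' => y py by_.
by rewrite -[LHS]/(osv (mv_cut a b j p x) y) mv_cutE // mv_sign_deg.
Qed.

Lemma mv_cut_sq a e j p x : \sum_b mv_cut b e j p (mv_cut a b j p x) = 0.
Proof.
apply: osec_ext' => y py ey; rewrite osv_sum.
rewrite (eq_bigr (fun b => osv x y *~ (mv_sign a b * mv_sign b e))); last first.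
  move=> b _; rewrite -[LHS]/(osv (mv_cut b e j p _) y) mv_cutE //.
  have [->|be] := eqVneq (mv_sign b e) 0; first by rewrite mulr0.
  by rewrite mv_cutE ?mulrzA //; apply: mv_sign_sub ey.
by rewrite -mulrz_sumr mv_sign_sq.
Qed.
Definition mv_cx : cx X := fintot mv_cut_deg mv_cut_sq.
End MayerVietoris.

(** * The acyclic complex that represents Mayer-Vietoris cochains *)

Section TestComplex.
Variables (k : comPzRingType) (X : rfspace k) (V W : set X).
Hypotheses (upV : upclosed V) (upW : upclosed W).
Variables (N : int) (p : X).

Let S (a : bool * bool) (q : X) : Prop := spec p q /\ mv_set V W a q.
Let S_up a q q' : spec q q' -> S a q -> S a q'.
Proof.
move=> h [pq aq]; split; first exact: spec_trans h.
case: a aq => [[] []] /=; [case; split| exact: upV | exact: upW | case; [left|right]];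
  by [apply: upV h _|apply: upW h _].
Qed.
Let S_sign a b q : mv_sign a b != 0 -> S b q -> S a q.
Proof. by move=> ab [pq bq]; split=> //; apply: mv_sign_sub ab _ bq. Qed.
Let sign_deg a b : mv_sign a b != 0 -> sqdeg b = sqdeg a + 1.
Proof. by apply: contraNeq => /mv_sign_deg ->. Qed.

Definition test_gen (n : int) (q : X) (a : bool * bool) : bool :=
  (n + sqdeg a == N) && `[< S a q >].

Definition test_res (n : int) q q' (h : spec q q')
    (c : dsumM (test_gen n q) (fun _ => (O X q)^o : lmodType _)) :
  dsumM (test_gen n q') (fun _ => (O X q')^o : lmodType _).
Proof.
exists (fun a => ores h (c a)).
- move=> a na; rewrite dfam_out ?rmorph0 //; apply: contra na => /andP[na /asboolP aq].
  by rewrite /test_gen na; apply/asboolP; apply: S_up aq.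
- by have [s hs] := dfam_fin c; exists s => a /hs ->; rewrite rmorph0.
Defined.

(* In degree [N - sqdeg a] the extensions by zero of the structure sheaf of
   the open sets [mv_set V W a], cut down to [minopen p]. *)
Definition test_ob (n : int) : omod X.
Proof.
refine (@OMod k X (fun q => dsumM (test_gen n q) (fun _ => (O X q)^o : lmodType _))
  (@test_res n) _ _ _).
- by move=> q q' h a c c'; apply: dsum_ext => b /=; rewrite rmorphD rmorphM.
- by move=> q h c; apply: dsum_ext => a; apply: ores_id.
- by move=> q q' q'' h h' h'' c; apply: dsum_ext => a; apply: ores_comp.
Defined.

(** The inclusions of extensions by zero, transposes of the restrictions in [mv_cx]. The overall
    sign is the one for which cocycles of [mv_cx] become morphisms of complexes. *)
Definition test_dfun (n m : int) q (c : test_ob n q) (a : bool * bool) : O X q :=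
  if n + 1 == m then - ((-1) ^+ `|m|%N * \sum_b (c b : O X q) *~ mv_sign a b) else 0.

Definition test_dterm (n m : int) q (c : test_ob n q) : test_ob m q.
Proof.
exists (test_dfun m c).
- move=> a na; rewrite /test_dfun; case: eqP => // nm.
  rewrite big1 ?mulr0 ?oppr0 // => b _.
  have [->|ab] := eqVneq (mv_sign a b) 0; first by rewrite mulr0z.
  rewrite dfam_out ?mul0rz //; apply: contra na => /andP[/eqP nb /asboolP bq].
  apply/andP; split; last by apply/asboolP; apply: S_sign bq.
  by rewrite -nm -nb (sign_deg ab) addrAC addrA.
- by exists (enum {: bool * bool}) => a; rewrite mem_enum.
Defined.

Definition test_d (n m : int) : ohom (test_ob n) (test_ob m).
Proof.
refine (@OHom k X (test_ob n) (test_ob m) (@test_dterm n m) _ _).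
- move=> q u c c'; apply: dsum_ext => a.
  rewrite -[LHS]/(test_dfun m (u *: c + c') a).
  rewrite -[RHS]/(u * test_dfun m c a + test_dfun m c' a) /test_dfun.
  case: ifP => _; last by rewrite mulr0 addr0.
  rewrite mulrN -opprD mulrCA -mulrDr [u * _]mulr_sumr; congr (- (_ * _)).
  rewrite (eq_bigr (fun b => u * ((c b : O X q) *~ mv_sign a b) +
    (c' b : O X q) *~ mv_sign a b)) ?big_split // => b _.
  by rewrite mulrzAr -mulrzDl.
- move=> q q' h c; apply: dsum_ext => a.
  rewrite -[LHS]/(test_dfun m (mres (test_ob n) h c) a).
  rewrite -[RHS]/(ores h (test_dfun m c a)) /test_dfun.
  case: ifP => _; last by rewrite rmorph0.
  rewrite rmorphN rmorphM rmorphXn rmorphN rmorph1 rmorph_sum; congr (- (_ * _)).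
  by apply: eq_bigr => b _; rewrite rmorphMz.
Defined.

Lemma test_dE n m q (c : test_ob n q) a : test_d n m q c a =
  if n + 1 == m then - ((-1) ^+ `|m|%N * \sum_b (c b : O X q) *~ mv_sign a b) else 0.
Proof. by []. Qed.

Definition test_cx : cx X.
Proof.
refine (@Cx k X test_ob test_d _ _).
- by move=> i j q c ij; apply: dsum_ext => a; rewrite test_dE eq_sym (negPf ij).
- move=> i j l q c; apply: dsum_ext => a; rewrite test_dE.
  case: ifP => // _; have [ij|ij] := eqVneq (i + 1) j; last first.
    by rewrite big1 ?mulr0 ?oppr0 // => b _; rewrite test_dE (negPf ij) mul0rz.
  rewrite (eq_bigr (fun b => - (-1) ^+ `|j|%N * \sum_e c e *~ (mv_sign a b * mv_sign b e))).
    rewrite -mulr_sumr exchange_big [X in _ * (_ * X)]big1 ?mulr0 ?oppr0 // => e _.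
    by rewrite -mulrz_sumr mv_sign_sq.
  move=> b _; rewrite test_dE ij eqxx -mulNr -mulrzAr mulrz_suml; congr (_ * _).
  by apply: eq_bigr => e _; rewrite -mulrzA mulrC.
Defined.

(** On stalks this is the short exact sequence of extensions by zero attached to the cover of the
    union by [V] and [W]. *)
Lemma test_acyclic : acyclic test_cx.
Proof.
move=> n q c dc.
have d0 a : \sum_b (c b : O X q) *~ mv_sign a b = 0.
  have := congr1 (fun z : test_ob (n + 1) q => z a) dc; rewrite test_dE eqxx => /eqP.
  rewrite oppr_eq0 => /eqP h; rewrite -[LHS]mul1r -(sign_sq _ (n + 1)) -mulrA.
  by rewrite h mulr0.
have c11 : c (true, true) = 0.
  by have := d0 (true, false); rewrite sum_sq /= !mulr0z !addr0.
have c10 : c (false, true) = - c (true, false).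
  have := d0 (false, false); rewrite sum_sq /= !mulr0z add0r addr0 => /eqP.
  by rewrite addrC addr_eq0 => /eqP.
pose Vq := `[< S (true, false) q >].
(* One formula serves all degrees, as each degree involves the corners of a single [sqdeg]. A germ
   on the union is lifted to [V] if [q] lies in [V], and to [W] otherwise; a pair with sum zero
   comes from the intersection. *)
pose y (a : bool * bool) : O X q := match a with
  | (true, false) => if Vq then c (false, false) else 0
  | (false, true) => if Vq then 0 else c (false, false)
  | (true, true) => c (true, false)
  | (false, false) => 0 end.
pose e : O X q := - (-1) ^+ `|n|%N.
have yo a : ~~ test_gen (n - 1) q a -> e * y a = 0.
  move=> na; apply/eqP; apply: contraNT na => ya.
  have {}ya : y a != 0 by apply: contraNneq ya => ->; rewrite mulr0.
  have gen b : c b != 0 -> test_gen n q b.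
    by apply: contraNT => nb; rewrite dfam_out.
  move: ya; case: a => [[] []] /=; rewrite ?eqxx // /test_gen.
  - move=> h; have /andP[/eqP nN /asboolP Sq] := gen _ h.
    rewrite -nN -addrA; apply/andP; split=> //; apply/asboolP.
    have : c (false, true) != 0 by rewrite c10 oppr_eq0.
    move=> /gen/andP[_ /asboolP [pq Wq]].
    by case: Sq => _ Vq'.
  - case: ifP; rewrite ?eqxx // => /asboolP Sq h; have /andP[/eqP nN _] := gen _ h.
    rewrite -nN; apply/andP; split; last exact/asboolP.
    by rewrite subrK addr0.
  - case: ifP; rewrite ?eqxx // => /asboolP Sq h; have /andP[/eqP nN /asboolP[pq VW]] := gen _ h.
    rewrite -nN; apply/andP; split; first by rewrite subrK addr0.
    by apply/asboolP; case: VW => // Vq'; case: Sq.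
have yf : exists s : seq (bool * bool), forall a, a \notin s -> e * y a = 0.
  by exists (enum {: bool * bool}) => a; rewrite mem_enum.
exists (@DSum _ (test_gen (n - 1) q) _ (fun _ => (O X q)^o : lmodType _) _ yo yf).
apply: dsum_ext => a; rewrite test_dE subrK eqxx /=.
rewrite (eq_bigr (fun b => e * (y b *~ mv_sign a b))); last first.
  by move=> b _; rewrite mulrzAr.
rewrite -mulr_sumr mulrA -mulNr mulrN opprK sign_sq mul1r sum_sq.
case: a => [[] []]; rewrite /= !mulr0z !add0r ?addr0 ?mulr1z //.
by case: ifP; rewrite ?addr0 ?add0r.
Qed.
Section TestMap.
Variables (J : cx X) (s : mv_cx V W J N p).
Hypothesis ds : cd (mv_cx V W J) N (N + 1) p s = 0.

Let sv (a : bool * bool) (j : int) : osec (mv_set V W a) (J j) p := s (a, j).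

Let sv_res a j q q' (h : spec q q') : S a q -> mres (J j) h (sv a j q) = sv a j q'.
Proof.
move=> aq; have [pq Uq] := aq; have [_ Uq'] := S_up h aq.
by have := osv_res (sv a j) h pq Uq Uq'.
Qed.

Let sv_d b n m q : n + 1 = m -> S b q -> cd J n m q (sv b n q) =
  - ((-1) ^+ `|m|%N *: \sum_a sv a m q *~ mv_sign a b).
Proof.
move=> <- [pq bq]; apply/eqP; rewrite -addr_eq0.
have := congr1 (fun z : mv_cx V W J (N + 1) p =>
  osv (z (b, n + 1)) q) ds.
rewrite fintot_dE addrK => h; apply/eqP; rewrite -[RHS]h.
rewrite -[RHS]/(cd J n (n + 1) q (sv b n q) + oscal _ _) (oscalE pq).
rewrite rmorphXn rmorphN rmorph1 osv_sum; congr (_ + _ *: _).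
by apply: eq_bigr => a _; rewrite mv_cutE.
Qed.

Let gen_S n q a (c : test_ob n q) : ~ S a q -> c a = 0.
Proof. by move=> na; apply: dfam_out; rewrite /test_gen (asboolF na) andbF. Qed.

(** A section over an open subset is a morphism out of the extension by zero of the structure sheaf:
    it is the image of the generator. *)
Definition test_fun n q (c : test_ob n q) : J n q := \sum_a (c a : O X q) *: sv a n q.

Definition test_hom n : ohom (test_ob n) (J n).
Proof.
refine (@OHom k X (test_ob n) (J n) (@test_fun n) _ _).
- move=> q u c c'; rewrite /test_fun scaler_sumr -big_split.
  by apply: eq_bigr => a _; rewrite scalerA; exact: scalerDl.
- move=> q q' h c; rewrite /test_fun mres_sum; apply: eq_bigr => a _.
  rewrite mresZ; have [aq|naq] := EM (S a q); first by rewrite (sv_res _ _ aq).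
  by rewrite /= (gen_S c naq) rmorph0 !scale0r.
Defined.

Definition test_map : cmap test_cx J.
Proof.
refine (@CMap k X test_cx J test_hom _) => n m q c.
have [nm|nm] := eqVneq (n + 1) m; last first.
  by rewrite !cd_shape ?oh0 // eq_sym.
rewrite -[LHS]/(\sum_a (test_d n m q c a : O X q) *: sv a m q).
rewrite -[test_hom n q c]/(\sum_a (c a : O X q) *: sv a n q) oh_sum.
pose g : O X q := - (-1) ^+ `|m|%N.
transitivity (\sum_a \sum_b (g * (c b : O X q)) *: (sv a m q *~ mv_sign a b)).
  apply: eq_bigr => a _; rewrite test_dE nm eqxx -mulNr mulr_sumr scaler_suml.
  by apply: eq_bigr => b _; rewrite mulrzAr -scalerMzl scalerMzr.
rewrite exchange_big; apply: eq_bigr => b _; rewrite ohZ.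
have [bq|nbq] := EM (S b q); last first.
  by rewrite (gen_S c nbq) scale0r big1 // => a _; rewrite mulr0 scale0r.
rewrite sv_d // -scaleNr scalerA mulrC scaler_sumr.
by apply: eq_bigr.
Defined.
End TestMap.
Definition test_unit (a : bool * bool) n q : test_ob n q.
Proof.
exists (fun b => if (a == b) && test_gen n q a then 1 else 0 : O X q).
- by move=> b; case: eqP => //= <- /negPf ->.
- by exists [:: a] => b; rewrite inE eq_sym => /negPf ->.
Defined.

Let test_unitE a n q b :
  test_unit a n q b = if (a == b) && test_gen n q a then 1 else 0 :> O X q.
Proof. by []. Qed.

Let unit_out a n q : ~~ test_gen n q a -> test_unit a n q = 0.
Proof. by move=> na; apply: dsum_ext => b; rewrite test_unitE (negPf na) andbF. Qed.

Let gen_up a n q q' : spec q q' -> S a q -> test_gen n q a = test_gen n q' a.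
Proof.
by move=> h aq; rewrite /test_gen !asboolT //; apply: S_up aq.
Qed.

Let unit_res a n q q' (h : spec q q') : S a q ->
  mres (test_ob n) h (test_unit a n q) = test_unit a n q'.
Proof.
move=> aq; apply: dsum_ext => b; rewrite -[LHS]/(ores h (test_unit a n q b)).
rewrite !test_unitE -(gen_up n h aq); case: ifP => _; first exact: rmorph1.
exact: rmorph0.
Qed.

Let unit_d a m q : S a q -> m + sqdeg a = N ->
  test_d m (m + 1) q (test_unit a m q) =
  (-1) ^+ `|m|%N *: \sum_b test_unit b (m + 1) q *~ mv_sign b a.
Proof.
move=> aq ma; apply: dsum_ext => b; rewrite test_dE eqxx.
rewrite -[RHS]/(_ * _) dsum_coord_sum.
have -> : (-1) ^+ absz (m + 1) = - (-1) ^+ `|m|%N :> O X q.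
  by rewrite -[m in RHS](addrK 1) sign_pred opprK.
rewrite mulNr opprK; congr (_ * _).
have ga : test_gen m q a by rewrite /test_gen ma eqxx asboolT.
rewrite (bigD1 a) // big1; last first.
  by move=> a' a'a; rewrite test_unitE eq_sym (negPf a'a) mul0rz.
rewrite [LHS]addr0 test_unitE eqxx ga (bigD1 b) // big1; last first.
  move=> b' b'b; rewrite (_ : dfam _ _ = test_unit b' (m + 1) q b *~ mv_sign b' a) //.
    by rewrite test_unitE (negPf b'b) mul0rz.
  exact: (madd_int (U := test_ob (m + 1) q) (V := O X q) (f := fun z => z b)).
rewrite [RHS]addr0.
rewrite (_ : dfam (_ *~ _) _ = test_unit b (m + 1) q b *~ mv_sign b a); last first.
  exact: (madd_int (U := test_ob (m + 1) q) (V := O X q) (f := fun z => z b)).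
have [->|ba] := eqVneq (mv_sign b a) 0; first by rewrite !mulr0z.
rewrite test_unitE eqxx /test_gen (asboolT (S_sign ba aq)).
by rewrite -addrA [1 + _]addrC -(sign_deg ba) ma eqxx.
Qed.

Section TestHomotopy.
Variables (J : cx X) (s : mv_cx V W J N p).
Hypothesis ds : cd (mv_cx V W J) N (N + 1) p s = 0.
Variable h : forall i j, ohom (test_cx i) (J j).
Hypothesis hh : forall n q x, test_map ds n q x =
  cmap0 test_cx J n q x + (cd J (n - 1) n q (h n (n - 1) q x) +
    h (n + 1) n q (cd test_cx n (n + 1) q x)).

(** The converse passage, from morphisms to sections: the homotopy is evaluated at the generators.
    It lowers degrees by one, hence the [j + 1]. *)
Definition htpy_sec (a : bool * bool) (j : int) : osec (mv_set V W a) (J j) p.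
Proof.
exists (fun q => h (j + 1) j q (test_unit a (j + 1) q)).
- move=> q nq; rewrite unit_out ?oh0 //.
  by rewrite /test_gen (asboolF nq) andbF.
- by move=> q q' g pq aq aq'; rewrite -oh_nat unit_res.
Defined.

Let htpy_out a j : j + sqdeg a != N - 1 -> htpy_sec a j = 0.
Proof.
move=> aj; apply: osec_ext => q.
rewrite -[LHS]/(h (j + 1) j q (test_unit a (j + 1) q)) unit_out ?oh0 //.
rewrite /test_gen negb_and; apply/orP; left; apply: contra aj => /eqP <-.
by rewrite addrAC addrK.
Qed.

Definition htpy_mv : mv_cx V W J (N - 1) p.
Proof.
exists (fun aj => htpy_sec aj.1 aj.2).
- by move=> [a j]; apply: htpy_out.
- exists [seq (a, N - 1 - sqdeg a) | a <- enum {: bool * bool}] => -[a j] aj.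
  apply: htpy_out; apply: contra aj => /eqP <-; apply/mapP; exists a; rewrite ?mem_enum //.
  by rewrite addrK.
Defined.

Lemma htpy_mv_d : s = cd (mv_cx V W J) (N - 1) N p htpy_mv.
Proof.
apply: dsum_ext => -[a m].
have [am|am] := eqVneq (m + sqdeg a) N; last by rewrite !(dfam_out (_ : dsum _ _)).
apply: osec_ext' => q pq aq.
have Sq : S a q by [].
have ga : test_gen m q a by rewrite /test_gen am eqxx asboolT.
have -> : osv (s (a, m)) q = test_map ds m q (test_unit a m q).
  rewrite -[RHS]/(\sum_b (test_unit a m q b : O X q) *: (osv (s (b, m)) q : J m q)).
  rewrite (bigD1 a) // big1; last first.
    by move=> b ba; rewrite test_unitE eq_sym (negPf ba) scale0r.
  by rewrite [RHS]addr0 test_unitE eqxx ga scale1r.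
rewrite hh -[cd test_cx _ _ _ _]/(test_d _ _ _ _) unit_d // ohZ oh_sum add0r.
rewrite fintot_dE'.
have E b j : htpy_mv (b, j) = htpy_sec b j by [].
rewrite E (eq_bigr (fun b => mv_cut V W J b a m p (htpy_sec b m))); last by move=> b _; rewrite E.
rewrite -[RHS]/(cd J (m - 1) m q (osv (htpy_sec a (m - 1)) q) + oscal _ _) (oscalE pq).
rewrite rmorphXn rmorphN rmorph1 osv_sum; congr (cd _ _ _ _ _ + _ *: _).
  by rewrite -[RHS]/(h (m - 1 + 1) (m - 1) q (test_unit a (m - 1 + 1) q)) subrK.
by apply: eq_bigr => b _; rewrite mv_cutE // oh_int.
Qed.
End TestHomotopy.
End TestComplex.

Lemma mv_acyclic (k : comPzRingType) (X : rfspace k) (V W : set X) (J : cx X) :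
  upclosed V -> upclosed W -> K_injective J -> acyclic (mv_cx V W J).
Proof.
move=> upV upW iJ N p s ds.
have [h hh] := iJ _ (test_map upV upW ds) (@test_acyclic k X V W upV upW N p).
by exists (htpy_mv h); apply: htpy_mv_d hh.
Qed.

(** * The projection morphism over an open subset *)

Section Transform.
Variables (k : comPzRingType) (X : rfspace k) (P A J : cx X) (psi : cmap (tot P A) J).

Section Eval.
Variables (U : set X) (p x : X) (h : spec p x).

Definition ev_comp i j : otens (P i) (secs U (A j)) p -> otens (P i) (A j) x :=
  tmap (mres (P i) h) (fun s : osecM U (A j) p => s x).

Lemma ev_comp_pure i j m s : @ev_comp i j (tpure m s) = tpure (mres (P i) h m) (osv s x).
Proof. exact: (tmap_pure (@mres_lin _ _ (P i) _ _ h) (@osv_semilin _ _ U (A j) _ _ h)). Qed.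
Lemma ev_comp_semilin i j : semilin (ores h) (@ev_comp i j).
Proof. exact: (tmap_semilin (@mres_lin _ _ (P i) _ _ h) (@osv_semilin _ _ U (A j) _ _ h)). Qed.
Lemma ev_compD i j : {morph @ev_comp i j : s t / s + t}.
Proof. exact: (semilinD (@ev_comp_semilin i j)). Qed.

Lemma ev_comp_l i j t : ev_comp (tot_dl P (secs_cx U A) i j p t) =
  tot_dl P A i j x (ev_comp t).
Proof.
move: t; apply: tens_ext => [u v|u v|m s]; rewrite ?ohD ?ev_compD ?ohD //.
by rewrite /tot_dl ev_comp_pure !otens_map_pure ev_comp_pure oh_nat.
Qed.
Lemma ev_comp_r i j t : ev_comp (tot_dr P (secs_cx U A) i j p t) =
  tot_dr P A i j x (ev_comp t).
Proof.
move: t; apply: tens_ext => [u v|u v|m s]; rewrite ?ohD ?ev_compD ?ohD //.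
by rewrite /tot_dr ev_comp_pure !otens_map_pure ev_comp_pure.
Qed.

Definition tot_ev : zmap (stalk p (tot P (secs_cx U A))) (stalk x (tot P A)).
Proof.
refine (@ZMap (stalk p (tot P (secs_cx U A))) (stalk x (tot P A))
  (@tot_add _ _ _ P (secs_cx U A) P A p x ev_comp ev_compD) _ _).
- by move=> n s t; apply: dsum_ext => ij; apply: ev_compD.
- by move=> n m t; apply: tot_add_d; [apply: ev_comp_l|apply: ev_comp_r].
Defined.

Lemma tot_evE n (t : tot P (secs_cx U A) n p) ij :
  (tot_ev n t : tot P A n x) ij = ev_comp ((t : dsum _ _) ij).
Proof. by []. Qed.

Lemma tot_ev_semilin n : semilin (ores h)
  (fun t : tot P (secs_cx U A) n p => tot_ev n t : tot P A n x).
Proof. by move=> a s t; apply: dsum_ext => ij; apply: ev_comp_semilin. Qed.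
End Eval.

Lemma tot_ev_res (U : set X) p x x' (h : spec p x) (h' : spec p x') (g : spec x x') n
    (t : tot P (secs_cx U A) n p) : U x -> U x' ->
  mres (tot P A n) g (tot_ev U h n t) = tot_ev U h' n t.
Proof.
move=> Ux Ux'; apply: dsum_ext => ij.
rewrite -[LHS]/(mres (otens (P ij.1) (A ij.2)) g (ev_comp h (t ij))) -[RHS]/(ev_comp h' (t ij)).
move: (t ij); apply: tens_ext => [u v|u v|m s]; rewrite ?ev_compD ?mresD //.
rewrite !ev_comp_pure otens_res_pure (mres_comp _ _ h').
by rewrite (osv_res s g h Ux Ux').
Qed.

Definition trans_sec U n p (t : tot P (secs_cx U A) n p) : osec U (J n) p.
Proof.
exists (fun x => if pselect (spec p x /\ U x) is left h
  then psi n x (tot_ev U h.1 n t) else 0).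
- by move=> x nx; case: pselect.
- move=> x x' g px Ux Ux'; case: pselect => [h|[]] //.
  case: pselect => [h'|[]]; last by split=> //; apply: spec_trans g.
  by rewrite -oh_nat (tot_ev_res _ h'.1).
Defined.

Lemma trans_secE U n p (t : tot P (secs_cx U A) n p) x (h : spec p x) : U x ->
  trans_sec t x = psi n x (tot_ev U h n t).
Proof.
move=> Ux; rewrite -[LHS]/(if pselect (spec p x /\ U x) is left h'
  then psi n x (tot_ev U h'.1 n t) else 0).
by case: pselect => [h'|[]] //; rewrite (Prop_irrelevance h'.1 h).
Qed.

Definition trans_hom U n : ohom (tot P (secs_cx U A) n) (secs U (J n)).
Proof.
refine (@OHom k X (tot P (secs_cx U A) n) (secs U (J n)) (@trans_sec U n) _ _).
- move=> p a s t; apply: osec_ext' => x px Ux.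
  rewrite (trans_secE _ px) // -[tot_ev _ _ _ _]/(tot_ev U px n (a *: s + t)).
  rewrite tot_ev_semilin ohD ohZ -!trans_secE //.
  by rewrite -[RHS]/((a *: trans_sec s : osecM U (J n) p) x + trans_sec t x) (osvZ _ _ px).
- move=> p q h t; apply: osec_ext' => x qx Ux.
  have px := spec_trans h qx.
  rewrite -[mres (secs U (J n)) _ _]/(sec_res h _) sec_resE // (trans_secE _ px) //.
  rewrite (trans_secE _ qx) //; congr (psi n x _); apply: dsum_ext => ij.
  rewrite !tot_evE -[X in ev_comp _ X]/(mres (otens (P ij.1) (secs U (A ij.2))) h (t ij)).
  move: (t ij); apply: tens_ext => [u v|u v|m s]; rewrite ?mresD ?ev_compD //.
  rewrite otens_res_pure !ev_comp_pure (mres_comp _ _ px).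
  by rewrite -[mres (secs _ _) _ _]/(sec_res h s) sec_resE.
Defined.

(** This is T_U as a morphism of sheaves: an element is evaluated at each point [x] of [U] above
    [p], and [psi] is applied on the stalk at [x]. *)
Definition trans U : cmap (tot P (secs_cx U A)) (secs_cx U J).
Proof.
refine (@CMap k X (tot P (secs_cx U A)) (secs_cx U J) (trans_hom U) _).
move=> n m p t; apply: osec_ext' => x px Ux.
rewrite -[LHS]/(trans_sec (cd (tot P (secs_cx U A)) n m p t) x) (trans_secE _ px) //.
rewrite -[RHS]/(cd J n m x (trans_sec t x)) (trans_secE _ px) //.
rewrite -cf_d; congr (psi m x _).
exact: (@zf_d _ _ (tot_ev U px) n m t).
Defined.

Lemma transE U n p (t : tot P (secs_cx U A) n p) x (h : spec p x) : U x ->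
  osv (trans U n p t) x = psi n x (tot_ev U h n t).
Proof. exact: trans_secE. Qed.

(** The coefficient [e] and the case where [V] is not contained in [U] are included so that the
    statement covers every pair of corners of a Mayer-Vietoris square. *)
Lemma trans_cut U V e n p (t : tot P (secs_cx U A) n p) :
  trans V n p (tot_map (cmap_id P) (cut U V e A) n p t) =
  cut U V e J n p (trans U n p t).
Proof.
have cE F (s : osec U F p) y : V y ->
    osv (cut_hom U V e F p s) y = if `[< V `<=` U >] then s y *~ e else 0.
  move=> Vy; have [VU|nVU] := EM (V `<=` U).
    by rewrite (asboolT VU) -[LHS]/(sec_cut V e s y) sec_cutE.
  by rewrite (asboolF nVU) /= asboolF // => -[].
apply: osec_ext' => x px Vx.
rewrite (transE _ px) // -[RHS]/(osv (cut_hom U V e (J n) p (trans U n p t)) x) cE //.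
case: asboolP => [VU|nVU]; last first.
  rewrite (_ : tot_ev V px n _ = 0) ?oh0 //; apply: dsum_ext => ij.
  rewrite tot_evE -[X in ev_comp _ X]/(otens_map _ _ p (t ij)).
  move: (t ij); apply: tens_ext => [u v|u v|m s].
  - by rewrite ohD ev_compD.
  - by rewrite addr0.
  rewrite otens_map_pure ev_comp_pure cE // (asboolF nVU).
  by rewrite -(scale0r 0) -tpureZr scale0r.
rewrite (transE _ px); last exact: VU.
rewrite -oh_int; congr (psi n x _); apply: dsum_ext => ij.
have -> : (tot_ev U px n t *~ e : tot P A n x) ij = ev_comp px (t ij) *~ e.
  exact: (madd_int (U := tot P A n x) (f := fun z : tot P A n x => z ij)).
rewrite tot_evE -[X in ev_comp _ X]/(otens_map _ _ p (t ij)).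
move: (t ij); apply: tens_ext => [u v|u v|m s].
- by rewrite ohD ev_compD.
- by rewrite ev_compD mulrzDl.
rewrite otens_map_pure !ev_comp_pure cE // asboolT //.
exact: (madd_int (V := tens _ _) (@tpureDr _ _ _ _)).
Qed.

Lemma trans_mv V W p : upclosed V -> upclosed W -> K_flat P -> K_injective A ->
  K_injective J -> zqis (stalk_map p (trans V)) -> zqis (stalk_map p (trans W)) ->
  zqis (stalk_map p (trans (V `&` W))) -> zqis (stalk_map p (trans (V `|` W))).
Proof.
move=> upV upW fP iA iJ qV qW qVW.
have aA := tot_fintot_acyclic (fP _ (mv_acyclic upV upW iA)).
have aJ := mv_acyclic upV upW iJ.
apply: (mv_five_lemma (T := fun a => trans (mv_set V W a)) _ aA aJ) => //.
by move=> a b n q t; apply: trans_cut.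
Qed.

Lemma trans_set0 p : zqis (stalk_map p (trans set0)).
Proof.
have J0 n (s : secs_cx set0 J n p) : s = 0 by apply: osec_ext' => x _ [].
have A0 n (t : tot P (secs_cx set0 A) n p) : t = 0.
  apply: dsum_ext => ij; elim/tensor_ind: (t ij) => [|u v hu hv|m s] //.
    by rewrite hu hv addr0.
  rewrite (_ : s = 0); last by apply: osec_ext' => x _ [].
  by rewrite -(scale0r 0) -tpureZr scale0r.
move=> n; split=> [x _ _|y _]; first by exists 0; rewrite (A0 _ x); apply/esym/A0.
by exists 0, 0; split; [exact: oh0|rewrite (J0 _ y); apply/esym/J0].
Qed.

Lemma trans_qis p : K_flat P -> K_injective A -> K_injective J ->
  (forall x, spec p x -> zqis (stalk_map p (trans (spec x)))) ->
  forall U : set X, upclosed U -> U `<=` spec p -> zqis (stalk_map p (trans U)).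
Proof.
move=> fP iA iJ base.
have /finite_seqP[r Xr] := @pt_fin _ X.
have r_all x : x \in r.
  by have : [set: X] x by []; rewrite Xr.
(* The list may repeat points, so this is not quite the cardinality; only strict monotonicity
   matters. *)
pose size (U : set X) := count (fun x => `[< U x >]) r.
have lt_size (U V : set X) x : V `<=` U -> U x -> ~ V x -> (size V < size U)%N.
  move=> VU Ux Vx; rewrite /size -addn1.
  have x1 : (0 < count (pred1 x) r)%N by rewrite -has_count has_pred1.
  apply: leq_trans (_ : size V + count (pred1 x) r <= _)%N; first by rewrite leq_add2l.
  rewrite -count_predUI [X in (_ + X)%N](eq_count (a2 := pred0)) ?count_pred0 ?addn0; last first.
    by move=> y /=; case: eqP => [->|_]; rewrite ?andbF ?(asboolF Vx).
  apply: sub_count => y /= /orP[/asboolP/VU Uy|/eqP ->]; exact/asboolP.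
pose down (x : X) : set X := [set y | spec y x].
(* Descent on the number of points below [x]. *)
have minimal (U : set X) : U !=set0 ->
    exists2 x, U x & forall y, U y -> spec y x -> spec x y.
  move=> [x]; have [n] := ubnP (size (down x)); elim: n x => // n IH x xn Ux.
  have [//|nx] := EM (forall y, U y -> spec y x -> spec x y); first by exists x.
  have /existsNP[y /not_implyP[Uy /not_implyP[yx xy]]] := nx.
  apply: (IH y) => //; apply: (@leq_trans (size (down x))); last exact: xn.
  apply: (lt_size _ _ x) => //.
    by move=> z zy; apply: spec_trans yx.
  exact: (spec_refl x).
move=> U; have [n] := ubnP (size U); elim: n U => // n IH U Un upU Up.
have [->|/set0P/minimal[x Ux minx]] := eqVneq U set0; first exact: trans_set0.
have xU : spec x `<=` U by move=> y xy; apply: upU Ux.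
pose V : set X := [set y | U y /\ ~ spec y x].
have upV : upclosed V.
  move=> y z yz [Uy nyx]; split; first exact: upU Uy.
  by move=> zx; apply: nyx; apply: spec_trans zx.
have upx : upclosed (spec x) by move=> y z yz xy; apply: spec_trans yz.
(* The space need not be T0: a point [y] of [U] below [x] may differ from [x], but minimality then
   gives [spec x y], so that [y] lies in U_x. *)
have UE : U = V `|` spec x.
  apply/seteqP; split=> [y Uy|y [[//]|/xU //]].
  by have [yx|nyx] := EM (spec y x); [right; apply: minx|left].
have small (V' : set X) : upclosed V' -> V' `<=` V -> zqis (stalk_map p (trans V')).
  move=> upV' V'V; apply: IH => //.
    apply: (@leq_trans (size U)); last exact: Un.
    apply: (lt_size _ _ x) => // [y /V'V[]//|/V'V[_]].
    by apply; apply: spec_refl.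
  by move=> y /V'V[Uy _]; apply: Up.
rewrite UE; apply: trans_mv => //.
- exact: small.
- by apply: base; apply: Up.
apply: small; last by move=> y [].
by move=> y z yz [Vy xy]; split; [apply: upV Vy|apply: upx xy].
Qed.
End Transform.

(** * Flatness and quasi-coherence *)

Section Image.
Variables (R : comPzRingType) (B C : lmodType R) (h : {linear B -> C}).

Record imod := IMod { im_val :> C; im_ex : exists b, h b = im_val }.
HB.instance Definition _ := gen_eqMixin imod.
HB.instance Definition _ := gen_choiceMixin imod.

Lemma im_ext (u v : imod) : im_val u = im_val v -> u = v.
Proof.
by case: u v => [u hu] [v hv] /= uv; case: v / uv hv => hv; congr IMod; apply: Prop_irrelevance.
Qed.

Definition im0 : imod. Proof. by exists 0; exists 0; apply: linear0. Defined.
Definition imopp (u : imod) : imod.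
Proof. by exists (- im_val u); have [b <-] := im_ex u; exists (- b); rewrite linearN. Defined.
Definition imadd (u v : imod) : imod.
Proof.
exists (im_val u + im_val v); have [b <-] := im_ex u; have [b' <-] := im_ex v.
by exists (b + b'); rewrite linearD.
Defined.
Definition imscale (a : R) (u : imod) : imod.
Proof.
exists (a *: im_val u); have [b <-] := im_ex u; exists (a *: b).
by rewrite linearZ.
Defined.
Fact imaddA : associative imadd. Proof. by move=> u v w; apply: im_ext; apply: addrA. Qed.
Fact imaddC : commutative imadd. Proof. by move=> u v; apply: im_ext; apply: addrC. Qed.
Fact imadd0 : left_id im0 imadd. Proof. by move=> u; apply: im_ext; apply: add0r. Qed.
Fact imaddN : left_inverse im0 imopp imadd.
Proof. by move=> u; apply: im_ext; apply: addNr. Qed.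
HB.instance Definition _ := GRing.isZmodule.Build imod imaddA imaddC imadd0 imaddN.
Fact imscaleA a b u : imscale a (imscale b u) = imscale (a * b) u.
Proof. by apply: im_ext; apply: scalerA. Qed.
Fact imscale1 : left_id 1 imscale.
Proof. by move=> u; apply: im_ext; apply: scale1r. Qed.
Fact imscaleDr : right_distributive imscale +%R.
Proof. by move=> a u v; apply: im_ext; apply: scalerDr. Qed.
Fact imscaleDl u : {morph imscale^~ u : a b / a + b}.
Proof. by move=> a b; apply: im_ext; apply: scalerDl. Qed.
HB.instance Definition _ := GRing.Zmodule_isLmodule.Build R imod
  imscaleA imscale1 imscaleDr imscaleDl.

Fact im_val_lin : linear im_val. Proof. by []. Qed.
HB.instance Definition _ := GRing.isLinear.Build R imod C _ im_val im_val_lin.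

Definition im_in (b : B) : imod := @IMod (h b) (ex_intro _ b erefl).
Lemma im_in_lin : linear im_in.
Proof. by move=> a u v; apply: im_ext; apply: linearP. Qed.
Definition im_lift (u : imod) : B := projT1 (cid (im_ex u)).
Lemma im_liftK u : h (im_lift u) = im_val u.
Proof. by rewrite /im_lift; case: cid. Qed.
End Image.

Section Exact.
Variables (R T : comPzRingType) (g : {rmorphism R -> T}).
Let F : lmodType R := restrM g T^o.
Let id_sl : semilin (idfun : {rmorphism R -> R}) (id : F -> F). Proof. by []. Qed.

Section TmapId.
Variables (A B : lmodType R) (f : A -> B).
Hypothesis f_lin : linear f.
Let f_sl : semilin (idfun : {rmorphism R -> R}) f := f_lin.
Lemma tmapi_pure a c : tmap f id (tpure a c : tens A F) = tpure (f a) c.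
Proof. exact: (tmap_pure f_sl id_sl). Qed.
Lemma tmapiD : {morph (tmap f id : tens A F -> tens B F) : x y / x + y}.
Proof. exact: (tmapD f_sl id_sl). Qed.
Lemma tmapi0 : tmap f id (0 : tens A F) = 0.
Proof. exact: (tmap0 f_sl id_sl). Qed.
End TmapId.

Lemma tmapi_comp (A B C : lmodType R) (f : A -> B) (h : B -> C) (t : tens A F) :
  linear f -> linear h ->
  tmap h id (tmap f id t : tens B F) = tmap (h \o f) id t :> tens C F.
Proof.
move=> fl hl; exact: (@tmap_comp _ _ _ idfun idfun _ _ _ _ _ _ f id h id fl id_sl hl id_sl).
Qed.

(* The quotient of [B] by the kernel of [h] is [imod h]; right exactness of the
   tensor product is checked on the generators of [tens_eq]. *)
Lemma flat_exact (A B C : lmodType R) (f : A -> B) (h : B -> C) :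
  flat_morphism g -> linear f -> linear h ->
  (forall b, h b = 0 -> exists a, b = f a) ->
  forall t : tens B F, tmap h id t = 0 :> tens C F ->
  exists t' : tens A F, t = tmap f id t'.
Proof.
move=> flat_g f_lin h_lin ex t ht.
pose hL : {linear B -> C} := HB.pack h (GRing.isLinear.Build R B C _ h h_lin).
pose h' : B -> imod hL := im_in hL; have h'_lin : linear h' := im_in_lin hL.
have hD : {morph h : x y / x + y} by move=> x y; rewrite -[x]scale1r h_lin !scale1r.
have liftK (u : imod hL) : h (im_lift u) = im_val u := im_liftK u.
(* Flatness is used only here: the inclusion of the image of [h] in [C] stays injective after
   tensoring. *)
have {}ht : tmap h' id t = 0 :> tens (imod hL) F.
  apply: (flat_g _ _ (@im_val _ _ _ hL : {linear imod hL -> C})); first exact: im_ext.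
  by rewrite tmapi_comp // tmapi0.
pose Im (z : tens B F) := exists t' : tens A F, z = tmap f id t'.
have Im0 : Im 0 by exists 0; rewrite tmapi0.
have ImD y z : Im y -> Im z -> Im (y + z).
  by move=> [y' ->] [z' ->]; exists (y' + z'); rewrite tmapiD.
have ImN y : Im y -> Im (- y).
  by move=> [y' ->]; exists (- y'); rewrite (maddN (tmapiD f_lin)).
have Imp b c : h b = 0 -> Im (tpure b c).
  by move=> /ex[a ->]; exists (tpure a c); rewrite tmapi_pure.
(* The chosen lifts to [B] are not additive. Each defining relation of the tensor product is
   therefore lifted only up to tensors of elements killed by [h], which come from [A]. *)
pose L (s : seq (imod hL * F)) : tens B F := \sum_(u <- s) tpure (im_lift u.1) u.2.
have Lc s s' : L (s ++ s') = L s + L s' by rewrite /L big_cat.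
have L1 u c : L [:: (u, c)] = tpure (im_lift u) c by rewrite /L big_seq1.
have L2 u c u' c' : L [:: (u, c); (u', c')] = tpure (im_lift u) c + tpure (im_lift u') c'.
  by rewrite /L big_cons big_seq1.
have tB b b' (c : F) : tpure b c - tpure b' c = tpure (b - b') c.
  by rewrite -(maddB (tpureDl (c : F))).
have Leq s s' : tens_eq s s' -> Im (L s - L s').
  elim=> {s s'}.
  - by move=> s; rewrite subrr.
  - by move=> s s' _ H; rewrite -opprB; apply: ImN.
  - by move=> s1 s2 s3 _ H _ H'; rewrite -(subrK (L s2) (L s1)) -addrA; apply: ImD.
  - move=> s s' r r' _ H _ H'; rewrite !Lc opprD addrACA; exact: ImD.
  - by move=> s s'; rewrite !Lc [L s + _]addrC subrr.
  - move=> u u' c; rewrite L1 L2 -tpureDl tB; apply: Imp.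
    by rewrite (maddB hD) hD !liftK subrr.
  - by move=> u c c'; rewrite L1 L2 -tpureDr subrr.
  - move=> a u c; rewrite !L1 -tpureZ tB; apply: Imp.
    by rewrite (maddB hD) -[a *: im_lift u]addr0 h_lin !liftK (madd0 hD) addr0 subrr.
  move=> u c; rewrite L2 -tpureDl [L _]big_nil subr0; apply: Imp.
  by rewrite hD !liftK addNr.
have [s st] : exists s, t = tsum s by exists (repr t); rewrite tsum_repr.
have hs : tens_eq [seq (h' u.1, u.2) | u <- s] [::].
  apply/tsumP; rewrite [RHS](_ : _ = 0) // -ht st !tsumE big_map.
  by rewrite (madd_sum (tmapiD h'_lin)); apply: eq_bigr => u _; rewrite tmapi_pure.
have := Leq _ _ hs; rewrite [L [::]]big_nil subr0 => Ls.
rewrite -/(Im t) -(subrK (L [seq (h' u.1, u.2) | u <- s]) t); apply: (ImD _ _) => //.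
rewrite st tsumE /L big_map -sumrB; apply: (big_ind Im) => [|y z|u _] /=; [exact: Im0|exact: ImD|].
by rewrite tB; apply: Imp; rewrite (maddB hD) liftK subrr.
Qed.

(** This allows [flat_exact] to be applied to the common kernel of two maps, seen as the kernel of
    one map to a product. *)
Lemma tens_pair0 (B C : lmodType R) (t : tens (B * C)%type F) :
  tmap fst id t = 0 :> tens B F -> tmap snd id t = 0 :> tens C F -> t = 0.
Proof.
move=> t1 t2; pose i1 (b : B) : (B * C)%type := (b, 0); pose i2 (c : C) : (B * C)%type := (0, c).
have i1l : linear i1.
  by move=> a u v; rewrite /i1; congr pair; rewrite /= scaler0 addr0.
have i2l : linear i2.
  by move=> a u v; rewrite /i2; congr pair; rewrite /= scaler0 addr0.
have l1 : linear (fst : (B * C)%type -> B) by [].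
have l2 : linear (snd : (B * C)%type -> C) by [].
have -> : t = tmap i1 id (tmap fst id t : tens B F) + tmap i2 id (tmap snd id t : tens C F).
  move: t {t1 t2}; apply: tens_ext => [|u v|[b c] a] //.
    by rewrite !tmapiD // addrACA.
  rewrite !tmapi_pure // -tpureDl; congr tpure.
  by rewrite /i1 /i2; congr pair; rewrite /= ?addr0 ?add0r.
by rewrite t1 t2 !tmapi0 // addr0.
Qed.
End Exact.

Lemma tpure0r (R : comPzRingType) (M N : lmodType R) (m : M) :
  tpure m 0 = 0 :> tens M N.
Proof. exact: (@madd0 _ _ (tpure m : N -> tens M N) (@tpureDr _ _ _ m)). Qed.
Lemma tpure0l (R : comPzRingType) (M N : lmodType R) (n : N) :
  tpure 0 n = 0 :> tens M N.
Proof. exact: (@madd0 _ _ (tpure^~ n : M -> tens M N) (@tpureDl _ _ _ n)). Qed.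

Section Can.
Variables (k : comPzRingType) (X : rfspace k) (p x : X) (h : spec p x).

Definition stalk_alg : lmodType (O X p) := restrM (ores h) (O X x)^o.

(* The comparison morphism [N_p (x)_(O_p) O_x -> N_x]. *)
Definition can (N : omod X) : tens (N p) stalk_alg -> N x :=
  tlift (fun m (c : stalk_alg) => (c : O X x) *: mres N h m).

Section Module.
Variable N : omod X.
Let can_bal : balanced (fun m (c : stalk_alg) => (c : O X x) *: mres N h m).
Proof.
split=> [m m' c|m c c'|a m c]; first by rewrite mresD scalerDr.
  exact: scalerDl.
by rewrite mresZ scalerA mulrC.
Qed.
Lemma can_pure m (c : O X x) : can (tpure m (c : stalk_alg)) = c *: mres N h m.
Proof. exact: (tlift_pure can_bal). Qed.
Lemma canD : {morph @can N : u v / u + v}.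
Proof. exact: (tliftD can_bal). Qed.
Lemma can0 : @can N 0 = 0.
Proof. exact: (tlift0 can_bal). Qed.
End Module.

Lemma can_nat (N N' : omod X) (f : ohom N N') t :
  can (tmap (f p) id t : tens (N' p) stalk_alg) = f x (can t).
Proof.
move: t; apply: tens_ext => [u v|u v|m c].
- by rewrite (tmapiD (@oh_lin _ _ _ _ f p)) canD.
- by rewrite canD ohD.
by rewrite (tmapi_pure (@oh_lin _ _ _ _ f p)) !can_pure ohZ oh_nat.
Qed.

Section Free.
Variable I : choiceType.

Definition free_unit (q : X) (i : I) : @ofree k X I q.
Proof.
exists (fun j => if i == j then 1 else 0 : O X q) => [//|].
by exists [:: i] => j; rewrite inE eq_sym => /negPf ->.
Defined.

Lemma free_unitE q i j : free_unit q i j = if i == j then 1 else 0 :> O X q.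
Proof. by []. Qed.

Lemma free_sum q (y : @ofree k X I q) (s : seq I) : uniq s ->
  (forall i, i \notin s -> y i = 0) -> y = \sum_(i <- s) (y i : O X q) *: free_unit q i.
Proof.
move=> us ys; apply: dsum_ext => j; rewrite dsum_coord_sum.
rewrite (eq_bigr (fun i => if i == j then y j : O X q else 0)); last first.
  move=> i _; rewrite -[LHS]/((y i : O X q) * free_unit q i j) free_unitE.
  by case: eqP => [->|_]; rewrite ?mulr1 ?mulr0.
rewrite -big_mkcond /=; have [js|js] := boolP (j \in s).
  by rewrite -big_filter filter_pred1_uniq // big_seq1.
by rewrite big_seq_cond big1 ?ys // => i /andP[is_ /eqP ij]; rewrite -ij is_ in js.
Qed.

Lemma can_free_coord (v : @ofree k X I p) (c : O X x) i :
  (can (tpure v (c : stalk_alg)) : @ofree k X I x) i = c * ores h (v i).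
Proof. by rewrite can_pure. Qed.

Lemma can_free_surj (y : @ofree k X I x) : exists t, can t = y.
Proof.
have [s hs] := dfam_fin y.
exists (\sum_(i <- undup s) tpure (free_unit p i) (y i : stalk_alg)).
rewrite (madd_sum (@canD _)) [RHS](@free_sum _ _ (undup s)) ?undup_uniq //; last first.
  by move=> i; rewrite mem_undup => /hs.
apply: eq_bigr => i _; rewrite can_pure; congr (_ *: _).
apply: dsum_ext => j; rewrite -[LHS]/(ores h (free_unit p i j)) !free_unitE.
by case: eqP => _; rewrite ?rmorph1 ?rmorph0.
Qed.

Lemma can_free_inj (t : tens (@ofree k X I p) stalk_alg) : can t = 0 -> t = 0.
Proof.
(* The expansion in the basis is claimed for all lists containing [s], so that the lists of two
   summands can be merged. *)
suff [s hs] : exists s : seq I, forall r, {subset s <= r} -> uniq r ->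
    t = \sum_(i <- r) tpure (free_unit p i) ((can t : @ofree k X I x) i : stalk_alg).
  move=> t0; rewrite (hs (undup s)) ?undup_uniq //; last by move=> i; rewrite mem_undup.
  by rewrite big1 // => i _; rewrite t0; exact: tpure0r.
elim/tensor_ind: t => [|u v [s hs] [s' hs']|v c].
- exists [::] => r _ _; rewrite big1 // => i _.
  by rewrite can0; exact: tpure0r.
- exists (s ++ s') => r sr ur.
  have su : {subset s <= r} by move=> i is_; apply: sr; rewrite mem_cat is_.
  have sv : {subset s' <= r} by move=> i is_; apply: sr; rewrite mem_cat is_ orbT.
  rewrite [LHS](congr2 +%R (hs r su ur) (hs' r sv ur)).
  by rewrite -big_split; apply: eq_bigr => i _; rewrite canD; apply/esym/tpureDr.
have [s hs] := dfam_fin v; exists s => r sr ur.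
have vr : forall i, i \notin r -> v i = 0.
  by move=> i ir; apply: hs; apply: contra ir; apply: sr.
rewrite [in LHS](free_sum ur vr).
rewrite (madd_sum (tpureDl (c : stalk_alg))); apply: eq_bigr => i _.
rewrite can_free_coord tpureZ; congr tpure.
exact: mulrC.
Qed.
End Free.

(** Base change is right exact and [can] is bijective for free modules, so bijectivity passes to
    cokernels. *)
Lemma can_presented (N : omod X) : presented N ->
  (forall t, @can N t = 0 -> t = 0) /\ (forall m, exists t, @can N t = m).
Proof.
move=> [I [J [a [b [b_surj ab]]]]]; split=> [t t0|m].
  have bt (u : tens (N p) stalk_alg) : exists v, u = tmap (b p) id v.
    elim/tensor_ind: u => [|u v [u' ->] [v' ->]|m c].
    - by exists 0; rewrite (tmapi0 _ (@oh_lin _ _ _ _ b p)).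
    - by exists (u' + v'); rewrite (tmapiD (@oh_lin _ _ _ _ b p)).
    have [y <-] := b_surj p m.
    by exists (tpure y c); rewrite (tmapi_pure (@oh_lin _ _ _ _ b p)).
  have [v tv] := bt t; move: t0; rewrite tv can_nat => /ab[w aw].
  have [u uw] := can_free_surj w.
  have -> : v = tmap (a p) id u.
    apply/eqP; rewrite -subr_eq0; apply/eqP; apply: can_free_inj.
    by rewrite (maddB (@canD _)) can_nat uw aw subrr.
  rewrite (tmapi_comp u (@oh_lin _ _ _ _ a p) (@oh_lin _ _ _ _ b p)).
  move: u {uw}; apply: (@tens_ext _ _ _ _ _ (fun _ => 0)) => [u1 u2|u1 u2|y c].
  - rewrite tmapiD //.
    by move=> e y z /=; rewrite !oh_lin.
  - by rewrite addr0.
  rewrite tmapi_pure; last by move=> e y' z /=; rewrite !oh_lin.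
  rewrite /= (_ : b p (a p y) = 0); last by apply/ab; exists y.
  exact: tpure0l.
have [y <-] := b_surj x m; have [t <-] := can_free_surj y.
by exists (tmap (b p) id t); rewrite can_nat.
Qed.
End Can.

(** A neighbourhood of [p] on which [M] is presented contains U_p, hence [x], and [p] is still below
    [x] in it. *)
Lemma can_quasi_coherent (k : comPzRingType) (X : rfspace k) (M : omod X)
    (p x : X) (h : spec p x) : quasi_coherent M ->
  (forall t, @can k X p x h M t = 0 -> t = 0) /\
  (forall m, exists t, @can k X p x h M t = m).
Proof.
move=> qcM; have [U [oU Up pM]] := qcM p.
have Ux : U x by apply: h; split.
pose tp : openS U := (exist _ p (mem_set Up) : U).
pose tx : openS U := (exist _ x (mem_set Ux) : U).
have h' : spec tp tx.
  move=> B [[A oA <-] Ap].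
  by apply: (h A); split.
have [] := can_presented h' pM.
have <- : spec_cont (@open_cont k X U) h' = h by apply: Prop_irrelevance.
by move=> i s; split.
Qed.

(** * The projection morphism over a minimal open subset *)

Lemma zqis_bijP (A B : zcx) (f : zmap A B) :
  (forall n x, f n x = 0 -> x = 0) -> (forall n y, exists x, f n x = y) -> zqis f.
Proof.
move=> fi fs n; split=> [x dx [y fx]|y dy].
  have [z zy] := fs _ y; exists z; apply/eqP; rewrite -subr_eq0; apply/eqP.
  by apply: fi; rewrite zfB fx zf_d zy subrr.
have [x xy] := fs n y; exists x, 0; rewrite zd0 addr0 xy; split=> //.
by apply: fi; rewrite zf_d xy dy.
Qed.

Lemma zqis_ext (A B : zcx) (f g : zmap A B) :
  (forall n x, f n x = g n x) -> zqis f -> zqis g.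
Proof. by move=> fg; apply: zqis_cohom => n x _; rewrite fg; apply: zcohom_refl. Qed.

Section Skyscraper.
Variables (k : comPzRingType) (X : rfspace k) (U : set X) (p x : X) (h : spec p x).
Hypotheses (Ux : U x) (xU : U `<=` spec x).

(** The hypotheses on [U] cover both U_x and {x}; in either case a section is determined by its
    value at [x]. *)
Definition ext_sec (F : omod X) (m : F x) : osec U F p.
Proof.
exists (fun y => if pselect (spec x y /\ U y) is left g then mres F g.1 m else 0).
- by move=> y ny; case: pselect => // -[xy Uy]; case: ny; split=> //; apply: spec_trans xy.
- move=> y y' g py Uy Uy'; case: pselect => [a|[]]; last by split=> //; apply: xU.
  case: pselect => [a'|[]]; last by split=> //; apply: xU.
  by rewrite (mres_comp _ _ a'.1).
Defined.

Lemma ext_secE (F : omod X) (m : F x) : ext_sec m x = m.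
Proof.
rewrite /=; case: pselect => [a|[]]; first by rewrite mres_id.
by split=> //; apply: spec_refl.
Qed.

Lemma ext_secK (F : omod X) (s : osec U F p) : ext_sec (s x) = s.
Proof.
apply: osec_ext' => y py Uy /=; case: pselect => [a|[]]; last by split=> //; apply: xU.
by rewrite (osv_res s a.1 h Ux).
Qed.

Lemma osv_inj (F : omod X) (s t : osec U F p) : s x = t x -> s = t.
Proof. by move=> st; rewrite -(ext_secK s) st ext_secK. Qed.

Definition ev_map (A : cx X) : zmap (stalk p (secs_cx U A)) (stalk x A).
Proof.
by refine (@ZMap (stalk p (secs_cx U A)) (stalk x A) (fun i s => osv (s : osec U (A i) p) x) _ _).
Defined.

Lemma ev_map_qis (A : cx X) : zqis (ev_map A).
Proof.
apply: zqis_bijP => [n s s0|n m].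
  by apply: osv_inj; rewrite -[LHS]/(ev_map A n s) s0.
by exists (ext_sec m); apply: ext_secE.
Qed.
End Skyscraper.

Section TotBij.
Variables (k : comPzRingType) (X : rfspace k) (P A B : cx X) (f : cmap A B) (p : X).
Variable g : forall j, B j p -> A j p.
Hypotheses (fK : forall j, cancel (f j p) (@g j)) (gK : forall j, cancel (@g j) (f j p)).

Let g_lin j : linear (@g j).
Proof.
have fi : injective (f j p) := can_inj (fK (j := j)).
by move=> a u v; apply: fi; rewrite gK oh_lin !gK.
Qed.

Let G i j : tens (P i p) (B j p) -> tens (P i p) (A j p) := tmap id (@g j).
Let G_sl i j : semilin (idfun : {rmorphism O X p -> O X p}) (@G i j).
Proof. by apply: (@tmap_semilin _ _ _ _ _ _ idfun) => //; apply: g_lin. Qed.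

(** Bijectivity is assumed at [p] only: cutting U_x down to {x} is bijective on the stalks at points
    below [x], but not on all stalks. *)
Lemma tot_map_bij_qis : zqis (stalk_map p (tot_map (cmap_id P) f)).
Proof.
have fsl j : semilin (idfun : {rmorphism O X p -> O X p}) (f j p) := @oh_lin _ _ _ _ (f j) p.
have isl (M : lmodType (O X p)) : semilin (idfun : {rmorphism O X p -> O X p}) (id : M -> M).
  by [].
pose Gt n : tot P B n p -> tot P A n p :=
  dsmap (f := fun ij => @G ij.1 ij.2) (fun ij => @G_sl ij.1 ij.2).
apply: (@zqis_bij (stalk p (tot P A)) (stalk p (tot P B))
  (stalk_map p (tot_map (cmap_id P) f)) Gt) => n y; apply: dsum_ext => ij.
  rewrite -[LHS]/(tmap id (@g ij.2) (tmap id (f ij.2 p) (y ij))).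
  rewrite (@tmap_comp _ _ _ idfun idfun) //; last exact: g_lin.
  by rewrite -[RHS]tmap_id; apply: eq_tmap => // z /=; rewrite fK.
rewrite -[LHS]/(tmap id (f ij.2 p) (tmap id (@g ij.2) (y ij))).
rewrite (@tmap_comp _ _ _ idfun idfun) //; last exact: g_lin.
by rewrite -[RHS]tmap_id; apply: eq_tmap => // z /=; rewrite gK.
Qed.
End TotBij.

(** Each stalk of a skyscraper sheaf at [x] is either the stalk of the given sheaf at [x] or
    zero. *)
Lemma secs_point_qis (k : comPzRingType) (X : rfspace k) (x : X) (A B : cx X)
    (f : cmap A B) : quasi_iso f -> quasi_iso (secs_cmap [set x] f).
Proof.
move=> /quasi_isoP qf; apply/quasi_isoP => q.
have [h|nh] := EM (spec q x).
  have xx : [set x] `<=` spec x by move=> y ->; apply: spec_refl.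
  have qA := ev_map_qis h (erefl : [set x] x) xx A.
  have qB := ev_map_qis h (erefl : [set x] x) xx B.
  apply: (zqis_cancel_l qB); apply: zqis_ext (zqis_comp (qf x) qA).
  by [].
have z C n (s : secs_cx [set x] C n q) : s = 0.
  by apply: osec_ext' => y qy yx; case: nh; rewrite -yx.
apply: zqis_bijP => n s; first by rewrite (z _ _ s).
by exists 0; rewrite (z _ _ s); apply: z.
Qed.

Section Base.
Variables (k : comPzRingType) (X : rfspace k) (p x : X) (h : spec p x).
Variables (M : omod X) (P I J : cx X).
Variables (kP : cmap P (single M)) (kI : cmap (single ounit) I) (kJ : cmap (single M) J).
Variable psi : cmap (tot P I) J.
Hypotheses (fP : K_flat P) (qP : quasi_iso kP) (qI : quasi_iso kI) (qJ : quasi_iso kJ).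
Hypothesis flat_h : flat_morphism (ores h).
Hypothesis can_inj0 : forall t, @can k X p x h M t = 0 -> t = 0.
Hypothesis can_surj : forall m, exists t, @can k X p x h M t = m.
Hypothesis psiE : forall n q (t : tot P (single ounit) n q),
  cd (tot P (single ounit)) n (n + 1) q t = 0 ->
  zcohom (stalk_map q psi n (stalk_map q (tot_map (cmap_id P) kI) n t))
    (stalk_map q kJ n (stalk_map q kP n (stalk_map q (right_unit P) n t))).

Let F := stalk_alg h.
Let pl n m : linear (cd P n m p) := @oh_lin _ _ _ _ (cd P n m) p.

Definition stalk_tens : zcx.
Proof.
refine (@Zcx (fun n => tens (P n p) F) (fun n m => tmap (cd P n m p) id) _ _).
- by move=> n m; apply: tmapiD.
- move=> n m l t; rewrite tmapi_comp //.
  move: t; apply: (@tens_ext _ _ _ _ _ (fun _ => 0)) => [u v|u v|y c].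
  + by apply: tmapiD => e y z /=; rewrite !oh_lin.
  + by rewrite addr0.
  rewrite tmapi_pure /=; last by move=> e y' z /=; rewrite !oh_lin.
  by rewrite cd_sq; apply: tpure0l.
Defined.

Definition stalk_tens_res : zcx.
Proof.
refine (@Zcx (fun n => tens (single M n p) F) (fun n m => fun=> 0) _ _) => //.
by move=> n m u v; rewrite addr0.
Defined.

Let kl n : linear (kP n p) := @oh_lin _ _ _ _ (kP n) p.

Definition aug : zmap stalk_tens stalk_tens_res.
Proof.
refine (@ZMap stalk_tens stalk_tens_res (fun n => tmap (kP n p) id) _ _).
- by move=> n; apply: tmapiD.
- move=> n m t; rewrite -[zd stalk_tens _ _ _]/(tmap (cd P n m p) id t) tmapi_comp //.
  move: t; apply: (@tens_ext _ _ _ _ _ (fun _ => 0)) => [u v|u v|y c].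
  + by apply: tmapiD => e y z /=; rewrite !oh_lin.
  + by rewrite addr0.
  rewrite tmapi_pure /=; last by move=> e y' z /=; rewrite !oh_lin.
  by rewrite cf_d; apply: tpure0l.
Defined.

(** On stalks at [p], the complex [P] resolves [M], and tensoring with the flat algebra O_x
    preserves this. *)
Lemma aug_qis : zqis aug.
Proof.
move=> n; have [ki ks] := qP n p; split=> [t dt [y ht]|y _].
  (* The kernel of the pair consists of boundaries: a cocycle with zero image in [single M] is a
     boundary, since [kP] is a quasi-isomorphism. *)
  apply: (flat_exact (h := fun b => (cd P n (n + 1) p b, kP n p b)) flat_h) => //.
  - by move=> a u v; congr pair; rewrite oh_lin.
  - move=> b [db kb]; apply: ki => //; exists 0; rewrite kb oh0 //.
  apply: tens_pair0; rewrite tmapi_comp //; try by move=> a u v; congr pair; rewrite oh_lin.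
have d0 (q : stalk_tens_res (n - 1)) : zd stalk_tens_res (n - 1) n q = 0 by [].
elim/tensor_ind: y => [|u v [u' [z [du ->]]] [v' [w [dv ->]]]|m c].
- by exists 0, 0; rewrite zd0 zf0 addr0.
- exists (u' + v'), 0; rewrite zdD du dv addr0; split=> //.
  by rewrite zfD !d0 !addr0.
have [|a [z [da ->]]] := ks m; first by [].
exists (tpure a c), 0; rewrite d0; split.
  by rewrite -[LHS]/(tmap _ _ _) tmapi_pure // da; apply: tpure0l.
rewrite [RHS]addr0 -[RHS]/(tmap (kP n p) id (tpure a c)) tmapi_pure //; congr tpure.
exact: addr0.
Qed.

Definition can_map : zmap stalk_tens_res (stalk x (single M)).
Proof.
refine (@ZMap stalk_tens_res (stalk x (single M)) (fun n => @can k X p x h (single M n)) _ _).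
- by move=> n; apply: canD.
- by move=> n m t; rewrite can0.
Defined.

Let ozero_tens n (t : tens (single_ob M n p) F) : n != 0 -> t = 0.
Proof.
case: n t => [[//|n]|n] t _; elim/tensor_ind: t => [|u v -> ->|m c] //;
  rewrite ?addr0 // (_ : m = 0) ?tpure0l //; exact: ozero_eq.
Qed.

Lemma can_map_qis : zqis can_map.
Proof.
apply: zqis_bijP => n; have [->|n0] := eqVneq n 0; [exact: can_inj0| |exact: can_surj|].
  by move=> t _; apply: ozero_tens.
move=> y; exists 0; rewrite zf0.
by case: n n0 y => [[//|n]|n] _ y; apply: ozero_eq.
Qed.

Let S := [set x].
Let Sx : S x := erefl.
Let xS : S `<=` spec x. Proof. by move=> y ->; apply: spec_refl. Qed.
Let ev0 (s : osecM S ounit p) : F := osv s x.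
Let ev0_lin : linear ev0.
Proof. by move=> a u v; exact: (@osv_semilin _ _ S ounit p x h a u v). Qed.

Let tmr_sl n : semilin (idfun : {rmorphism O X p -> O X p}) (id : P n p -> P n p).
Proof. by []. Qed.

(** Only the component at [(n, 0)] can be nonzero, as [single ounit] is concentrated in degree 0. *)
Definition unit_comp n (t : tot P (secs_cx S (single ounit)) n p) : tens (P n p) F :=
  tmap id ev0 ((t : dsum _ _) (n, 0)).

Definition unit_map : zmap (stalk p (tot P (secs_cx S (single ounit)))) stalk_tens.
Proof.
refine (@ZMap (stalk p (tot P (secs_cx S (single ounit)))) stalk_tens unit_comp _ _).
- move=> n u v; exact: (tmapD (@tmr_sl n) ev0_lin).
- move=> n m t.
  rewrite -[zd (stalk _ _) n m t]/(cd (tot P (secs_cx S (single ounit))) n m p t).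
  rewrite /unit_comp tot_dE -[RHS]/(tmap (cd P n m p) id (tmap id ev0 (t (n, 0)))).
  have [<-|nm] := eqVneq (n + 1) m; last first.
    rewrite (tmap0 (@tmr_sl m) ev0_lin); apply/esym.
    move: (tmap id ev0 _) => z; move: z.
    apply: (@tens_ext _ _ _ _ _ (fun _ => 0)) => [u v|u v|y c].
    + exact: tmapiD.
    + by rewrite addr0.
    by rewrite tmapi_pure // cd_shape ?tpure0l // eq_sym.
  have -> : tot_dr P (secs_cx S (single ounit)) (n + 1) 0 p (t (n + 1, 0 - 1)) = 0.
    by apply: otens_map0r => s; apply: osec_ext.
  rewrite scaler0 addr0 /tot_dl.
  have -> : tmap id ev0 (otens_map (cd P (n + 1 - 1) (n + 1)) (ohom_id _) p
      (t (n + 1 - 1, 0))) = tmap (cd P n (n + 1) p) id (tmap id ev0 (t (n, 0))).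
    have : n + 1 - 1 = n by rewrite addrK.
    move: (n + 1 - 1) => l ->.
    move: (t (n, 0)); apply: tens_ext => [u v|u v|y s].
    + by rewrite ohD (tmapD (@tmr_sl _) ev0_lin).
    + by rewrite (tmapD (@tmr_sl _) ev0_lin) tmapiD.
    by rewrite otens_map_pure !(tmap_pure (@tmr_sl _) ev0_lin) tmapi_pure.
  by [].
Defined.

Let secs_ozero (i : int) (s : osecM S (single_ob (@ounit k X) i) p) : i != 0 -> s = 0.
Proof.
by case: i s => [[//|i]|i] s _; apply: osec_ext => y; apply: ozero_eq.
Qed.

Lemma unit_map_qis : zqis unit_map.
Proof.
pose g0 (c : F) : osecM S (@ounit k X) p := ext_sec h xS (c : @ounit k X x).
have evK : cancel ev0 g0 by move=> s; apply: ext_secK.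
have g0K : cancel g0 ev0 by move=> c; exact: (ext_secE h Sx xS (c : @ounit k X x)).
have g0_lin : linear g0.
  by move=> a u v; apply: (can_inj evK); rewrite ev0_lin !g0K.
have Q0 n i j (t : tot P (secs_cx S (single ounit)) n p) : (i, j) != (n, 0) -> t (i, j) = 0.
  move=> ij; have [ijn|ijn] := eqVneq (i + j) n; last by apply: dfam_out.
  have j0 : j != 0.
    by apply: contra ij => /eqP j0; move: ijn; rewrite j0 addr0 => ->.
  elim/tensor_ind: (t (i, j)) => [|u v -> ->|m s] //; first by rewrite addr0.
  rewrite (secs_ozero s j0); exact: tpure0r.
apply: zqis_bijP => n.
- move=> t t0; apply: dsum_ext => -[i j].
  have [[-> ->]|/eqP ij] := pselect ((i, j) = (n, 0)); last exact: Q0.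
  rewrite -[LHS](@tmap_id _ (P n p) (osecM S ounit p)).
  have <- : tmap id g0 (tmap id ev0 (t (n, 0))) = tmap id id (t (n, 0)).
    rewrite (@tmap_comp _ _ _ idfun idfun) //.
    by apply: eq_tmap => // s; apply: evK.
  rewrite -[tmap id ev0 _]/(unit_map n t) t0.
  exact: (tmap0 (@tmr_sl n) g0_lin).
move=> y; pose V (ij : int * int) := tens (P ij.1 p) (secs S (single_ob (@ounit k X) ij.2) p).
pose z : V (n, 0) := tmap id g0 y.
have z1 ij : ~~ (ij.1 + ij.2 == n) -> @dput _ V (n, 0) z ij = 0.
  by move=> ij_n; rewrite dput_out //; apply: contra ij_n => /eqP <- /=; rewrite addr0.
have z2 : exists s : seq (int * int), forall ij, ij \notin s -> @dput _ V (n, 0) z ij = 0.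
  by exists [:: (n, 0)] => ij; rewrite inE eq_sym => ij_n; rewrite dput_out.
exists (DSum z1 z2 : tot P (secs_cx S (single ounit)) n p).
rewrite -[LHS]/(tmap id ev0 (@dput _ V (n, 0) z (n, 0))) dput_id /z.
rewrite (@tmap_comp _ _ _ idfun idfun) // -[RHS]tmap_id.
by apply: eq_tmap => // c; apply: g0K.
Qed.

(** K-flatness allows the skyscraper of [I] to be replaced with that of [ounit]. By [psiE] the map
    then agrees in cohomology with a composite of known quasi-isomorphisms, through [aug], [can_map]
    and [kJ]. *)
Lemma trans_point_qis : zqis (stalk_map p (trans psi S)).
Proof.
apply: (zqis_cancel_l (ev_map_qis h Sx xS J)).
have q1 := (quasi_isoP _).1 (tot_qis fP (secs_point_qis x qI)) p.
apply: (zqis_cancel_r q1).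
have qH := zqis_comp can_map_qis (zqis_comp aug_qis unit_map_qis).
have qG := zqis_comp ((quasi_isoP kJ).1 qJ x) qH.
apply: zqis_cohom qG => n t dt.
have -> : zcomp (stalk_map x kJ) (zcomp can_map (zcomp aug unit_map)) n t =
    stalk_map x kJ n (stalk_map x kP n (stalk_map x (right_unit P) n
      (tot_ev P (single ounit) S h n t))).
  rewrite -[LHS]/(kJ n x (can (tmap (kP n p) id (unit_comp t) : tens _ F))).
  rewrite -[RHS]/(kJ n x (kP n x (oright (P n) x (ev_comp h (t (n, 0)))))).
  congr (kJ n x _); rewrite /unit_comp.
  move: (t (n, 0)); apply: tens_ext => [u v|u v|m s].
  - by rewrite (tmapD (@tmr_sl n) ev0_lin) tmapiD ?canD.
  - by rewrite ev_compD !ohD.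
  rewrite (tmap_pure (@tmr_sl n) ev0_lin) tmapi_pure // can_pure ev_comp_pure.
  rewrite -[oright _ _ _]/(tlift _ _) (tlift_pure (oright_bal (P n) x)).
  by rewrite ohZ oh_nat.
have dt' : cd (tot P (single ounit)) n (n + 1) x (tot_ev P (single ounit) S h n t) = 0.
  have := @zf_d _ _ (tot_ev P (single ounit) S h) n (n + 1) t; rewrite dt zf0.
  exact: esym.
apply: zcohom_trans (zcohom_sym (psiE dt')) _.
have -> : zcomp (zcomp (ev_map S p x J) (stalk_map p (trans psi S)))
    (stalk_map p (tot_map (cmap_id P) (secs_cmap S kI))) n t =
    stalk_map x psi n (stalk_map x (tot_map (cmap_id P) kI) n
      (tot_ev P (single ounit) S h n t)).
  rewrite -[LHS]/(osv (trans psi S n p _) x) (transE _ _ h) //.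
  congr (psi n x _); apply: dsum_ext => ij.
  rewrite tot_evE -[X in ev_comp _ X]/(otens_map (ohom_id _) (secs_cmap S kI ij.2) p (t ij)).
  rewrite -[RHS]/(otens_map (ohom_id _) (kI ij.2) x (ev_comp h (t ij))).
  move: (t ij); apply: tens_ext => [u v|u v|m s].
  - by rewrite ohD ev_compD.
  - by rewrite ev_compD ohD.
  by rewrite !(otens_map_pure, ev_comp_pure).
exact: zcohom_refl.
Qed.

(** A section over U_x is its value at [x], so on the stalk at [p] nothing changes when U_x is cut
    down to {x}. *)
Lemma trans_base : zqis (stalk_map p (trans psi (spec x))).
Proof.
have xx : spec x x := spec_refl x.
have Uxx : spec x `<=` spec x by [].
have qev := ev_map_qis h xx Uxx J.
apply: (zqis_cancel_l qev).
pose g j (s : secs_cx S I j p) : secs_cx (spec x) I j p :=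
  ext_sec h Uxx (osv s x).
have qcut : zqis (stalk_map p (tot_map (cmap_id P) (cut (spec x) S 1 I))).
  apply: (@tot_map_bij_qis _ _ _ _ _ _ _ g) => j s.
    rewrite /g -[osv (cut _ _ _ _ _ _ _) x]/(sec_cut S 1 s x) sec_cutE // mulr1z.
    exact: ext_secK.
  apply: (osv_inj h Sx xS).
  by rewrite -[LHS]/(sec_cut S 1 (g j s) x) sec_cutE // mulr1z ext_secE.
have q1 := zqis_comp (ev_map_qis h Sx xS J) (zqis_comp trans_point_qis qcut).
apply: zqis_ext q1 => n t.
rewrite -[LHS]/(osv (trans psi S n p (tot_map (cmap_id P) (cut (spec x) S 1 I) n p t)) x).
by rewrite trans_cut -[LHS]/(sec_cut S 1 (trans psi (spec x) n p t) x) sec_cutE.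
Qed.
End Base.

(** * The graph *)

Section ChangeBase.
Variables (R S : comPzRingType) (g : {rmorphism R -> S}).
Variables (M : lmodType R) (N : lmodType S) (N' : lmodType R).
Variables (u : N' -> N) (v : N -> N').
Hypotheses (u_sl : semilin g u) (uK : cancel u v) (vK : cancel v u).

Let uD := semilinD u_sl.
Let uZ := semilinZ u_sl.
Let vD : {morph v : x y / x + y}.
Proof. by move=> x y; apply: (can_inj uK); rewrite uD !vK. Qed.
Let vZ a n : v (g a *: n) = a *: v n.
Proof. by apply: (can_inj uK); rewrite uZ !vK. Qed.

(* [M (x)_R N -> (M (x)_R S) (x)_S N], with [N'] the restriction of scalars of
   [N]. *)
Definition chb : tens M N' -> tens (bchM g M) N :=
  tlift (fun m n => tpure (bpure g m 1 : bchM g M) (u n)).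
Let chb_bal : balanced (fun m n => tpure (bpure g m 1 : bchM g M) (u n)).
Proof.
split=> [m m' n|m n n'|a m n]; first by rewrite bpureDl tpureDl.
  by rewrite uD tpureDr.
by rewrite bpureZ -bpureZr tpureZ uZ.
Qed.
Lemma chb_pure m n : chb (tpure m n) = tpure (bpure g m 1 : bchM g M) (u n).
Proof. exact: (tlift_pure chb_bal). Qed.
Lemma chbD : {morph chb : x y / x + y}.
Proof. exact: (tliftD chb_bal). Qed.

Let b1 (n : N) : bchM g M -> tens M N' :=
  @tlift _ M (restrM g S^o) (tens M N') (fun m s => tpure m (v ((s : S) *: n))).
Let b1_bal n : @balanced _ M (restrM g S^o) (tens M N')
  (fun m s => tpure m (v ((s : S) *: n))).
Proof.
split=> [m m' s|m s s'|a m s]; first exact: tpureDl.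
  by rewrite scalerDl vD tpureDr.
by rewrite tpureZ -vZ scalerA.
Qed.
Let b1_pure n m s : b1 n (bpure g m s) = tpure m (v (s *: n)).
Proof. exact: (tlift_pure (b1_bal n)). Qed.
Let b1D n : {morph b1 n : x y / x + y}.
Proof. exact: (tliftD (b1_bal n)). Qed.
Let b10 n : b1 n 0 = 0.
Proof. exact: (tlift0 (b1_bal n)). Qed.

Definition chb_inv : tens (bchM g M) N -> tens M N' := tlift (fun w n => b1 n w).
Let inv_bal : balanced (fun w n => b1 n w).
Proof.
split=> [w w' n|w n n'|a w n]; first exact: b1D.
- elim/bch_ind: w => [|w w' hw hw'|m s]; first by rewrite !b10 addr0.
    by rewrite !b1D hw hw' addrACA.
  by rewrite !b1_pure scalerDr vD tpureDr.
- elim/bch_ind: w => [|w w' hw hw'|m s]; first by rewrite scaler0 !b10.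
    by rewrite scalerDr !b1D hw hw'.
  by rewrite bpureZr !b1_pure scalerA mulrC.
Qed.
Lemma chb_invD : {morph chb_inv : x y / x + y}.
Proof. exact: (tliftD inv_bal). Qed.
Lemma chb_inv_pure m s n :
  chb_inv (tpure (bpure g m s : bchM g M) n) = tpure m (v (s *: n)).
Proof. by rewrite /chb_inv (tlift_pure inv_bal) b1_pure. Qed.

Lemma chbK : cancel chb chb_inv.
Proof.
apply: (tens_ext (f := chb_inv \o chb) (g := id)) => [x y|x y|m n] //=.
  by rewrite chbD chb_invD.
by rewrite chb_pure chb_inv_pure scale1r uK.
Qed.
Lemma chb_invK : cancel chb_inv chb.
Proof.
apply: (tens_ext (f := chb \o chb_inv) (g := id)) => [x y|x y|w n] //=.
  by rewrite chb_invD chbD.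
elim/bch_ind: w => [|w w' hw hw'|m s].
- by rewrite tpure0l (madd0 chb_invD) (madd0 chbD).
- by rewrite tpureDl chb_invD chbD hw hw'.
by rewrite chb_inv_pure chb_pure vK -tpureZ bpureZr mulr1.
Qed.
End ChangeBase.

Lemma bpure1_semilin (R S : comPzRingType) (g : {rmorphism R -> S}) (N : lmodType R) :
  semilin g (fun m : N => bpure g m 1 : bchM g N).
Proof. by move=> a m m'; rewrite bpureDl bpureZ mulr1 bpureZr mulr1. Qed.

Section GraphUnit.
Variables (k : comPzRingType) (X Y : rfspace k) (f : rfmor X Y).
Let G : rfmor X (prodS X Y) := graphS f.
Let pi : rfmor (prodS X Y) X := proj1S X Y.

(** A right inverse of [graph_pull_fun]. Composed with it, [psi] becomes a map out of [tot P I], as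
    [trans] requires. *)
Definition graph_unit_fun (N : omod X) x (m : N x) : pull G (pull pi N) x :=
  bpure (fsh G x) (bpure (fsh pi (G x)) m 1 : pull pi N (G x)) 1.

Definition graph_unit_hom (N : omod X) : ohom N (pull G (pull pi N)).
Proof.
refine (@OHom k X N (pull G (pull pi N)) (@graph_unit_fun N) _ _).
- move=> x a m m'; rewrite /graph_unit_fun.
  rewrite (@bpure1_semilin _ _ (fsh pi (G x)) (N (pi (G x))) a m m').
  rewrite bpure1_semilin; congr (_ *: _ + _).
  rewrite -[LHS]/(graph_sh f x (prod_inl (graph_pt f x) a)); exact: graph_shl.
- move=> x x' h m; rewrite -[RHS]/(pull_res h _) /graph_unit_fun.
  rewrite pull_res_pure rmorph1.
  rewrite -[mres (pull pi N) _ _]/(pull_res _ _) pull_res_pure rmorph1.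
  congr (bpure _ (bpure _ (mres N _ m) 1) 1); exact: Prop_irrelevance.
Defined.

Definition graph_unit (P : cx X) : cmap P (pull_cx G (pull_cx pi P)).
Proof.
refine (@CMap k X P (pull_cx G (pull_cx pi P)) (fun n => graph_unit_hom (P n)) _).
move=> n m x y; rewrite -[RHS]/(pull_fun (pull_map pi (cd P n m)) _).
rewrite -[LHS]/(graph_unit_fun _) -[graph_unit_hom _ x y]/(graph_unit_fun y) /graph_unit_fun.
by rewrite pull_fun_pure -[pull_map _ _ _ _]/(pull_fun (cd P n m) _) pull_fun_pure.
Defined.

Lemma graph_unitK (P : cx X) n x (m : P n x) :
  graph_pull f P n x (graph_unit P n x m) = m.
Proof.
rewrite -[LHS]/(graph_pull_fun (graph_unit_fun m)) graph_pull_fun_pure scale1r.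
by rewrite graph_pull_in_pure rmorph1 scale1r.
Qed.

Section Stalk.
Variable z : prodS X Y.

(* [secs graph_set F] at [z.1] is the stalk at [z] of the direct image of [F]. *)
Definition graph_set : set X := [set x | spec z (G x)].

Lemma graph_set_up : upclosed graph_set.
Proof.
move=> x y xy zx; apply: (spec_trans zx).
exact: (spec_cont (@fcont _ _ _ G) xy).
Qed.

Lemma graph_set_sub : graph_set `<=` spec z.1.
Proof. by move=> x zx; exact: (spec_cont (@fst_cont _ X Y) zx). Qed.

Section Module.
Variable F : omod X.

Definition to_push (s : osec graph_set F z.1) : gsec G F z.
Proof.
exists (fun x _ => osv s x) => x x' h u u'.
by apply: osv_res => //; apply: graph_set_sub.
Defined.

Definition of_push (s : gsec G F z) : osec graph_set F z.1.
Proof.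
exists (fun x => if pselect (minopen z (G x)) is left u then s x u else 0).
- move=> x nx; case: pselect => // u; case: nx; split=> //; exact: graph_set_sub.
- move=> x x' h zx u u'; case: pselect => // v; case: pselect => // v'.
  exact: sfam_res.
Defined.

Lemma to_pushK : cancel to_push of_push.
Proof. by move=> s; apply: osec_ext' => x zx u /=; case: pselect. Qed.
Lemma of_pushK : cancel of_push to_push.
Proof.
move=> s; apply: gsec_ext => x u /=; case: pselect => [v|//].
by rewrite (Prop_irrelevance v u).
Qed.

(** The scalars act through the first factor of the product, on which the graph morphism induces the
    identity. *)
Lemma to_push_semilin : semilin (prod_inl z)
  (to_push : osecM graph_set F z.1 -> gsecM G F z).
Proof.
move=> a s t; apply: gsec_ext => x u.
have h : spec z.1 x := graph_set_sub u.
rewrite -[LHS]/(osv (a *: s : osecM graph_set F z.1) x + osv t x) (osvZ a s h).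
rewrite -[RHS]/(fsh G x (prod_res u (prod_inl z a)) *: osv s x + osv t x).
rewrite (prod_res_l u h); congr (_ *: _ + _); apply/esym; exact: graph_shl.
Qed.
End Module.

Variables (P A : cx X).

Let B := push_cx G A.
Let Q := pull_cx pi P.
Let xi i j : otens (P i) (secs graph_set (A j)) z.1 -> otens (Q i) (B j) z :=
  @chb _ _ (prod_inl z) (P i z.1) (gsecM G (A j) z) (osecM graph_set (A j) z.1)
    (@to_push (A j)).
Let xi_pure i j m s : @xi i j (tpure m s) =
  tpure (bpure (prod_inl z) m 1 : Q i z) (to_push s : B j z).
Proof. exact: (@chb_pure _ _ (prod_inl z) (P i z.1) _ _ _ (@to_push_semilin (A j)) m s). Qed.
Let xiD i j : {morph @xi i j : s t / s + t}.
Proof. exact: (@chbD _ _ (prod_inl z) (P i z.1) _ _ _ (@to_push_semilin (A j))). Qed.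

Let xi_l i j t : xi (tot_dl P (secs_cx graph_set A) i j z.1 t) = tot_dl Q B i j z (xi t).
Proof.
move: t; apply: tens_ext => [u v|u v|m s]; rewrite ?ohD ?xiD ?ohD //.
rewrite /tot_dl xi_pure !otens_map_pure xi_pure.
by rewrite -[pull_map _ _ _ _]/(pull_fun (cd P (i - 1) i) _) pull_fun_pure.
Qed.
Let xi_r i j t : xi (tot_dr P (secs_cx graph_set A) i j z.1 t) = tot_dr Q B i j z (xi t).
Proof.
move: t; apply: tens_ext => [u v|u v|m s]; rewrite ?ohD ?xiD ?ohD //.
by rewrite /tot_dr xi_pure !otens_map_pure xi_pure.
Qed.

(** The cancellation of base change: (P_p (x) O_z) (x) N over O_z is P_p (x) N over O_p, for p =
    [z.1] and N the stalk at [z] of the direct image. *)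
Definition tot_graph : zmap (stalk z.1 (tot P (secs_cx graph_set A))) (stalk z (tot Q B)).
Proof.
refine (@ZMap (stalk z.1 (tot P (secs_cx graph_set A))) (stalk z (tot Q B))
  (@tot_add _ _ _ P (secs_cx graph_set A) Q B z.1 z xi xiD) _ _).
- by move=> n s t; apply: dsum_ext => ij; apply: xiD.
- by move=> n m t; apply: tot_add_d; [apply: xi_l|apply: xi_r].
Defined.

Lemma tot_graph_qis : zqis tot_graph.
Proof.
pose ix i j : otens (Q i) (B j) z -> otens (P i) (secs graph_set (A j)) z.1 :=
  @chb_inv _ _ (prod_inl z) (P i z.1) (gsecM G (A j) z) (osecM graph_set (A j) z.1)
    (@of_push (A j)).
have sl j := @to_push_semilin (A j).
have xiK i j : cancel (@xi i j) (@ix i j).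
  exact: (chbK (sl j) (@to_pushK (A j)) (@of_pushK (A j))).
have ixK i j : cancel (@ix i j) (@xi i j).
  exact: (chb_invK (sl j) (@to_pushK (A j)) (@of_pushK (A j))).
have ix0 i j : @ix i j 0 = 0.
  by apply: (can_inj (xiK i j)); rewrite ixK (madd0 (@xiD i j)).
apply: zqis_bijP => n t.
  move=> t0; apply: dsum_ext => -[i j]; apply: (can_inj (xiK i j)).
  rewrite (madd0 (@xiD i j)).
  exact: (congr1 (fun y : tot Q B n z => y (i, j)) t0).
have t1 ij : ~~ (ij.1 + ij.2 == n) -> @ix ij.1 ij.2 ((t : dsum _ _) ij) = 0.
  by move=> ijn; rewrite dfam_out.
have t2 : exists s : seq (int * int), forall ij, ij \notin s -> @ix ij.1 ij.2 ((t : dsum _ _) ij) = 0.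
  by have [s hs] := dfam_fin t; exists s => ij /hs ->.
exists (DSum t1 t2 : tot P (secs_cx graph_set A) n z.1).
by apply: dsum_ext => -[i j]; apply: ixK.
Qed.

Definition push_map_stalk (J : cx X) : zmap (stalk z.1 (secs_cx graph_set J)) (stalk z (push_cx G J)).
Proof.
refine (@ZMap (stalk z.1 (secs_cx graph_set J)) (stalk z (push_cx G J))
  (fun j => @to_push (J j)) _ _).
- by move=> j s t; apply: gsec_ext.
- by move=> i j s; apply: gsec_ext.
Defined.

Lemma push_map_stalk_qis (J : cx X) : zqis (push_map_stalk J).
Proof.
apply: (@zqis_bij _ _ (push_map_stalk J) (fun j => @of_push (J j))) => j.
  exact: to_pushK.
exact: of_pushK.
Qed.

(** Before [psi] is applied, both sides send [m (x) s] to the family with value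
    [((m|_x (x) 1) (x) 1) (x) s x] at [x]. *)
Lemma projection_graph (J : cx X) (psi : cmap (tot (pull_cx G Q) A) J) n
    (t : tot P (secs_cx graph_set A) n z.1) :
  push_cmap G psi n z (projection G Q A n z (tot_graph n t)) =
  push_map_stalk J n (trans (cmap_comp psi (tot_map (graph_unit P) (cmap_id A)))
    graph_set n z.1 t).
Proof.
apply: gsec_ext => x u; have h : spec z.1 x := graph_set_sub u.
rewrite -[LHS]/(psi n x (proj_val (tot_graph n t : tot Q B n z) u)).
rewrite -[RHS]/(osv (trans _ graph_set n z.1 t) x) (transE _ _ h) //.
rewrite -[RHS]/(psi n x (tot_map (graph_unit P) (cmap_id A) n x (tot_ev P A graph_set h n t))).
congr (psi n x _); apply: dsum_ext => -[i j].
rewrite -[LHS]/(oproj_at u (xi (t (i, j)))).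
rewrite -[RHS]/(otens_map (graph_unit P i) (ohom_id (A j)) x (ev_comp h (t (i, j)))).
move: (t (i, j)); apply: tens_ext => [v w|v w|m s].
- by rewrite xiD oproj_atD.
- by rewrite ev_compD ohD.
rewrite xi_pure oproj_at_pure ev_comp_pure otens_map_pure; congr tpure.
rewrite -[RHS]/(graph_unit_fun _) /graph_unit_fun.
rewrite -[mres (pull pi _) _ _]/(pull_res _ _) pull_res_pure rmorph1.
congr (bpure _ (bpure _ (mres _ _ m) 1) 1); exact: Prop_irrelevance.
Qed.
End Stalk.
End GraphUnit.

Lemma tot_map_swap (k : comPzRingType) (X : rfspace k) (P P' A A' : cx X)
    (e : cmap P P') (g : cmap A A') n q (t : tot P A n q) :
  tot_map (cmap_id P') g n q (tot_map e (cmap_id A) n q t) =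
  tot_map e (cmap_id A') n q (tot_map (cmap_id P) g n q t).
Proof.
apply: dsum_ext => -[i j].
rewrite -[LHS]/(otens_map (ohom_id (P' i)) (g j) q
  (otens_map (e i) (ohom_id (A j)) q (t (i, j)))).
rewrite -[RHS]/(otens_map (e i) (ohom_id (A' j)) q
  (otens_map (ohom_id (P i)) (g j) q (t (i, j)))).
by rewrite !otens_map_comp; apply: eq_otens_map.
Qed.

Lemma right_unit_nat (k : comPzRingType) (X : rfspace k) (P P' : cx X)
    (e : cmap P P') n q (t : tot P (single ounit) n q) :
  right_unit P' n q (tot_map e (cmap_id (single ounit)) n q t) =
  e n q (right_unit P n q t).
Proof.
rewrite -[LHS]/(oright (P' n) q (otens_map (e n) (ohom_id ounit) q (t (n, 0)))).
exact: oright_nat.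
Qed.

Section RestrictIdent.
Variables (k : comPzRingType) (X : rfspace k) (M : omod X) (P P2 I J : cx X).
Variables (gu : cmap P P2) (gp : cmap P2 P).
Hypothesis gpK : forall n q m, gp n q (gu n q m) = m.
Variables (kP : cmap P (single M)) (kI : cmap (single ounit) I) (kJ : cmap (single M) J).
Variable psi : cmap (tot P2 I) J.

(** The identity for [psi] is evaluated on the image of [t] under [gu]; naturality of the right unit
    moves [gu] next to [gp], which cancels it. *)
Lemma restrict_ident :
  deq (dloc (cmap_comp psi (tot_map (cmap_id P2) kI)))
    (dloc (cmap_comp (cmap_comp kJ (cmap_comp kP gp)) (right_unit P2))) ->
  forall n q (t : tot P (single ounit) n q),
  cd (tot P (single ounit)) n (n + 1) q t = 0 ->
  zcohom (stalk_map q (cmap_comp psi (tot_map gu (cmap_id I))) n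
      (stalk_map q (tot_map (cmap_id P) kI) n t))
    (stalk_map q kJ n (stalk_map q kP n (stalk_map q (right_unit P) n t))).
Proof.
move=> hpsi n q t dt.
pose e := tot_map gu (cmap_id (single (@ounit k X))).
have de : cd (tot P2 (single ounit)) n (n + 1) q (e n q t) = 0 by rewrite -cf_d dt oh0.
have := dloc_cohom hpsi de; set u := stalk_map q _ n _; set v := stalk_map q _ n _.
have -> : u = psi n q (tot_map gu (cmap_id I) n q (tot_map (cmap_id P) kI n q t)).
  by rewrite -tot_map_swap.
have -> // : v = kJ n q (kP n q (right_unit P n q t)).
by rewrite -[right_unit P n q t]gpK -right_unit_nat.
Qed.
End RestrictIdent.

Lemma graph_projection_qis (k : comPzRingType) (X Y : rfspace k) (f : rfmor X Y)
    (M : omod X) (P I J : cx X) (kP : cmap P (single M)) (kI : cmap (single ounit) I)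
    (kJ : cmap (single M) J)
    (psi : cmap (tot (pull_cx (graphS f) (pull_cx (proj1S X Y) P)) I) J) :
  finite_space X -> quasi_coherent M -> K_flat P -> K_injective I -> K_injective J ->
  quasi_iso kP -> quasi_iso kI -> quasi_iso kJ ->
  deq (dloc (cmap_comp psi (tot_map (cmap_id _) kI)))
    (dloc (cmap_comp (cmap_comp kJ (cmap_comp kP (graph_pull f P))) (right_unit _))) ->
  quasi_iso (cmap_comp (push_cmap (graphS f) psi)
    (projection (graphS f) (pull_cx (proj1S X Y) P) I)).
Proof.
move=> finX qcM fP iI iJ qP qI qJ hpsi; apply/quasi_isoP => z.
pose psi0 := cmap_comp psi (tot_map (graph_unit f P) (cmap_id I)).
have psi0E := restrict_ident (@graph_unitK _ _ _ f P) hpsi.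
have base x (h : spec z.1 x) : zqis (stalk_map z.1 (trans psi0 (spec x))).
  have [ci cs] := can_quasi_coherent h qcM.
  exact: (trans_base fP qP qI qJ (finX _ _ h) ci cs psi0E).
have qT := trans_qis fP iI iJ base (@graph_set_up _ _ _ f z) (@graph_set_sub _ _ _ f z).
(* Along [tot_graph], the composite at [z] becomes T_U for the open subset [graph_set f z]. *)
apply: (zqis_cancel_r (tot_graph_qis f z P I)).
apply: zqis_ext (zqis_comp (push_map_stalk_qis f z J) qT) => n t.
by apply/esym; apply: projection_graph.
Qed.

Theorem theorem3p6 (k : comPzRingType) (X Y : rfspace k)
    (finX : finite_space X) (finY : finite_space Y) (f : rfmor X Y)
    (M : omod X) (qcM : quasi_coherent M)
    (P : kflat_res (single M))
    (I : kinj_res (single (@ounit k X))) (J : kinj_res (single M))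
    (psi : cmap (Ltensor (Lpull (graphS f) (Lpull (proj1S X Y) P)) I) J)
    (hpsi : represents_ident psi) :
  disom (natural_morphism psi).
Proof.
move: psi hpsi.
unfold natural_morphism, represents_ident, graph_ident, Rpush, Ltensor, Lpull.
cbn [kflat_cx] => psi hpsi.
have q := graph_projection_qis finX qcM (@kflatP _ _ P) (@kinjP _ _ I) (@kinjP _ _ J)
  (@kfr_qis _ _ _ P) (@kir_qis _ _ _ I) (@kir_qis _ _ _ J) hpsi.
exact: (disom_quasi_iso q).
Qed.
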